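(* Let $u_0\in L^2(\Omega)\cap L^p(\Omega)$. Then the nonlocal $p$-biharmonic evolution equation with homogeneous Dirichlet boundary condition $$\begin{cases}\dfrac{\partial u}{\partial t}=-\Delta_{NL}\big(|\Delta_{NL}u|^{p-2}\Delta_{NL}u\big), & (x,t)\in\Omega\times(0,T),\\ u(x,t)=0, & x\notin \Omega,\ t\in(0,T),\\ u(x,0)=u_0(x), & x\in\Omega,\end{cases}$$ admits a unique solution, i.e. there exists a unique function $u\in C([0,T];L^2(\Omega))$ with $\frac{\partial u}{\partial t}\in L^2(Q_T)$ such that $$\frac{\partial u}{\partial t}=-\Delta_{NL}\big(|\Delta_{NL}\widetilde u|^{p-2}\Delta_{NL}\widetilde u\big)\quad\text{a.e. in }Q_T,$$ and $u(x,0)=u_0(x)$ for a.e. $x\in\Omega$.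
   Context: Standing assumptions: $N\ge 2$, $\Omega\subset\mathbb{R}^N$ is a bounded domain, $T>0$, $Q_T=\Omega\times(0,T)$, $1<p<+\infty$. The kernel $J:\mathbb{R}^N\to\mathbb{R}$ is a nonnegative continuous radial function with compact support $\mathrm{supp}(J)$. $\Omega_E\subset\mathbb{R}^N$ is a (sufficiently large) bounded domain with $\Omega+2\,\mathrm{supp}(J)\subset\Omega_E$. The nonlocal Laplacian is $$\Delta_{NL}v(x)=\int_{\Omega_E}J(x-y)\,(v(y)-v(x))\,dy .$$ For $u:\Omega\to\mathbb{R}$, $\widetilde u:\Omega_E\to\mathbb{R}$ denotes the zero extension: $\widetilde u=u$ on $\Omega$ and $\widetilde u=0$ on $\Omega_E\setminus\Omega$; for time-dependent functions the extension and $\Delta_{NL}$ act in the space variable. The Dirichlet condition is encoded by using $\widetilde u$ in the operator; the solution notion is the one written out in the claim. *)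

(* Defs.v *)
From HB Require Import structures.
From mathcomp Require Import all_boot all_order all_algebra.
From mathcomp Require Import all_classical all_reals all_analysis.

Set Implicit Arguments.
Unset Strict Implicit.
Unset Printing Implicit Defensive.

Import Order.TTheory GRing.Theory Num.Theory.
Import numFieldNormedType.Exports.

Local Open Scope classical_set_scope.
Local Open Scope ring_scope.

(* R^n is 'rV[R]_n with the product sigma-algebra, generated by the coordinate
   maps exactly as the library does for n.-tuple; this is the Borel
   sigma-algebra of R^n. *)
Definition rV_display : measure_display.
Proof. exact: default_measure_display. Qed.

Section measurable_rV.
Context {R : realType} (n : nat).

Let coors : 'I_n -> 'rV[R]_n -> R := fun i x => x ord0 i.

Let rV_set0 : g_sigma_preimage coors set0.
Proof. exact: sigma_algebra0. Qed.

Let rV_setC A : g_sigma_preimage coors A -> g_sigma_preimage coors (~` A).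
Proof. exact: sigma_algebraC. Qed.

Let rV_bigcup (F : _^nat) : (forall i, g_sigma_preimage coors (F i)) ->
  g_sigma_preimage coors (\bigcup_i (F i)).
Proof. exact: sigma_algebra_bigcup. Qed.

HB.instance Definition _ := @isMeasurable.Build rV_display
  'rV[R]_n (g_sigma_preimage coors) rV_set0 rV_setC rV_bigcup.

End measurable_rV.

Lemma measurable_rV_coord (R : realType) n (i : 'I_n) :
  measurable_fun setT (fun x : 'rV[R]_n => x ord0 i).
Proof.
move=> _ Y mY; rewrite setTI; apply: sub_sigma_algebra => /=.
rewrite -bigcup_seq/=; exists i => /=; first by rewrite mem_index_enum.
by exists Y => //; rewrite setTI.
Qed.

Lemma measurable_fun_rVP d (T : measurableType d) (R : realType) n
    (f : T -> 'rV[R]_n) :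
  (forall i, measurable_fun setT (fun x => f x ord0 i)) ->
  measurable_fun setT f.
Proof.
move=> mf _ Y mY; rewrite setTI; move: Y mY.
pose G := [set Y : set 'rV[R]_n | measurable (f @^-1` Y)].
suff : @measurable _ 'rV[R]_n `<=` G by [].
apply: smallest_sub.
  split.
  - by rewrite /G /= preimage_set0.
  - move=> A; rewrite /G /= setTD preimage_setC; exact: measurableC.
  - move=> F mF; rewrite /G /= preimage_bigcup; exact: bigcupT_measurable.
move=> Y; rewrite -bigcup_seq => -[i _ [A mA <-]].
rewrite /G /= setTI.
by have := mf i measurableT _ mA; rewrite setTI.
Qed.

Section lebesgue_rV.
Context {R : realType}.

Definition rV_cons n (z : measurableTypeR R * 'rV[R]_n) : 'rV[R]_n.+1 :=
  \row_i (if unlift ord0 i is Some j then z.2 ord0 j else z.1).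

Definition rV_uncons n (x : 'rV[R]_n.+1) : measurableTypeR R * 'rV[R]_n :=
  (x ord0 ord0, \row_i x ord0 (lift ord0 i)).

Lemma rV_consK n : cancel (@rV_cons n) (@rV_uncons n).
Proof.
move=> [a v]; congr pair; rewrite /= ?mxE ?unlift_none//.
by apply/rowP => i; rewrite !mxE liftK.
Qed.

Lemma measurable_rV_cons n : measurable_fun setT (@rV_cons n).
Proof.
apply: measurable_fun_rVP => i; rewrite /rV_cons.
under eq_fun do rewrite mxE.
case: unliftP => [j _|_]; last exact: measurable_fst.
apply: (measurableT_comp (measurable_rV_coord j)).
exact: measurable_snd.
Qed.

Lemma measurable_rV_uncons n : measurable_fun setT (@rV_uncons n).
Proof.
apply: measurable_fun_pair => /=; first exact: measurable_rV_coord.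
apply: measurable_fun_rVP => i; under eq_fun do rewrite mxE.
exact: measurable_rV_coord.
Qed.

Section step.
Context n (mu : {sigma_finite_measure set 'rV[R]_n -> \bar R}).

Definition lebesgue_rV_step : set 'rV[R]_n.+1 -> \bar R :=
  pushforward (@lebesgue_measure R \x mu)%E (@rV_cons n).

Let mrV_cons := @measurable_rV_cons n.

Let step0 : lebesgue_rV_step set0 = 0%E.
Proof. exact: measure0. Qed.

Let step_ge0 A : (0 <= lebesgue_rV_step A)%E.
Proof. exact: measure_ge0. Qed.

Let step_sigma_additive : semi_sigma_additive lebesgue_rV_step.
Proof. exact: measure_semi_sigma_additive. Qed.

HB.instance Definition _ := isMeasure.Build _ _ _ lebesgue_rV_step
  step0 step_ge0 step_sigma_additive.

Let step_sigma_finite : sigma_finite setT lebesgue_rV_step.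
Proof.
have /sigma_finiteP[F [TF ndF Foo]] := sigma_finiteT (@lebesgue_measure R).
have /sigma_finiteP[G [TG ndG Goo]] := sigma_finiteT mu.
exists (fun k => @rV_uncons n @^-1` (F k `*` G k)).
  rewrite -preimage_bigcup (_ : \bigcup_k _ = setT) ?preimage_setT//.
  rewrite -setXTT TF TG predeqE => -[x y]; split.
    by move=> [k _ []/= ? ?]; split; exists k.
  move=> [/= [k _ Fkx] [l _ Gly]]; exists (maxn k l) => //; split.
    by move: x Fkx; exact/subsetPset/ndF/leq_maxl.
  by move: y Gly; exact/subsetPset/ndG/leq_maxr.
move=> k; have [? ?] := Foo k; have [? ?] := Goo k.
have mFG : measurable (F k `*` G k) by exact: measurableX.
split; first by rewrite -[X in measurable X]setTI; exact: measurable_rV_uncons.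
rewrite /lebesgue_rV_step /pushforward -comp_preimage.
rewrite (_ : _ \o _ = id); last by apply/funext => z; rewrite /= rV_consK.
by rewrite preimage_id product_measure1E// lte_mul_pinfty// ge0_fin_numE.
Qed.

HB.instance Definition _ := Measure_isSigmaFinite.Build _ _ _ lebesgue_rV_step
  step_sigma_finite.

End step.

(* Lebesgue measure on R^n, as the iterated product of the Lebesgue measure on
   R; on R^0 it is the unit mass. *)
Fixpoint lebesgue_rV n : {sigma_finite_measure set 'rV[R]_n -> \bar R} :=
  if n is n'.+1 then lebesgue_rV_step (lebesgue_rV n') else \d_(0 : 'rV[R]_0).

End lebesgue_rV.
Arguments lebesgue_rV {R} n.

Lemma lebesgue_rV_box (R : realType) n (a b : 'rV[R]_n) :
  (forall i, a ord0 i <= b ord0 i) ->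
  lebesgue_rV n [set x | forall i, x ord0 i \in `]a ord0 i, b ord0 i]] =
  (\prod_i (b ord0 i - a ord0 i))%:E.
Proof.
elim: n a b => [|n ih] a b ab.
  rewrite big_ord0 /= diracE mem_set//; by case.
have -> : lebesgue_rV n.+1 = lebesgue_rV_step (lebesgue_rV n) :> (set _ -> _) by [].
rewrite /lebesgue_rV_step /pushforward.
pose tl (x : 'rV[R]_n.+1) : 'rV[R]_n := \row_i x ord0 (lift ord0 i).
have mbox (c d : 'rV[R]_n) :
    measurable [set x : 'rV[R]_n | forall i, x ord0 i \in `]c ord0 i, d ord0 i]].
  rewrite (_ : [set _ | _] = \bigcap_(i in [set: 'I_n])
      ((fun x : 'rV[R]_n => x ord0 i) @^-1` `]c ord0 i, d ord0 i])); last first.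
    by apply/seteqP; split => x /= h i; have := h i => //; apply.
  apply: fin_bigcap_measurable => // i _.
  rewrite -[X in measurable X]setTI; exact: measurable_rV_coord.
rewrite (_ : _ @^-1` _ = `]a ord0 ord0, b ord0 ord0] `*`
    [set x : 'rV[R]_n | forall i, x ord0 i \in `]tl a ord0 i, tl b ord0 i]]).
  rewrite product_measure1E//= ih; last by move=> i; rewrite !mxE.
  rewrite lebesgue_measure_itv/= lte_fin big_ord_recl EFinM.
  congr (_ * _)%E; last by congr EFin; apply: eq_bigr => i _; rewrite !mxE.
  by case: ltgtP (ab ord0) => // -> _; rewrite subrr.
apply/seteqP; split => [[s x] /= h|[s x] /= [h1 h2] i].
  split; first by have := h ord0; rewrite mxE unlift_none.
  by move=> i; have := h (lift ord0 i); rewrite !mxE liftK.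
rewrite mxE; case: unliftP => [j|] -> //; by have := h2 j; rewrite !mxE.
Qed.

Section notions.
Context {R : realType}.

Definition supp (T : topologicalType) (f : T -> R) : set T :=
  closure [set x | f x != 0].

Definition zext (T : Type) (D : set T) (f : T -> R) : T -> R :=
  patch (fun=> 0) D f.

(* L^p(D), for measurable D, realised through zero extension. *)
Definition LpOn d (T : measurableType d) (mu : {measure set T -> \bar R})
    (D : set T) (p : R) : set (T -> R) :=
  [set f | zext D f \in Lfun mu p%:E].

Definition LpNorm_on d (T : measurableType d) (mu : {measure set T -> \bar R})
    (D : set T) (p : R) (f : T -> R) : \bar R :=
  ('N[mu]_p%:E[EFin \o zext D f])%E.

Definition is_domain (T : topologicalType) (D : set T) :=
  [/\ D !=set0, open D & connected D].

(* The norm of 'rV[R]_n is the sup norm, hence this separate definition. *)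
Definition euclidean_norm n (x : 'rV[R]_n) : R :=
  Num.sqrt (\sum_i x ord0 i ^+ 2).

Definition radial n (J : 'rV[R]_n -> R) :=
  exists j : R -> R, forall x, J x = j (euclidean_norm x).

End notions.

Section nonlocal.
Context {R : realType} {N : nat}.
Implicit Types (J v : 'rV[R]_N -> R) (E Omega : set 'rV[R]_N).

Definition NL_integrand J v (x y : 'rV[R]_N) : R := J (x - y) * (v y - v x).

Definition NL_laplacian J E v (x : 'rV[R]_N) : R :=
  \int[lebesgue_rV N]_(y in E) NL_integrand J v x y.

(* NL_laplacian takes a junk value where this fails. *)
Definition NL_defined_at J E v (x : 'rV[R]_N) : Prop :=
  (lebesgue_rV N).-integrable E (EFin \o NL_integrand J v x).

(* |s|^(p-2) s, with value 0 at s = 0 also when p < 2. *)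
Definition p_power (p s : R) : R := `|s| `^ (p - 2) * s.

Definition p_flux J E Omega p v : 'rV[R]_N -> R :=
  fun x => p_power p (NL_laplacian J E (zext Omega v) x).

(* A function of (x, t) is written u : R -> 'rV[R]_N -> R, so that u t is the
   slice u(., t). *)
Implicit Types u g : R -> 'rV[R]_N -> R.

Definition spacetime_measure :
    set ('rV[R]_N * measurableTypeR R) -> \bar R :=
  (lebesgue_rV N \x @lebesgue_measure R)%E.
HB.instance Definition _ := Measure.on spacetime_measure.

Definition cylinder E (T : R) : set ('rV[R]_N * measurableTypeR R) :=
  E `*` `]0, T[.

Definition uncurry_xt u : 'rV[R]_N * measurableTypeR R -> R :=
  fun z => u z.2 z.1.

(* u is in C([0,T]; L^2(Omega)); the joint measurability only selects a
   representative of the classes u t, so that u is a function on Q_T. *)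
Definition C_L2 Omega (T : R) u :=
  [/\ measurable_fun (cylinder Omega T) (uncurry_xt u),
      forall t, t \in `[0, T] -> LpOn (lebesgue_rV N) Omega 2 (u t) &
      forall t, t \in `[0, T] ->
        LpNorm_on (lebesgue_rV N) Omega 2 (u s \- u t)
          @[s --> within `[0, T] (nbhs t)] --> 0%E].

(* C_c^oo(0,T) *)
Definition test_function (T : R) (phi : R -> R) :=
  [/\ forall n s, derivable (derive1n n phi) s 1,
      compact (supp phi) & supp phi `<=` `]0, T[].

(* g is the weak derivative of the L^2(Omega)-valued function u: for each test
   function phi, \int phi' u dt = - \int phi g dt in L^2(Omega). *)
Definition weak_time_derivative Omega (T : R) u g :=
  forall phi, test_function T phi ->
    {ae lebesgue_rV N, forall x, Omega x ->
      \int[lebesgue_measure]_(t in `]0, T[) (derive1 phi t * u t x) =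
      - \int[lebesgue_measure]_(t in `]0, T[) (phi t * g t x)}.

(* The second clause says that the outer operator makes sense, as a function on
   E, for a.e. time; the inner one is defined everywhere when J is bounded, E
   has finite measure and u t is in L^2(Omega). *)
Definition is_solution J Omega E (p T : R) (u0 : 'rV[R]_N -> R) u :=
  [/\ C_L2 Omega T u,
      {ae spacetime_measure, forall z, cylinder E T z ->
        NL_defined_at J E (p_flux J E Omega p (u z.2)) z.1},
      exists g, [/\ LpOn spacetime_measure (cylinder Omega T) 2 (uncurry_xt g),
        weak_time_derivative Omega T u g &
        {ae spacetime_measure, forall z, cylinder Omega T z ->
          g z.2 z.1 = - NL_laplacian J E (p_flux J E Omega p (u z.2)) z.1}] &
      {ae lebesgue_rV N, forall x, Omega x -> u 0 x = u0 x}].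

End nonlocal.

(* Main.v *)
Require Import Defs.
From mathcomp Require Import all_boot all_order all_algebra.
From mathcomp Require Import all_classical all_reals all_analysis.
From mathcomp Require Import measurable_realfun ring lra.
Import Order.TTheory GRing.Theory Num.Theory.
Import numFieldNormedType.Exports.
Local Open Scope classical_set_scope.
Local Open Scope ring_scope.

Set Implicit Arguments.
Unset Strict Implicit.
Unset Printing Implicit Defensive.

(** Write D for the nonlocal Laplacian on the finite measure space E and w = phi (D u) for the flux,
    phi s = |s|^(p - 2) s.  The equation u' = - D w on Omega, with u = 0 outside Omega, is the
    gradient flow in L^2 of the convex energy that integrates |D u|^p / p, because the kernel
    J (x - y) is symmetric.  It is studied for an abstract kernel k, measurable, bounded, symmetric and
    nonnegative, and for an arbitrary continuous nondecreasing phi with phi 0 = 0.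

    Existence.  The nonlinearity is replaced by its Yosida approximation, which is Lipschitz, and
    the regularised equation is solved by Picard iteration (picard).  The gradient structure
    bounds the L^2 norm of u at each time (approx_energy) and the L^2 norm of u' in space-time
    (approx_dissipation); the initial energy is finite because u0 is in L^p and D is bounded.
    These bounds do not control w in L^2, which passing to the limit requires.
    That control comes from the nonlocal structure: D w = K w - degree * w with K a bounded
    integral operator, so on Omega the equation gives w as (K w + u') / degree, where
    K w is bounded by the L^1 norm of w, itself controlled by the power; outside
    Omega, D u = K u is bounded (approx_flux_bound).  Almost monotonicity of the Yosida
    approximations then makes the approximate solutions Cauchy in L^2 uniformly in time, and
    the limit solves the integral equation u t = u0 + the primitive of - D w (core_existence).

    The division by the degree requires a positive lower bound on Omega.  It holds unless J
    vanishes: E is connected, meets every neighbourhood of each point x of the closure of Omega and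
    contains a point at distance 2 |z0| from x for J z0 > 0, hence meets the sphere of
    radius |z0| about x, on which J (x - y) = J z0 (degree_lower_bound).

    Uniqueness.  A weakly differentiable and L^2-continuous u is the primitive of its weak
    derivative; this is proved by testing with differences of smooth steps (du_bois_reymond).
    The squared distance of two solutions then has derivative
    - 2 times the integral of (w1 - w2) (D u1 - D u2), which is nonpositive (weak_uniqueness).
    Moving D from one factor to the other requires the fluxes in L^2, whereas a solution is only
    assumed to have a flux for which D w makes sense; that w is in L^2 follows from the equation
    by the division by the degree used for existence, after a truncation argument that
    shows w integrable (flux_sqi).

    The last part identifies the solutions on Omega with those of the abstract problem
    on E (is_solution_weak, weak_is_solution). *)

(** * Integrable and square-integrable functions *)

Section toolbox.
Context d (X : measurableType d) (R : realType) (mu : {measure set X -> \bar R}).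
Implicit Types f g : X -> R.

(** Only integrals over the whole space occur below: a domain of integration
    is encoded by restricting the measure, so that Fubini and the convergence
    theorems apply without side conditions on sets. *)
Definition itg f := mu.-integrable setT (EFin \o f).

Lemma itg_meas f : itg f -> measurable_fun setT f.
Proof. by move=> /measurable_int/measurable_EFinP. Qed.

Lemma itg_le f g : measurable_fun setT f -> itg g ->
  (forall x, `|f x| <= g x) -> itg f.
Proof.
move=> mf ig fg; apply: (le_integrable measurableT _ _ ig).
  exact/measurable_EFinP.
by move=> x _ /=; rewrite lee_fin (le_trans (fg x))// ler_norm.
Qed.

Lemma itgD f g : itg f -> itg g -> itg (fun x => f x + g x).
Proof. by move=> fi gi; exact: (integrableD measurableT fi gi). Qed.

Lemma itgB f g : itg f -> itg g -> itg (fun x => f x - g x).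
Proof. by move=> fi gi; exact: (integrableB measurableT fi gi). Qed.

Lemma itgN f : itg f -> itg (fun x => - f x).
Proof. by move=> fi; exact: (integrableN fi). Qed.

Lemma itgZ f c : itg f -> itg (fun x => c * f x).
Proof. by move=> fi; exact: (integrableZl measurableT c fi). Qed.

Lemma itg_abs f : itg f -> itg (fun x => `|f x|).
Proof. by move=> fi; exact: (integrable_norm fi). Qed.

Lemma itg0 : itg (fun=> 0).
Proof. exact: integrable0. Qed.

Lemma itg_ext f g : f =1 g -> itg f -> itg g.
Proof. by move=> /funext ->. Qed.

Lemma RintD f g : itg f -> itg g ->
  \int[mu]_x (f x + g x) = \int[mu]_x f x + \int[mu]_x g x.
Proof. by move=> fi gi; rewrite RintegralD. Qed.

Lemma RintB f g : itg f -> itg g ->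
  \int[mu]_x (f x - g x) = \int[mu]_x f x - \int[mu]_x g x.
Proof. by move=> fi gi; rewrite RintegralB. Qed.

Lemma RintZ f c : itg f -> \int[mu]_x (c * f x) = c * \int[mu]_x f x.
Proof. by move=> fi; rewrite RintegralZl. Qed.

Lemma RintN f : itg f -> \int[mu]_x (- f x) = - \int[mu]_x f x.
Proof.
move=> fi; rewrite -mulN1r -RintZ//.
by apply: eq_Rintegral => x _; rewrite mulN1r.
Qed.

Lemma Rint_zero : \int[mu]_x (0 : R) = 0.
Proof. by rewrite /Rintegral integral0. Qed.

Lemma eq_Rint f g : f =1 g -> \int[mu]_x f x = \int[mu]_x g x.
Proof. by move=> fg; apply: eq_Rintegral => x _; rewrite fg. Qed.

Lemma Rint_ge0 f : (forall x, 0 <= f x) -> 0 <= \int[mu]_x f x.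
Proof. by move=> f0; exact: Rintegral_ge0. Qed.

Lemma le_Rint f g : itg f -> itg g -> (forall x, f x <= g x) ->
  \int[mu]_x f x <= \int[mu]_x g x.
Proof. by move=> fi gi fg; apply: le_Rintegral. Qed.

Lemma abs_Rint f : itg f -> `|\int[mu]_x f x| <= \int[mu]_x `|f x|.
Proof. by move=> fi; exact: le_normr_Rintegral. Qed.

Lemma abs_Rint_le f g : itg f -> itg g -> (forall x, `|f x| <= g x) ->
  `|\int[mu]_x f x| <= \int[mu]_x g x.
Proof.
move=> fi gi fg; apply: (le_trans (abs_Rint fi)).
by apply: le_Rint => //; exact: itg_abs.
Qed.

Lemma fin_Rint f : itg f -> (\int[mu]_x f x)%:E = (\int[mu]_x (f x)%:E)%E.
Proof. by move=> fi; rewrite /Rintegral fineK//; exact: integrable_fin_num. Qed.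

Lemma ae_eq_Rint f g : measurable_fun setT f -> measurable_fun setT g ->
  {ae mu, forall x, f x = g x} -> \int[mu]_x f x = \int[mu]_x g x.
Proof.
move=> mf mg fg; congr fine; apply: ae_eq_integral => //.
- exact/measurable_EFinP.
- exact/measurable_EFinP.
- by apply: filterS fg => x /= -> _.
Qed.

Lemma ae_eq_itg f g : measurable_fun setT g ->
  {ae mu, forall x, f x = g x} -> itg f -> itg g.
Proof.
move=> mg fg /integrableP[mf fi]; apply/integrableP; split.
  exact/measurable_EFinP.
rewrite (_ : integral _ _ _ = \int[mu]_x `|(f x)%:E|)%E//.
apply: ae_eq_integral => //.
- by apply: measurableT_comp => //; exact/measurable_EFinP.
- exact: measurableT_comp.
- by apply: filterS fg => x /= -> _.
Qed.

Lemma ae_le_Rint f g : itg f -> itg g -> {ae mu, forall x, f x <= g x} ->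
  \int[mu]_x f x <= \int[mu]_x g x.
Proof.
move=> fi gi fg.
have mf := itg_meas fi; have mg := itg_meas gi.
have mm : measurable_fun setT (fun x => Num.max (f x) (g x)) by exact: measurable_maxr.
have e : {ae mu, forall x, g x = Num.max (f x) (g x)}.
  by apply: filterS fg => x /max_idPr ->.
rewrite (ae_eq_Rint mg mm e); apply: le_Rint => //.
  exact: ae_eq_itg e gi.
by move=> x; rewrite le_max lexx.
Qed.

Lemma Rint_eq0_ae f : itg f -> (forall x, 0 <= f x) -> \int[mu]_x f x = 0 ->
  {ae mu, forall x, f x = 0}.
Proof.
move=> fi f0 f00.
have : (\int[mu]_x `|(EFin \o f) x| = 0)%E.
  transitivity (\int[mu]_x (f x)%:E)%E.
    by apply: eq_integral => x _ /=; rewrite ger0_norm.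
  by rewrite -fin_Rint// f00.
move=> /(ae_eq_integral_abs mu measurableT (measurable_int _ fi)).
by apply: filterS => x /= /(_ I) [].
Qed.

Lemma itg_ge0_fin f : measurable_fun setT f -> (forall x, 0 <= f x) ->
  (\int[mu]_x (f x)%:E < +oo)%E -> itg f.
Proof.
move=> mf f0 fi; apply/integrableP; split; first exact/measurable_EFinP.
rewrite (_ : integral _ _ _ = \int[mu]_x (f x)%:E)%E//.
by apply: eq_integral => x _ /=; rewrite ger0_norm.
Qed.

Definition sqi f := measurable_fun setT f /\ itg (fun x => f x ^+ 2).

Lemma sqi_le f g : measurable_fun setT f -> sqi g ->
  (forall x, `|f x| <= `|g x|) -> sqi f.
Proof.
move=> mf [mg ig] fg; split => //.
apply: (itg_le _ ig); first exact: measurable_funX.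
move=> x; rewrite ger0_norm ?sqr_ge0//.
by rewrite -(real_normK (num_real (f x))) -(real_normK (num_real (g x))) ler_sqr ?nnegrE.
Qed.

Lemma sqi_mul f g : sqi f -> sqi g -> itg (fun x => f x * g x).
Proof.
move=> [mf jf] [mg jg]; apply: (itg_le _ (itgD jf jg)).
  exact: measurable_funM.
move=> x; rewrite ler_norml; apply/andP; split; nra.
Qed.

Lemma sqiD f g : sqi f -> sqi g -> sqi (fun x => f x + g x).
Proof.
move=> [mf jf] [mg jg]; split; first exact: measurable_funD.
apply: (itg_le _ (itgZ 2 (itgD jf jg))).
  exact/measurable_funX/measurable_funD.
move=> x; rewrite ger0_norm ?sqr_ge0//; have := sqr_ge0 (f x - g x); nra.
Qed.

Lemma sqiZ f c : sqi f -> sqi (fun x => c * f x).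
Proof.
move=> [mf jf]; split; first exact: measurable_funM.
by apply: itg_ext (itgZ (c ^+ 2) jf) => x; rewrite exprMn.
Qed.

Lemma sqiN f : sqi f -> sqi (fun x => - f x).
Proof. by move=> h; rewrite (_ : (fun _ => _) = fun x => -1 * f x); [exact: sqiZ|apply/funext => x; rewrite mulN1r]. Qed.

Lemma sqiB f g : sqi f -> sqi g -> sqi (fun x => f x - g x).
Proof. by move=> h1 h2; apply: sqiD => //; exact: sqiN. Qed.

Lemma sqi_abs f : sqi f -> sqi (fun x => `|f x|).
Proof.
move=> h; apply: (sqi_le _ h); first exact: measurableT_comp h.1.
by move=> x; rewrite normr_id.
Qed.

(** A nonnegative quadratic polynomial has nonpositive discriminant. It is
    evaluated at its minimum, or, when C = 0, at a point that makes the linear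
    term negative. *)
Lemma disc_le (A B C : R) : 0 <= C -> (forall s, 0 <= A + 2 * s * B + s ^+ 2 * C) ->
  B ^+ 2 <= A * C.
Proof.
move=> C0 h; have [C00|Cn0] := eqVneq C 0.
  subst C; have [B0|Bn0] := eqVneq B 0; first by rewrite B0 expr0n mulr0.
  have A0 : 0 <= A by have := h 0; rewrite expr0n !(mulr0, mul0r, addr0).
  have := h (- (A + 1) / (2 * B)).
  have -> : A + 2 * (- (A + 1) / (2 * B)) * B + (- (A + 1) / (2 * B)) ^+ 2 * 0 = -1 by field.
  lra.
have Cp : 0 < C by rewrite lt_neqAle eq_sym Cn0.
have := h (- B / C).
have -> : A + 2 * (- B / C) * B + (- B / C) ^+ 2 * C = A - B ^+ 2 / C by field.
by rewrite subr_ge0 ler_pdivrMr.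
Qed.

Lemma cauchy_schwarz f g : sqi f -> sqi g ->
  (\int[mu]_x (f x * g x)) ^+ 2 <= (\int[mu]_x f x ^+ 2) * (\int[mu]_x g x ^+ 2).
Proof.
move=> hf hg; have hfg := sqi_mul hf hg; apply: disc_le.
  by apply: Rint_ge0 => x; exact: sqr_ge0.
move=> s; rewrite -mulrA -(RintZ _ hfg) -RintZ; last exact: itgZ.
rewrite -(RintZ _ hg.2) -RintD ?(hf.2)//; last by do 2 apply: itgZ.
rewrite -RintD; last 2 first.
  by apply: itgD; [exact: hf.2|do 2 apply: itgZ].
  by apply: itgZ; exact: hg.2.
apply: Rint_ge0 => x.
by rewrite (_ : _ + _ = (f x + s * g x) ^+ 2) ?sqr_ge0//; ring.
Qed.

(** Dominates f by the maximum of g and the norm of f, which agrees with g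
    almost everywhere. *)
Lemma itg_ae_le (f g : X -> R) : measurable_fun setT f -> itg g ->
  {ae mu, forall x, `|f x| <= g x} -> itg f.
Proof.
move=> mf ig fg; have ma : measurable_fun setT (fun x => `|f x|) by exact: measurableT_comp mf.
have mm : measurable_fun setT (fun x => Num.max (g x) `|f x|).
  by apply: measurable_maxr => //; exact: itg_meas ig.
apply: (itg_le mf (ae_eq_itg mm _ ig)).
  by apply: filterS fg => x /max_idPl ->.
by move=> x; rewrite le_max lexx orbT.
Qed.

Lemma sqi_ae_le (f g : X -> R) : measurable_fun setT f -> sqi g ->
  {ae mu, forall x, `|f x| <= `|g x|} -> sqi f.
Proof.
move=> mf [mg ig] fg; split => //; apply: itg_ae_le ig _; first exact: measurable_funX.
apply: filterS fg => x h; rewrite ger0_norm ?sqr_ge0//.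
by rewrite -(real_normK (num_real (f x))) -(real_normK (num_real (g x))) ler_sqr ?nnegrE.
Qed.

Lemma sqi_ae_eq (f g : X -> R) : measurable_fun setT g ->
  {ae mu, forall x, f x = g x} -> sqi f -> sqi g.
Proof. by move=> mg fg sf; apply: sqi_ae_le mg sf _; apply: filterS fg => x ->. Qed.

End toolbox.

Section finite.
Context d (X : measurableType d) (R : realType) (mu : {finite_measure set X -> \bar R}).
Implicit Types f g : X -> R.

Definition mass := fine (mu setT).

Lemma mass_ge0 : 0 <= mass. Proof. by rewrite /mass fine_ge0. Qed.

Lemma itg_cst c : itg mu (fun=> c).
Proof. by apply: finite_measure_integrable_cst. Qed.

Lemma Rint_cst c : \int[mu]_x c = c * mass.
Proof. by rewrite Rintegral_cst. Qed.

Lemma itg_bnd f c : measurable_fun setT f -> (forall x, `|f x| <= c) -> itg mu f.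
Proof. by move=> mf fc; apply: (itg_le mf (itg_cst c)). Qed.

Lemma sqi_cst c : sqi mu (fun=> c).
Proof. by split => //; exact: itg_cst. Qed.

Lemma sqi_bnd f c : measurable_fun setT f -> (forall x, `|f x| <= c) -> sqi mu f.
Proof. by move=> mf fc; apply: (sqi_le mf (sqi_cst c)) => x; rewrite (le_trans (fc x))// ler_norm. Qed.

Lemma sqi_itg f : sqi mu f -> itg mu f.
Proof.
move=> hf; have := sqi_mul hf (sqi_cst 1).
by apply: itg_ext => x; rewrite mulr1.
Qed.

Lemma sqr_Rint_abs_le f : sqi mu f ->
  (\int[mu]_x `|f x|) ^+ 2 <= mass * \int[mu]_x f x ^+ 2.
Proof.
move=> hf; have := cauchy_schwarz (sqi_abs hf) (sqi_cst 1).
rewrite (eq_Rint mu (g := fun x => `|f x|)); last by move=> x; rewrite mulr1.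
rewrite (eq_Rint mu (f := fun x => `|f x| ^+ 2) (g := fun x => f x ^+ 2)); last first.
  by move=> x; rewrite real_normK// num_real.
by rewrite Rint_cst expr1n mul1r mulrC.
Qed.

End finite.

(** * Functions of two variables and Fubini *)

Section measurability.
Context d1 d2 (X : measurableType d1) (Y : measurableType d2) (R : realType).

(** Functions of time y and space x are written time first, while the product
    measure has space first, as in the space-time cylinder. *)
Definition meas2 (u : Y -> X -> R) := measurable_fun setT (fun z : X * Y => u z.2 z.1).

Lemma meas2_comp d (Z : measurableType d) (u : Y -> X -> R) (f : Z -> Y) (g : Z -> X) :
  meas2 u -> measurable_fun setT f -> measurable_fun setT g ->
  measurable_fun setT (fun z => u (f z) (g z)).
Proof.
move=> mu mf mg.
exact: (measurableT_comp (f := fun z : X * Y => u z.2 z.1) (g := fun z => (g z, f z)) mu (measurable_fun_pair mg mf)).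
Qed.

Lemma meas2_1 (u : Y -> X -> R) y : meas2 u -> measurable_fun setT (u y).
Proof. by move=> mu; apply: (meas2_comp (f := cst y) (g := id) mu). Qed.

Lemma meas2_2 (u : Y -> X -> R) x : meas2 u -> measurable_fun setT (fun y => u y x).
Proof. by move=> mu; apply: (meas2_comp (f := id) (g := cst x) mu). Qed.

End measurability.

Section param.
Context d1 d2 (X : measurableType d1) (Y : measurableType d2) (R : realType).
Variable nu : {sigma_finite_measure set Y -> \bar R}.

Lemma meas_param (f : X -> Y -> R) :
  measurable_fun setT (fun z : X * Y => f z.1 z.2) ->
  measurable_fun setT (fun x => \int[nu]_y f x y).
Proof.
move=> mf; pose g (z : X * Y) := (f z.1 z.2)%:E.
have mg : measurable_fun setT g by exact/measurable_EFinP.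
apply: (measurableT_comp (f := @fine R)); first exact: fine_measurable.
have -> : (fun x => \int[nu]_y (f x y)%:E)%E =
   (fun x => fubini_F nu (g^\+)%E x - fubini_F nu (g^\-)%E x)%E.
  apply/funext => x; rewrite [LHS]integralE /fubini_F.
  by congr (_ - _)%E; apply: eq_integral => y _; rewrite ?funeposE ?funenegE /g.
apply: emeasurable_funB.
  by apply: measurable_fun_fubini_tonelli_F => //; exact: measurable_funepos.
by apply: measurable_fun_fubini_tonelli_F => //; exact: measurable_funeneg.
Qed.

End param.

Section prod.
Context d1 d2 (X : measurableType d1) (Y : measurableType d2) (R : realType).
Variables (mu : {sigma_finite_measure set X -> \bar R})
          (nu : {sigma_finite_measure set Y -> \bar R}).
Implicit Types u : Y -> X -> R.

Definition itg2 u := (mu \x nu)%E.-integrable setT (fun z => (u z.2 z.1)%:E).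

Lemma itg2_meas u : itg2 u -> meas2 u.
Proof. by move=> /measurable_int/measurable_EFinP. Qed.

Lemma meas_Rint1 u : meas2 u -> measurable_fun setT (fun y => \int[mu]_x u y x).
Proof.
move=> mu2; apply: (meas_param mu (f := fun y x => u y x)).
exact: (meas2_comp (f := fst) (g := snd) mu2).
Qed.

Lemma meas_Rint2 u : meas2 u -> measurable_fun setT (fun x => \int[nu]_y u y x).
Proof. by move=> mu2; apply: (meas_param nu (f := fun x y => u y x)). Qed.

Let fine_ae d (Z : measurableType d) (m : {measure set Z -> \bar R}) (F : Z -> \bar R) :
  m.-integrable setT F ->
  itg m (fine \o F) /\ (\int[m]_z (fine (F z))%:E = \int[m]_z F z)%E.
Proof.
move=> iF; have mF := measurable_int _ iF.
have mfF : measurable_fun setT (EFin \o (fine \o F)).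
  by apply/measurable_EFinP; apply: measurableT_comp => //; exact: fine_measurable.
have e : ae_eq m setT F (EFin \o (fine \o F)).
  by have := integrable_ae measurableT iF; apply: filterS => x /= h _; rewrite fineK// h.
split; last by apply: ae_eq_integral => //; exact: ae_eq_sym.
apply/integrableP; split => //.
have /integrableP[_] := iF; congr (_ < _)%E.
apply: ae_eq_integral => //; try exact: measurableT_comp.
by apply: filterS e => x /= h /h ->.
Qed.

Lemma itg2_Rint2 u : itg2 u -> itg mu (fun x => \int[nu]_y u y x).
Proof. by move=> /integrable_fubini_F/fine_ae[]. Qed.

Lemma itg2_ae1 u : itg2 u -> {ae nu, forall y, itg mu (u y)}.
Proof. by move=> /ae_integrable2. Qed.

(** The section u y is integrable only for almost every y; elsewhere the
    real-valued integral is an arbitrary finite number, so the bound by the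
    integral of the norms is used almost everywhere only. *)
Lemma itg2_Rint1 u : itg2 u -> itg nu (fun y => \int[mu]_x u y x).
Proof.
move=> iu; have mu2 := itg2_meas iu.
apply/integrableP; split; first by apply/measurable_EFinP; exact: meas_Rint1.
have /integrable21ltyP : (mu \x nu)%E.-integrable setT (fun z => (u z.2 z.1)%:E) by [].
move=> /(_ (measurable_int _ iu)); apply: le_lt_trans.
have mE : measurable_fun setT (fun z : X * Y => `|(u z.2 z.1)%:E|%E).
  by apply: measurableT_comp => //; exact: measurable_int iu.
apply: ae_ge0_le_integral => //.
- by apply: measurableT_comp => //; apply/measurable_EFinP; exact: meas_Rint1.
- by move=> y _; exact: integral_ge0.
- exact: (measurable_fun_fubini_tonelli_G (m1 := mu) _ mE).
- apply: filterS (itg2_ae1 iu) => y iy _ /=.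
  by rewrite EFin_normr_Rintegral//; apply: le_abse_integral => //; exact: measurable_int iy.
Qed.

Let fine_G u : itg2 u ->
  (\int[nu]_y (\int[mu]_x u y x)%:E = \int[nu]_y fubini_G mu (fun z => (u z.2 z.1)%:E) y)%E.
Proof.
move=> iu; have mu2 := itg2_meas iu.
apply: ae_eq_integral => //.
- by apply/measurable_EFinP; exact: meas_Rint1.
- exact: measurable_fubini_G iu.
- by apply: filterS (itg2_ae1 iu) => y iy _; rewrite fin_Rint.
Qed.

Lemma fubiniR u : itg2 u ->
  \int[mu]_x \int[nu]_y u y x = \int[nu]_y \int[mu]_x u y x.
Proof.
move=> iu; rewrite {1 3}/Rintegral; congr fine.
rewrite (fine_ae (integrable_fubini_F iu)).2 (fine_G iu).
exact: (Fubini iu).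
Qed.

Lemma itg2_prodE u : itg2 u ->
  fine (\int[(mu \x nu)%E]_z (u z.2 z.1)%:E)%E = \int[nu]_y \int[mu]_x u y x.
Proof.
move=> iu; rewrite -(integral21_prod_meas1 iu) [RHS]/Rintegral.
by congr fine; rewrite -(fine_G iu).
Qed.

Lemma itg2_ae2 u : itg2 u -> {ae mu, forall x, itg nu (fun y => u y x)}.
Proof. by move=> /ae_integrable1. Qed.

Lemma itg2_le u v : meas2 u -> itg2 v -> (forall y x, `|u y x| <= v y x) -> itg2 u.
Proof. by move=> mu2 iv uv; apply: (itg_le (mu := (mu \x nu)%E) (f := fun z => u z.2 z.1) mu2 iv) => z. Qed.

Lemma itg2_tonelli u : meas2 u -> {ae nu, forall y, itg mu (u y)} ->
  itg nu (fun y => \int[mu]_x `|u y x|) -> itg2 u.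
Proof.
move=> mu2 iu inu; apply/integrable21ltyP; first exact/measurable_EFinP.
have /integrableP[_] := inu; congr (_ < _)%E.
have mm : measurable_fun setT (fun y => \int[mu]_x `|(u y x)%:E|)%E.
  apply: (measurable_fun_fubini_tonelli_G (m1 := mu) (fun z => `|(u z.2 z.1)%:E|)%E) => //.
  by apply: measurableT_comp => //; exact/measurable_EFinP.
apply: ae_eq_integral => //.
- apply: measurableT_comp => //; apply: measurable_int inu.
- apply: filterS iu => y iy _ /=.
  rewrite ger0_norm ?Rint_ge0// fin_Rint//; exact: itg_abs.
Qed.

Lemma itg2_mul u (f : X -> R) (g : Y -> R) : meas2 u -> itg mu f -> itg nu g ->
  (forall y x, `|u y x| <= g y * f x) -> itg2 u.
Proof.
move=> mu2 iff ig uf.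
have iu y : itg mu (u y).
  by apply: (itg_le (meas2_1 _ mu2) (itgZ (g y) iff)) => x; exact: uf.
apply: itg2_tonelli => //; first by apply: aeW => y; exact: iu.
apply: (itg_le _ (itgZ (\int[mu]_x `|f x|) (itg_abs ig))).
  apply: meas_Rint1; apply: measurableT_comp => //.
move=> y; rewrite ger0_norm ?Rint_ge0// mulrC -RintZ; last exact: itg_abs.
apply: le_Rint; first exact: itg_abs.
  by apply: itgZ; exact: itg_abs.
by move=> x; rewrite (le_trans (uf y x))// -normrM ler_norm.
Qed.

(** An iterated null set need not be measurable in the product; stating the
    property as the vanishing of a jointly measurable function makes Tonelli
    applicable to its norm. *)
Lemma ae_prod_swap u : meas2 u ->
  {ae nu, forall y, {ae mu, forall x, u y x = 0}} ->
  {ae (mu \x nu)%E, forall z, u z.2 z.1 = 0}.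
Proof.
move=> mu2 h.
have mE : measurable_fun setT (fun z : X * Y => `|(u z.2 z.1)%:E|%E).
  by apply: measurableT_comp => //; exact/measurable_EFinP.
have h0 : (\int[(mu \x nu)%E]_z `|(u z.2 z.1)%:E| = 0)%E.
  rewrite fubini_tonelli2// /fubini_G.
  rewrite (ae_eq_integral (cst 0%E))//; first by rewrite integral0.
    exact: (measurable_fun_fubini_tonelli_G (m1 := mu) (fun z => `|(u z.2 z.1)%:E|)%E).
  apply: filterS h => y hy _ /=.
  rewrite (ae_eq_integral (cst 0%E))//; first by rewrite integral0.
    by apply/measurable_EFinP; apply: measurableT_comp => //; exact: (meas2_1 y mu2).
  by apply: filterS hy => x /= -> _; rewrite normr0.
have me : measurable_fun setT (fun z : X * Y => (u z.2 z.1)%:E) by exact/measurable_EFinP.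
have := (ae_eq_integral_abs (mu \x nu)%E measurableT me).1 h0.
by apply: filterS => z /= /(_ I) [].
Qed.

Lemma ae_prod_12 u : meas2 u ->
  {ae (mu \x nu)%E, forall z, u z.2 z.1 = 0} ->
  {ae mu, forall x, {ae nu, forall y, u y x = 0}} /\
  {ae nu, forall y, {ae mu, forall x, u y x = 0}}.
Proof.
move=> mu2 h.
have me : measurable_fun setT (fun z : X * Y => (u z.2 z.1)%:E) by exact/measurable_EFinP.
have mE : measurable_fun setT (fun z : X * Y => `|(u z.2 z.1)%:E|%E) by exact: measurableT_comp.
have h0 : (\int[(mu \x nu)%E]_z `|(u z.2 z.1)%:E| = 0)%E.
  apply/(ae_eq_integral_abs (mu \x nu)%E measurableT me).
  by apply: filterS h => z /= -> _.
split.
- have h1 := h0; rewrite fubini_tonelli1// /fubini_F in h1.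
  have : {ae mu, forall x, (\int[nu]_y `|(u y x)%:E| = 0)%E}.
    have mF := measurable_fun_fubini_tonelli_F (m2 := nu) _ mE (fun z => abse_ge0 _).
    have := (ae_eq_integral_abs mu measurableT mF).1.
    have -> : (\int[mu]_x `|fubini_F nu (fun z : X * Y => `|(u z.2 z.1)%:E|) x| = 0)%E.
      by rewrite -[RHS]h1; apply: eq_integral => x _; rewrite gee0_abs// integral_ge0.
    by move=> /(_ erefl); apply: filterS => x /= /(_ I).
  apply: filterS => x hx.
  have mx : measurable_fun setT (fun y => (u y x)%:E) by apply/measurable_EFinP; exact: meas2_2.
  have := (ae_eq_integral_abs nu measurableT mx).1 hx.
  by apply: filterS => y /= /(_ I) [].
- have h1 := h0; rewrite fubini_tonelli2// /fubini_G in h1.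
  have : {ae nu, forall y, (\int[mu]_x `|(u y x)%:E| = 0)%E}.
    have mF := measurable_fun_fubini_tonelli_G (m1 := mu) _ mE (fun z => abse_ge0 _).
    have := (ae_eq_integral_abs nu measurableT mF).1.
    have -> : (\int[nu]_y `|fubini_G mu (fun z : X * Y => `|(u z.2 z.1)%:E|) y| = 0)%E.
      by rewrite -[RHS]h1; apply: eq_integral => x _; rewrite gee0_abs// integral_ge0.
    by move=> /(_ erefl); apply: filterS => x /= /(_ I).
  apply: filterS => y hy.
  have mx : measurable_fun setT (fun x => (u y x)%:E) by apply/measurable_EFinP; exact: (meas2_1 y mu2).
  have := (ae_eq_integral_abs mu measurableT mx).1 hy.
  by apply: filterS => x /= /(_ I) [].
Qed.

End prod.

(** * Yosida approximation of a nondecreasing function *)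

Section yosida.
Context (R : realType) (phi : R -> R).
Hypothesis phi_cont : continuous phi.
Hypothesis phi_nd : {homo phi : x y / x <= y}.
Hypothesis phi0 : phi 0 = 0.

Definition resolvent (l s : R) : R := xget 0 [set r | r + l * phi r = s].

(** The Yosida approximation: phi composed with the inverse of id + l phi. It
    keeps the sign and the monotonicity of phi, and it is Lipschitz with
    constant 1 / l, so that the regularised equation is an ordinary
    differential equation. *)
Definition yos (l s : R) : R := phi (resolvent l s).

Lemma phi_sign s : 0 <= s * phi s.
Proof.
have [s0|s0] := lerP 0 s.
  by apply: mulr_ge0 => //; rewrite -phi0; exact: phi_nd.
by rewrite nmulr_rge0// -phi0; apply: phi_nd; exact: ltW.
Qed.

Context (l : R).
Hypothesis l0 : 0 < l.

Lemma resolventP s : resolvent l s + l * yos l s = s.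
Proof.
suff : [set r | r + l * phi r = s] (resolvent l s) by [].
apply: xgetPex.
have cf a b : {within `[a, b], continuous (fun r => r + l * phi r)}.
  apply: continuous_subspaceT => x.
  apply: cvgD; first exact: cvg_id.
  by apply: cvgM; [exact: cvg_cst|exact: phi_cont].
have [s0|s0] := lerP 0 s.
  have ps : 0 <= phi s by rewrite -phi0; exact: phi_nd.
  have := @IVT _ (fun r => r + l * phi r) 0 s s s0 (cf _ _).
  rewrite phi0 mulr0 addr0 => -[|c _ <-]; last by exists c.
  have lp : 0 <= l * phi s by rewrite mulr_ge0// ltW.
  by rewrite min_l ?max_r ?addr_ge0// s0 lerDl lp.
have ps : phi s <= 0 by rewrite -[leRHS]phi0; apply: phi_nd; exact: ltW.
have := @IVT _ (fun r => r + l * phi r) s 0 s (ltW s0) (cf _ _).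
rewrite phi0 mulr0 addr0 => -[|c _ <-]; last by exists c.
have lp : l * phi s <= 0 by rewrite pmulr_rle0.
have h1 : s + l * phi s <= s by rewrite gerDl.
by rewrite ge_min le_max h1 (ltW s0) orbT.
Qed.

Let lnd r r' : r <= r' -> l * phi r <= l * phi r'.
Proof. by move=> rr; rewrite ler_pM2l// phi_nd. Qed.

Lemma resolvent_nd : {homo resolvent l : s s' / s <= s'}.
Proof.
move=> s s' ss; rewrite leNgt; apply/negP => h.
have := lnd (ltW h); have := resolventP s; have := resolventP s'; rewrite /yos; lra.
Qed.

Lemma yos_nd : {homo yos l : s s' / s <= s'}.
Proof. by move=> s s' ss; apply: phi_nd; exact: resolvent_nd. Qed.

Lemma yos_lip s s' : `|yos l s - yos l s'| <= l^-1 * `|s - s'|.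
Proof.
rewrite -(ler_pM2l l0) mulrA divff ?gt_eqF// mul1r.
wlog ss : s s' / s <= s' => [h|].
  have [/h//|/ltW/h] := leP s s'.
  by rewrite distrC [in leRHS]distrC.
have h2 := resolvent_nd ss; have h1 := yos_nd ss.
rewrite ler0_norm ?subr_le0// ler0_norm ?subr_le0//.
have := resolventP s; have := resolventP s'; lra.
Qed.

Lemma yos0 : yos l 0 = 0.
Proof.
have := resolventP 0; rewrite /yos; set r := resolvent l 0 => h.
have [r0|r0] := lerP 0 r.
  have : 0 <= phi r by rewrite -phi0; exact: phi_nd.
  rewrite le_eqVlt => /predU1P[//|p0].
  have : 0 < l * phi r by rewrite mulr_gt0.
  lra.
have : phi r <= 0 by rewrite -[leRHS]phi0; apply: phi_nd; exact: ltW.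
rewrite le_eqVlt => /predU1P[//|p0].
have : l * phi r < 0 by rewrite pmulr_rlt0.
lra.
Qed.

Lemma resolvent_ge0 s : 0 <= s -> 0 <= resolvent l s <= s.
Proof.
move=> s0; have y0 : 0 <= yos l s by rewrite -yos0; exact: yos_nd.
have ly : 0 <= l * yos l s by rewrite mulr_ge0// ltW.
have := resolventP s; have := resolventP 0; rewrite yos0 mulr0 addr0 => h0 h.
apply/andP; split; last lra.
by rewrite -[leLHS]h0; exact: resolvent_nd.
Qed.

Lemma resolvent_le0 s : s <= 0 -> s <= resolvent l s <= 0.
Proof.
move=> s0; have y0 : yos l s <= 0 by rewrite -yos0; exact: yos_nd.
have ly : l * yos l s <= 0 by rewrite pmulr_rle0.
have := resolventP s; have := resolventP 0; rewrite yos0 mulr0 addr0 => h0 h.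
apply/andP; split; first lra.
by rewrite -[leRHS]h0; exact: resolvent_nd.
Qed.

Lemma yos_sign s : 0 <= s * yos l s.
Proof.
have [s0|/ltW s0] := lerP 0 s.
  by apply: mulr_ge0 => //; rewrite -yos0; exact: yos_nd.
by apply: mulr_le0 => //; rewrite -[leRHS]yos0; exact: yos_nd.
Qed.

Lemma yos_le s : `|yos l s| <= `|phi s|.
Proof.
have [s0|/ltW s0] := lerP 0 s.
  have /andP[r0 rs] := resolvent_ge0 s0.
  by rewrite !ger0_norm /yos ?phi_nd// -phi0; exact: phi_nd.
have /andP[r0 rs] := resolvent_le0 s0.
have h1 : phi s <= 0 by rewrite -[leRHS]phi0 phi_nd.
have h2 : yos l s <= 0 by rewrite -[leRHS]phi0 /yos phi_nd.
by rewrite !ler0_norm// lerN2 phi_nd.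
Qed.

Lemma yos_mul_le s : s * yos l s <= s * phi s.
Proof.
rewrite -(ger0_norm (yos_sign s)) -(ger0_norm (phi_sign s)) !normrM.
by rewrite ler_wpM2l// yos_le.
Qed.

Definition phi_one := `|phi 1| + `|phi (-1)|.

(** For |s| <= 1 the value is bounded by those of phi at 1 and -1; for |s| > 1
    it is at most s times itself in absolute value. This turns a bound on the
    power w z into an L^1 bound on the flux w. *)
Lemma yos_absorb s : `|yos l s| <= phi_one + s * yos l s.
Proof.
have [s1|s1] := lerP `|s| 1.
  have h : `|phi s| <= phi_one.
    move: s1; rewrite ler_norml => /andP[s1 s2].
    have := phi_nd s1; have := phi_nd s2.
    have : 0 <= phi 1 by rewrite -phi0 phi_nd.
    have : phi (-1) <= 0 by rewrite -[leRHS]phi0 phi_nd// lerN10.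
    rewrite /phi_one => a b c e; rewrite (ger0_norm b) (ler0_norm a) ler_norml.
    by apply/andP; split; lra.
  by rewrite (le_trans (yos_le s))// (le_trans h)// lerDl yos_sign.
have p0 : 0 <= phi_one by rewrite addr_ge0.
rewrite -(ger0_norm (yos_sign s)) normrM.
have : `|yos l s| <= `|s| * `|yos l s| by rewrite ler_peMl// ltW.
lra.
Qed.

End yosida.

Section yosida2.
Context (R : realType) (phi : R -> R).
Hypothesis phi_cont : continuous phi.
Hypothesis phi_nd : {homo phi : x y / x <= y}.
Hypothesis phi0 : phi 0 = 0.

(** With r and r' the resolvents, z - z' = (r - r') + l y - l' y'. The first
    term pairs with y - y' monotonically, and the others are small with l and
    l'. This makes the approximations a Cauchy family. *)
Lemma yos_almost_monotone l l' z z' : 0 < l -> 0 < l' ->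
  - ((l + l') * (yos phi l z ^+ 2 + yos phi l' z' ^+ 2)) <=
  (yos phi l z - yos phi l' z') * (z - z').
Proof.
move=> l0 l0'.
have := resolventP phi_cont phi_nd phi0 l0 z.
have := resolventP phi_cont phi_nd phi0 l0' z'.
rewrite /yos; set r := resolvent phi l z; set r' := resolvent phi l' z'.
have mono : 0 <= (phi r - phi r') * (r - r').
  have [h|/ltW h] := leP r r'.
    by apply: mulr_le0; rewrite subr_le0// phi_nd.
  by apply: mulr_ge0; rewrite subr_ge0// phi_nd.
move: mono; set y := phi r; set y' := phi r' => mono <- <-.
have h1 : 0 <= (l + l') * (y - y') ^+ 2 by rewrite mulr_ge0 ?sqr_ge0// addr_ge0 ?ltW.
have h2 : 0 <= l * y ^+ 2 by rewrite mulr_ge0 ?sqr_ge0// ltW.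
have h3 : 0 <= l' * y' ^+ 2 by rewrite mulr_ge0 ?sqr_ge0// ltW.
have h4 : 0 <= l * y' ^+ 2 by rewrite mulr_ge0 ?sqr_ge0// ltW.
have h5 : 0 <= l' * y ^+ 2 by rewrite mulr_ge0 ?sqr_ge0// ltW.
lra.
Qed.

(** Since the approximation is bounded by |phi|, l times it tends to 0, hence
    the resolvent of z tends to z0, and phi is continuous. *)
Lemma yos_cvg (l z : R^nat) (z0 : R) : (forall n, 0 < l n) ->
  l @ \oo --> 0 -> z @ \oo --> z0 -> (yos phi (l n) (z n)) @[n --> \oo] --> phi z0.
Proof.
move=> l0 cl cz.
have cphi : phi (z n) @[n --> \oo] --> phi z0.
    by apply: continuous_cvg => //; exact: phi_cont.
have cly : (l n * yos phi (l n) (z n)) @[n --> \oo] --> 0.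
  apply/cvgr0Pnorm_le => e e0.
  have b : \forall n \near \oo, `|phi (z n)| <= `|phi z0| + 1.
    by apply: (cvgr_le `|phi z0|); [exact: cvg_norm|rewrite ltrDl].
  have dl : 0 < e / (`|phi z0| + 1) by rewrite divr_gt0// ltr_wpDl.
  move/cvgr0Pnorm_le : cl => /(_ _ dl); apply: filterS2 b => n h1 h2.
  rewrite normrM -(@divfK _ (`|phi z0| + 1) _ e) ?gt_eqF ?ltr_wpDl//.
  by rewrite ler_pM// (le_trans (yos_le _ _ _ _ _)).
have cr : resolvent phi (l n) (z n) @[n --> \oo] --> z0.
  have -> : (fun n => resolvent phi (l n) (z n)) = (fun n => z n - l n * yos phi (l n) (z n)).
    apply/funext => n; have := resolventP phi_cont phi_nd phi0 (l0 n) (z n); lra.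
  by rewrite -[z0]subr0; exact: cvgB.
by apply: continuous_cvg => //; exact: phi_cont.
Qed.

End yosida2.

(** * Restricted measures *)

Section restriction.
Context d (X : measurableType d) (R : realType) (m : {measure set X -> \bar R}).
Variables (D : set X) (mD : measurable D) (mfin : (m D < +oo)%E).
Let mr : {finite_measure set X -> \bar R} := mfrestr mD mfin.

Let ge0_integral_restr (f : X -> \bar R) : measurable_fun setT f -> (forall x, 0 <= f x)%E ->
  (\int[mr]_x f x = \int[m]_(x in D) f x)%E.
Proof.
move=> mf f0.
rewrite (@ge0_negligible_integral _ _ _ mr setT (~` D))//; last 2 first.
- exact: measurableC.
- by rewrite /mr /= /mfrestr /mrestr setICl measure0.
rewrite setTD setCK; apply: eq_measure_integral => A mA AD.
by rewrite /mr /= /mfrestr /mrestr (setIidl AD).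
Qed.

Lemma integral_restr (f : X -> \bar R) : measurable_fun setT f ->
  (\int[mr]_x f x = \int[m]_(x in D) f x)%E.
Proof.
move=> mf; rewrite [LHS]integralE [RHS]integralE.
by rewrite !ge0_integral_restr//; [exact: measurable_funeneg|exact: measurable_funepos].
Qed.

Lemma Rint_restr (f : X -> R) : measurable_fun setT f ->
  \int[mr]_x f x = \int[m]_(x in D) f x.
Proof. by move=> mf; rewrite /Rintegral integral_restr//; exact/measurable_EFinP. Qed.

Lemma itg_restr (f : X -> R) : measurable_fun setT f ->
  itg mr f <-> m.-integrable D (EFin \o f).
Proof.
move=> mf; have mf' : measurable_fun setT (EFin \o f) by exact/measurable_EFinP.
split => /integrableP[_ h]; apply/integrableP; split => //.
- exact: measurable_funTS.
- by rewrite -integral_restr//; exact: measurableT_comp.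
- by rewrite integral_restr//; exact: measurableT_comp.
Qed.

Lemma ae_restr (P : X -> Prop) : {ae m, forall x, D x -> P x} <-> {ae mr, forall x, P x}.
Proof.
split => -[N [mN N0 sN]].
- exists (N `|` ~` D); split; first by apply: measurableU => //; exact: measurableC.
    rewrite /mr /= /mfrestr /mrestr setIUl setICl setU0.
    apply/eqP; rewrite eq_le measure_ge0 andbT -N0.
    by apply: le_measure; rewrite ?inE//; exact: measurableI.
  move=> x /= nP; have [Dx|nDx] := pselect (D x); last by right.
  by left; apply: sN => /= h; apply: nP; exact: h.
- exists (N `&` D); split; first exact: measurableI.
    exact: N0.
  move=> x /= nP; have Dx : D x by apply: contrapT => nD; apply: nP => /nD.
  by split => //; apply: sN => /= Px; apply: nP.
Qed.

End restriction.

(** * Primitives in time *)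

Lemma is_derive_continuous (R : realType) (f F : R -> R) :
  (forall x : R, is_derive x 1 F (f x)) -> continuous F.
Proof.
by move=> dF x; apply/differentiable_continuous/derivable1_diffP; have [] := dF x.
Qed.

Lemma smooth_continuous (R : realType) (f : R -> R) n :
  (forall m (x : R), derivable (derive1n m f) x 1) -> continuous (derive1n n f).
Proof. by move=> df x; apply/differentiable_continuous/derivable1_diffP. Qed.

Section antiderivative.
Context (R : realType).
Implicit Types f F : R -> R.
Notation leb := (@lebesgue_measure R).

Lemma cont_itv_itg f (a b : R) : continuous f ->
  leb.-integrable `[a, b] (EFin \o f).
Proof.
move=> cf; apply: continuous_compact_integrable; first exact: segment_compact.
exact: continuous_subspaceT.
Qed.

(** The integral from 0 is split by the sign of its endpoint; near x it
    differs by a constant from an integral with a fixed base point to the left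
    of x, to which the fundamental theorem applies. *)
Lemma antiderivative f : continuous f -> exists F, forall x : R, is_derive x 1 F (f x).
Proof.
move=> cf.
pose F x := \int[leb]_(t in `[0, x]) f t - \int[leb]_(t in `[x, 0]) f t.
exists F => x; pose A : R := `|x| + 1.
have A0 : 0 < A by rewrite ltr_wpDl.
pose G (y : R) := \int[leb]_(t in `[-A, y]) f t.
have FG (y : R) : -A < y -> F y = G y - G 0.
  move=> Ay; have [y0|y0|y0] := ltgtP 0 y.
  - rewrite /F (_ : [set` `[y, 0]] = set0 :> set R); last first.
      by rewrite set_itv_ge// bnd_simp -ltNge.
    rewrite Rintegral_set0 subr0 /G -Rintegral_itv_obnd_cbnd; last first.
      by apply: integrableS (cont_itv_itg 0 y cf) => //; apply: subset_itvr; rewrite bnd_simp.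
    rewrite Rintegral_itvB//; first exact: cont_itv_itg.
    by rewrite bnd_simp oppr_le0 ltW.
    by rewrite bnd_simp ltW.
  - rewrite /F (_ : [set` `[0, y]] = set0 :> set R); last first.
      by rewrite set_itv_ge// bnd_simp -ltNge.
    rewrite Rintegral_set0 sub0r /G -[RHS]opprB -Rintegral_itv_obnd_cbnd; last first.
      by apply: integrableS (cont_itv_itg y 0 cf) => //; apply: subset_itvr; rewrite bnd_simp.
    rewrite Rintegral_itvB//; first exact: cont_itv_itg.
    by rewrite bnd_simp ltW.
    by rewrite bnd_simp ltW.
  - by rewrite -y0 /F !subrr.
have Ax : -A < x by rewrite ltrNl (le_lt_trans (ler_norm _))// normrN ltrDl.
have [dG GE] : derivable G x 1 /\ derive1 G x = f x.
  apply: (@continuous_FTC1_closed _ f (-A) x (x + 1)) => //.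
  - by rewrite ltrDl.
  - exact: cont_itv_itg.
  - exact: cf.
have iG : is_derive x 1 G (f x).
  by move/derivableP : dG; rewrite -derive1E GE.
have iG' : is_derive x 1 (fun y => G y - G 0) (f x).
  by rewrite -[f x]subr0; apply: is_deriveB.
apply: near_eq_is_derive iG' => //.
by near=> y; rewrite FG//; near: y; exact: lt_nbhsr.
Unshelve. all: by end_near. Qed.

Lemma FTC2 f F (a b : R) : a <= b -> continuous f -> (forall x : R, is_derive x 1 F (f x)) ->
  \int[leb]_(x in `[a, b]) f x = F b - F a.
Proof.
rewrite le_eqVlt => /predU1P[<- _ _|ab cf dF].
  by rewrite set_itv1 Rintegral_set1 subrr.
have cF : continuous F := is_derive_continuous dF.
rewrite /Rintegral (@continuous_FTC2 _ f F a b ab)//.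
- exact: continuous_subspaceT.
- split.
  + by move=> x _; have [] := dF x.
  + by apply: cvg_at_right_filter; exact: cF.
  + by apply: cvg_at_left_filter; exact: cF.
- by move=> x _; rewrite derive1E; have [_ ->] := dF x.
Qed.

End antiderivative.

Lemma abs_bool_mul (R : realType) (b : bool) (x : R) : `|b%:R * x| <= `|x|.
Proof. by case: b; rewrite ?mul1r// mul0r normr0. Qed.

Lemma le_bool_mul (R : realType) (b : bool) (x y : R) : x <= y -> b%:R * x <= b%:R * y.
Proof. by case: b; rewrite ?mul1r// !mul0r. Qed.

Section time.
Context (R : realType) (T : R).
Hypothesis T0 : 0 < T.
Notation leb := (@lebesgue_measure R).
Notation TR := (measurableTypeR R).

Lemma mitv0T : measurable ([set` `[0%R, T]] : set TR).
Proof. exact: measurable_itv. Qed.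

Lemma itv0T_fin : (leb ([set` `[0%R, T]] : set TR) < +oo)%E.
Proof. by rewrite lebesgue_measure_itv/=; case: ifP => _; rewrite ltry. Qed.

Definition tau : {finite_measure set TR -> \bar R} := mfrestr mitv0T itv0T_fin.

(** The upper limit t is an indicator inside the integral, which makes prim
    jointly measurable and lets it commute with spatial integrals by Fubini.
    It is constant outside [0, T]. *)
Definition prim (h : R -> R) (t : R) : R := \int[tau]_s ((s <= t)%R%:R * h s).

Lemma meas_le d (Z : measurableType d) (f g : Z -> TR) :
  measurable_fun setT f -> measurable_fun setT g ->
  measurable_fun setT (fun z => ((f z <= g z)%R%:R : R)).
Proof.
move=> mf mg; rewrite (_ : (fun z => _) = (fun z => if f z <= g z then 1 else 0)).
  by apply: measurable_fun_ifT => //; exact: measurable_fun_ler.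
by apply/funext => z; case: (_ <= _).
Qed.

Lemma Rint_tau (h : R -> R) : measurable_fun setT h ->
  \int[tau]_s h s = \int[leb]_(s in `[0, T]) h s.
Proof. by move=> mh; rewrite /tau Rint_restr. Qed.

Lemma itg_tau (h : R -> R) : measurable_fun setT h ->
  itg tau h <-> leb.-integrable `[0, T] (EFin \o h).
Proof. by move=> mh; exact: itg_restr. Qed.

Lemma ae_tau (P : R -> Prop) :
  {ae leb, forall t, t \in `[0, T] -> P t} <-> {ae tau, forall t, P t}.
Proof. exact: ae_restr. Qed.

Lemma tau_set1 t : tau [set t] = 0%E.
Proof.
rewrite /tau /= /mfrestr /mrestr; apply/eqP; rewrite eq_le measure_ge0 andbT.
rewrite -(lebesgue_measure_set1 t); apply: le_measure; rewrite ?inE//.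
by apply: measurableI => //; exact: measurable_set1.
Qed.

Lemma massE : mass tau = T.
Proof.
rewrite /mass /tau /= /mfrestr /mrestr setTI lebesgue_measure_itv/= lte_fin T0.
by rewrite oppr0 addr0.
Qed.

Lemma cut_meas (h : R -> R) t : measurable_fun setT h ->
  measurable_fun setT (fun s : TR => (s <= t)%R%:R * h s).
Proof. by move=> mh; apply: measurable_funM => //; exact: meas_le. Qed.

Lemma cut_abs (h : R -> R) t s : `|(s <= t)%R%:R * h s| <= `|h s|.
Proof. exact: abs_bool_mul. Qed.

Lemma cut_itg h t : itg tau h -> itg tau (fun s => (s <= t)%R%:R * h s).
Proof.
move=> ih; apply: itg_le (itg_abs ih) _; first by apply: cut_meas; exact: itg_meas ih.
by move=> s; exact: cut_abs.
Qed.

Lemma prim_cut (h : R -> R) t : measurable_fun setT h -> t \in `[0, T] ->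
  prim h t = \int[leb]_(s in `[0, t]) h s.
Proof.
move=> mh; rewrite in_itv/= => /andP[t0 tT].
rewrite /prim Rint_tau; last exact: cut_meas.
rewrite Rintegral_mkcond [RHS]Rintegral_mkcond; apply: eq_Rint => s.
rewrite !patchE !mem_setE !in_itv/=.
case: (leP 0 s) => //= s0; case: (leP s t) => //= st.
  by rewrite (le_trans st tT) mul1r.
by case: ifP => _; rewrite ?mul0r.
Qed.

Lemma prim0 (h : R -> R) t : measurable_fun setT h -> t <= 0 -> prim h t = 0.
Proof.
move=> mh; rewrite le_eqVlt => /predU1P[->|t0].
  by rewrite prim_cut// ?set_itv1 ?Rintegral_set1// in_itv/= lexx ltW.
rewrite /prim Rint_tau; last exact: cut_meas.
rewrite (@eq_Rintegral _ _ _ _ _ (fun=> 0)) ?/Rintegral ?integral0//.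
move=> s; rewrite inE/= in_itv/= => /andP[s0 _].
by rewrite leNgt (lt_le_trans t0 s0) mul0r.
Qed.

Lemma primT (h : R -> R) t : measurable_fun setT h -> T <= t -> prim h t = \int[tau]_s h s.
Proof.
move=> mh Tt; rewrite /prim !Rint_tau//; last exact: cut_meas.
apply: eq_Rintegral => s; rewrite inE/= in_itv/= => /andP[_ sT].
by rewrite (le_trans sT Tt) mul1r.
Qed.

Lemma prim_abs h t : itg tau h -> `|prim h t| <= \int[tau]_s `|h s|.
Proof.
move=> ih; apply: abs_Rint_le; [exact: cut_itg|exact: itg_abs|exact: cut_abs].
Qed.

Lemma prim_le h g t : itg tau h -> itg tau g -> (forall s, h s <= g s) ->
  prim h t <= prim g t.
Proof.
move=> ih ig hg; apply: le_Rint; [exact: cut_itg|exact: cut_itg|].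
by move=> s; exact: le_bool_mul.
Qed.

Lemma primD h g t : itg tau h -> itg tau g ->
  prim (fun s => h s + g s) t = prim h t + prim g t.
Proof.
move=> ih ig; rewrite /prim -RintD; [|exact: cut_itg|exact: cut_itg].
by apply: eq_Rint => s; rewrite mulrDr.
Qed.

Lemma primB h g t : itg tau h -> itg tau g ->
  prim (fun s => h s - g s) t = prim h t - prim g t.
Proof.
move=> ih ig; rewrite /prim -RintB; [|exact: cut_itg|exact: cut_itg].
by apply: eq_Rint => s; rewrite mulrBr.
Qed.

Lemma primZ c h t : itg tau h -> prim (fun s => c * h s) t = c * prim h t.
Proof.
move=> ih; rewrite /prim -RintZ; [|exact: cut_itg].
by apply: eq_Rint => s; rewrite mulrCA.
Qed.

Lemma eq_prim h g : h =1 g -> prim h =1 prim g.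
Proof. by move=> hg t; apply: eq_Rint => s; rewrite hg. Qed.

Lemma tau_le_leb (A : set TR) : measurable A -> (tau A <= leb A)%E.
Proof.
by move=> mA; rewrite /tau /= /mfrestr /mrestr; apply: le_measure; rewrite ?inE//; exact: measurableI.
Qed.

Lemma prim_lip (h : R -> R) c s t : measurable_fun setT h -> (forall r, `|h r| <= c) ->
  `|prim h t - prim h s| <= c * `|t - s|.
Proof.
move=> mh hc; wlog st : s t / s <= t => [H|].
  have [/H//|/ltW/H] := leP s t.
  by rewrite distrC [in leRHS]distrC.
have ih := itg_bnd tau mh hc.
have mi : measurable (`]s, t]%classic : set TR) by exact: measurable_itv.
have ii : itg tau (fun r => \1_(`]s, t]%classic : set TR) r).
  by apply: (@itg_bnd _ _ _ tau _ 1) => [|r]; [exact: measurable_indic|rewrite indicE; case: (_ \in _); rewrite ?normr1// normr0].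
rewrite /prim -RintB; [|exact: cut_itg|exact: cut_itg].
apply: (@le_trans _ _ (\int[tau]_r (c * \1_(`]s, t]%classic : set TR) r))).
  apply: abs_Rint_le; [by apply: itgB; exact: cut_itg|exact: itgZ|].
  move=> r; rewrite indicE mem_setE in_itv/=.
  case: (leP r s) => rs /=; first by rewrite (le_trans rs st) subrr normr0 mulr0.
  by case: (r <= t); rewrite /= ?mul1r mul0r subr0 ?mulr1// normr0 mulr0.
rewrite RintZ//; apply: ler_wpM2l; first exact: le_trans (hc 0).
rewrite ger0_norm ?subr_ge0// /Rintegral integral_indic// setIT.
have := tau_le_leb mi; rewrite lebesgue_measure_itv/= lte_fin.
case: ltP => [_|ts] h1.
  rewrite -lee_fin fineK//; rewrite ge0_fin_numE//; exact: le_lt_trans h1 (ltry _).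
have -> : tau `]s, t]%classic = 0%E by apply/eqP; rewrite eq_le h1 measure_ge0.
by rewrite subr_ge0.
Qed.

Lemma meas_prim d (X : measurableType d) (u : R -> X -> R) :
  meas2 (u : TR -> X -> R) -> meas2 ((fun t x => prim (u ^~ x) t) : TR -> X -> R).
Proof.
move=> mu2; rewrite /meas2 /prim.
apply: (meas_param tau (f := fun (z : X * TR) (s : TR) => (s <= z.2)%R%:R * u s z.1)).
apply: measurable_funM.
  apply: meas_le; first exact: measurable_snd.
  by apply: measurableT_comp; [exact: measurable_snd|exact: measurable_fst].
apply: (meas2_comp (f := fun z : (X * TR) * TR => z.2) (g := fun z => z.1.1) mu2); first exact: measurable_snd.
by apply: measurableT_comp; [exact: measurable_fst|exact: measurable_fst].
Qed.

Lemma prim_fubini d (X : measurableType d) (mu : {sigma_finite_measure set X -> \bar R})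
    (u : R -> X -> R) t : itg2 mu tau u ->
  \int[mu]_x prim (u ^~ x) t = prim (fun s => \int[mu]_x u s x) t.
Proof.
move=> iu.
have h : itg2 mu tau (fun s x => (s <= t)%R%:R * u s x).
  apply: itg2_le (_ : itg2 mu tau (fun s x => `|u s x|)) _.
  - apply: measurable_funM; last exact: itg2_meas iu.
    by apply: meas_le => //; exact: measurable_snd.
  - exact: (integrable_norm iu).
  - by move=> s x; exact: abs_bool_mul.
rewrite /prim (fubiniR h).
have ae1 := itg2_ae1 iu.
apply: ae_eq_Rint.
- by apply: meas_Rint1; exact: itg2_meas h.
- apply: cut_meas; apply: meas_Rint1; exact: itg2_meas iu.
- by apply: filterS ae1 => s is_; rewrite RintZ.
Qed.

(** The chain rule for the square of a primitive of a merely integrable h. The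
    square of the integral of h is a double integral of h s * h r, and the two
    triangles r <= s and s <= r contribute equally by symmetry. *)
Lemma prim_sqr c h t : itg tau h ->
  (c + prim h t) ^+ 2 = c ^+ 2 + 2 * prim (fun s => h s * (c + prim h s)) t.
Proof.
move=> ih; pose H s := (s <= t)%R%:R * h s.
have iH : itg tau H by exact: cut_itg.
have mH := itg_meas iH.
have bnd b s r : `|(b : bool)%:R * (H s * H r)| <= `|H s| * `|H r|.
  by rewrite -normrM abs_bool_mul.
have m1 : measurable_fun setT (fun z : TR * TR => H z.2 * H z.1).
  by apply: measurable_funM; apply: measurableT_comp => //.
have i1 : itg2 tau tau (fun s r => (r <= s)%R%:R * (H s * H r)).
  apply: (itg2_mul _ (itg_abs iH) (itg_abs iH)) => [|s r]; last exact: bnd.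
  by apply: measurable_funM => //; apply: meas_le; [exact: measurable_fst|exact: measurable_snd].
have i2 : itg2 tau tau (fun s r => (~~ (r <= s))%R%:R * (H s * H r)).
  apply: (itg2_mul _ (itg_abs iH) (itg_abs iH)) => [|s r]; last exact: bnd.
  apply: measurable_funM => //.
  rewrite (_ : (fun z : TR * TR => _) = (fun z : TR * TR => 1 - (z.1 <= z.2)%R%:R : R)).
    by apply: measurable_funB => //; apply: meas_le; [exact: measurable_fst|exact: measurable_snd].
  by apply/funext => z; case: (_ <= _) => /=; rewrite ?subrr ?subr0.
pose A := \int[tau]_s \int[tau]_r ((r <= s)%R%:R * (H s * H r)).
have iA s : itg tau (fun r => (r <= s)%R%:R * (H s * H r)).
  by apply: cut_itg; exact: itgZ.
have iA' s : itg tau (fun r => (~~ (r <= s))%R%:R * (H s * H r)).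
  apply: (itg_ext _ (itgB (itgZ (H s) iH) (iA s))) => r.
  by case: (_ <= _); rewrite /= ?mul1r ?mul0r ?subrr ?subr0.
have E1 : (\int[tau]_s H s) ^+ 2 = A + \int[tau]_s \int[tau]_r ((~~ (r <= s))%R%:R * (H s * H r)).
  rewrite /A -RintD; [|exact: itg2_Rint1 i1|exact: itg2_Rint1 i2].
  rewrite expr2 -RintZ//; apply: eq_Rint => s; rewrite mulrC -RintZ// -RintD//.
  by apply: eq_Rint => r; case: (_ <= _); rewrite /= ?mul1r ?mul0r ?addr0 ?add0r.
have E2 : \int[tau]_s \int[tau]_r ((~~ (r <= s))%R%:R * (H s * H r)) = A.
  rewrite -(fubiniR i2) /A; apply: eq_Rint => s; apply: ae_eq_Rint.
  - by have := meas2_2 s (itg2_meas i2); apply.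
  - exact: itg_meas (iA s).
  - exists [set s]; split; [exact: measurable_set1|exact: tau_set1|].
    move=> r /= h1; apply: contrapT => rs; apply: h1.
    rewrite -ltNge mulrC [H r * H s]mulrC mulrC lt_neqAle.
    by move/eqP : rs => ->.
have EA : A = prim (fun s => h s * prim h s) t.
  apply: eq_Rint => s; rewrite /H; case: (leP s t) => st; last first.
    rewrite [RHS]mul0r -[RHS](Rint_zero tau); apply: eq_Rint => r.
    by rewrite !mul0r mulr0.
  rewrite !mul1r -RintZ; last exact: cut_itg.
  apply: eq_Rint => r; case: (leP r s) => rs.
    by rewrite (le_trans rs st) !mul1r.
  by rewrite !mul0r mulr0.
have ihp : itg tau (fun s => h s * prim h s).
  have mp : measurable_fun setT (prim h).
    apply: (meas2_2 (u := fun t (x : TR) => prim h t) (0 : TR)).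
    apply: (meas_prim (u := fun t (x : TR) => h t)).
    by apply: measurableT_comp; [exact: itg_meas ih|exact: measurable_snd].
  apply: itg_le (itgZ (\int[tau]_s `|h s|) (itg_abs ih)) _.
    by apply: measurable_funM; [exact: itg_meas ih|exact: mp].
  by move=> s; rewrite normrM mulrC ler_wpM2r// prim_abs.
have -> : prim (fun s => h s * (c + prim h s)) t =
   prim (fun s => c * h s + h s * prim h s) t.
  by apply: eq_prim => s; rewrite mulrDr [h s * c]mulrC.
rewrite primD ?primZ//; last exact: itgZ.
rewrite -EA; have : (prim h t) ^+ 2 = 2 * A by rewrite /prim E1 E2; ring.
by move=> e; rewrite sqrrD e; ring.
Qed.

End time.

(** * The nonlocal operator on a finite measure space *)

Section kernel.
Context d (X : measurableType d) (R : realType) (mu : {finite_measure set X -> \bar R}).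
Variables (k : X -> X -> R) (M : R).
Hypothesis mk : measurable_fun setT (fun z : X * X => k z.1 z.2).
Hypothesis k_ge0 : forall x y, 0 <= k x y.
Hypothesis k_le : forall x y, k x y <= M.
Hypothesis k_sym : forall x y, k x y = k y x.

Implicit Types f g : X -> R.

Definition Kop f x := \int[mu]_y (k x y * f y).
Definition degree x := \int[mu]_y k x y.
(** The nonlocal Laplacian of an integrable f: the difference f y - f x is
    split into an integral operator and a multiplication operator. *)
Definition Dop f x := Kop f x - degree x * f x.

Lemma k_abs x y : `|k x y| <= M.
Proof. by rewrite ger0_norm. Qed.

Lemma meas_k d' (Z : measurableType d') (f g : Z -> X) :
  measurable_fun setT f -> measurable_fun setT g ->
  measurable_fun setT (fun z => k (f z) (g z)).
Proof.
move=> mf mg.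
exact: (measurableT_comp (g := fun z => (f z, g z)) mk (measurable_fun_pair mf mg)).
Qed.

Lemma k_itg x : itg mu (k x).
Proof. by apply: itg_bnd (k_abs x); exact: meas_k. Qed.

Lemma kf_itg f x : itg mu f -> itg mu (fun y => k x y * f y).
Proof.
move=> fi; apply: itg_le (itgZ M (itg_abs fi)) _.
  by apply: measurable_funM; [exact: meas_k|exact: itg_meas fi].
by move=> y; rewrite normrM ler_wpM2r// k_abs.
Qed.

Lemma degree_ge0 x : 0 <= degree x. Proof. by apply: Rint_ge0. Qed.

Lemma degree_le x : degree x <= M * mass mu.
Proof. by rewrite -Rint_cst; apply: le_Rint => //; [exact: k_itg|exact: itg_cst]. Qed.

Lemma meas_degree : measurable_fun setT degree.
Proof. exact: (meas_param mu mk). Qed.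

Lemma meas_Kop d' (Z : measurableType d') (u : Z -> X -> R) : meas2 u ->
  meas2 (fun t x => Kop (u t) x).
Proof.
move=> mu2; rewrite /meas2 /Kop.
apply: (meas_param mu (f := fun (z : X * Z) y => k z.1 y * u z.2 y)).
apply: measurable_funM.
  by apply: meas_k; [apply: measurableT_comp measurable_fst measurable_fst|exact: measurable_snd].
apply: (meas2_comp (f := fun z : (X * Z) * X => z.1.2) (g := fun z => z.2) mu2).
  exact: (measurableT_comp measurable_snd measurable_fst).
exact: measurable_snd.
Qed.

Lemma meas_Dop d' (Z : measurableType d') (u : Z -> X -> R) : meas2 u ->
  meas2 (fun t x => Dop (u t) x).
Proof.
move=> mu2; apply: measurable_funB; first exact: meas_Kop.
apply: measurable_funM => //.
exact: (measurableT_comp meas_degree measurable_fst).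
Qed.

Lemma meas_Kop1 f : measurable_fun setT f -> measurable_fun setT (Kop f).
Proof.
move=> mf; apply: (meas_param mu (f := fun x y => k x y * f y)).
by apply: measurable_funM => //; exact: (measurableT_comp mf measurable_snd).
Qed.

Lemma meas_Dop1 f : measurable_fun setT f -> measurable_fun setT (Dop f).
Proof.
move=> mf; apply: measurable_funB; first exact: meas_Kop1.
by apply: measurable_funM => //; exact: meas_degree.
Qed.

Lemma Kop_abs f x : itg mu f -> `|Kop f x| <= M * \int[mu]_y `|f y|.
Proof.
move=> fi; rewrite -RintZ; last exact: itg_abs.
apply: abs_Rint_le; [exact: kf_itg|by apply: itgZ; exact: itg_abs|].
by move=> y; rewrite normrM ler_wpM2r// k_abs.
Qed.

Lemma KopB f g x : itg mu f -> itg mu g -> Kop (fun y => f y - g y) x = Kop f x - Kop g x.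
Proof.
move=> fi gi; rewrite /Kop -RintB; [|exact: kf_itg|exact: kf_itg].
by apply: eq_Rint => y; rewrite mulrBr.
Qed.

Lemma DopB f g x : itg mu f -> itg mu g -> Dop (fun y => f y - g y) x = Dop f x - Dop g x.
Proof. by move=> fi gi; rewrite /Dop KopB// mulrBr; ring. Qed.

(** The operator is bounded on every space that contains the constants; this
    pointwise form serves L^1, L^2 and the pointwise envelopes below. *)
Lemma Dop_abs f x : itg mu f -> `|Dop f x| <= M * \int[mu]_y `|f y| + M * mass mu * `|f x|.
Proof.
move=> fi; apply: (le_trans (ler_normB _ _)); apply: lerD; first exact: Kop_abs.
by rewrite normrM ler_wpM2r// ger0_norm ?degree_le// degree_ge0.
Qed.

Lemma Dop_itg f : itg mu f -> itg mu (Dop f).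
Proof.
move=> fi; apply: (itg_le (g := fun x => M * \int[mu]_y `|f y| + M * mass mu * `|f x|)).
- by apply: meas_Dop1; exact: itg_meas fi.
- by apply: itgD; [exact: itg_cst|apply: itgZ; exact: itg_abs].
- by move=> x; exact: Dop_abs.
Qed.

Lemma Dop_Rint_abs f : itg mu f ->
  \int[mu]_x `|Dop f x| <= 2 * (M * mass mu) * \int[mu]_x `|f x|.
Proof.
move=> fi; have fa := itg_abs fi.
apply: (@le_trans _ _ (\int[mu]_x (M * \int[mu]_y `|f y| + M * mass mu * `|f x|))).
  apply: le_Rint; first exact/itg_abs/Dop_itg.
    by apply: itgD; [exact: itg_cst|exact: itgZ].
  by move=> x; exact: Dop_abs.
rewrite (RintD (itg_cst _ _) (itgZ _ fa)) (RintZ _ fa) Rint_cst.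
by rewrite le_eqVlt; apply/orP; left; apply/eqP; ring.
Qed.

Lemma Dop_sqi f : sqi mu f -> sqi mu (Dop f).
Proof.
move=> fs; have fi := sqi_itg fs.
apply: (sqi_le (g := fun x => M * \int[mu]_y `|f y| + M * mass mu * `|f x|)).
- by apply: meas_Dop1; exact: itg_meas fi.
- by apply: sqiD; [exact: sqi_cst|apply: sqiZ; exact: sqi_abs].
- by move=> x; rewrite (le_trans (Dop_abs x fi))// ler_norm.
Qed.

Lemma Kop_sym f g : itg mu f -> itg mu g ->
  \int[mu]_x (Kop f x * g x) = \int[mu]_x (f x * Kop g x).
Proof.
move=> fi gi; pose u (y x : X) := k x y * f y * g x.
have iu : itg2 mu mu u.
  apply: (itg2_mul _ (itg_abs gi) (itgZ M (itg_abs fi))) => [|y x].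
    apply: measurable_funM; last exact: (measurableT_comp (itg_meas gi) measurable_fst).
    by apply: measurable_funM => //; exact: (measurableT_comp (itg_meas fi) measurable_snd).
  by rewrite /u !normrM ler_wpM2r// ler_wpM2r// k_abs.
transitivity (\int[mu]_x \int[mu]_y u y x).
  apply: eq_Rint => x; rewrite mulrC /Kop -RintZ; last exact: kf_itg.
  by apply: eq_Rint => y; rewrite /u mulrC.
rewrite (fubiniR iu); apply: eq_Rint => y; rewrite /Kop -RintZ; last exact: kf_itg.
by apply: eq_Rint => x; rewrite /u k_sym; ring.
Qed.

Lemma Dop_sym f g : sqi mu f -> sqi mu g ->
  \int[mu]_x (Dop f x * g x) = \int[mu]_x (f x * Dop g x).
Proof.
move=> fs gs; have fi := sqi_itg fs; have gi := sqi_itg gs.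
have adj h h' : sqi mu h -> sqi mu h' -> \int[mu]_x (Dop h x * h' x) =
    \int[mu]_x (Kop h x * h' x) - \int[mu]_x (degree x * (h x * h' x)).
  move=> hs hs'; have hi := sqi_itg hs.
  rewrite -RintB; last 2 first.
  - apply: sqi_mul hs'; apply: (@sqi_bnd _ _ _ mu _ (M * \int[mu]_y `|h y|)).
      by apply: meas_Kop1; exact: itg_meas hi.
    by move=> x; exact: Kop_abs.
  - apply: itg_le (itgZ (M * mass mu) (itg_abs (sqi_mul hs hs'))) _.
      apply: measurable_funM; first exact: meas_degree.
      exact: itg_meas (sqi_mul hs hs').
    by move=> x; rewrite normrM ler_wpM2r// ger0_norm ?degree_le// degree_ge0.
  by apply: eq_Rint => x; rewrite /Dop mulrBl mulrA.
rewrite adj//; under [RHS]eq_Rint do rewrite mulrC.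
rewrite adj// Kop_sym//; congr (_ - _); first by apply: eq_Rint => x; rewrite mulrC.
by apply: eq_Rint => x; rewrite [f x * _]mulrC.
Qed.

Section prim.
Context (T : R).
Hypothesis T0 : 0 < T.

Lemma kf_itg2 (u : R -> X -> R) x : itg2 mu (tau T) u ->
  itg2 mu (tau T) (fun s y => k x y * u s y).
Proof.
move=> iu; apply: itg2_le (_ : itg2 mu (tau T) (fun s y => M * `|u s y|)) _.
- apply: measurable_funM; last exact: itg2_meas iu.
  by apply: meas_k => //; exact: measurable_fst.
- exact: (itgZ M (integrable_norm iu)).
- by move=> s y; rewrite normrM ler_wpM2r// k_abs.
Qed.

Lemma Kop_itg2 (u : R -> X -> R) x : itg2 mu (tau T) u ->
  itg (tau T) (fun s => Kop (u s) x).
Proof. by move=> iu; exact: itg2_Rint1 (kf_itg2 x iu). Qed.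

Lemma Kop_prim (u : R -> X -> R) t x : itg2 mu (tau T) u ->
  Kop (fun y => prim T (u ^~ y) t) x = prim T (fun s => Kop (u s) x) t.
Proof.
move=> iu; have iku := kf_itg2 x iu.
rewrite -(prim_fubini t iku); apply: ae_eq_Rint.
- apply: measurable_funM; first exact: meas_k.
  have := meas_prim T (itg2_meas iu).
  by move/meas2_1; apply.
- have := meas_prim T (itg2_meas iku).
  by move/meas2_1; apply.
- have := itg2_ae2 iu; apply: filterS => y iy.
  by rewrite (primZ (k x y) t iy).
Qed.

Lemma Dop_prim (u : R -> X -> R) t x : itg2 mu (tau T) u -> itg (tau T) (u ^~ x) ->
  Dop (fun y => prim T (u ^~ y) t) x = prim T (fun s => Dop (u s) x) t.
Proof.
move=> iu ix; rewrite /Dop Kop_prim// -primZ//.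
by rewrite -primB//; [exact: Kop_itg2|exact: itgZ].
Qed.

End prim.

End kernel.

(** * Picard iteration *)

Section geometric.
Context (R : realType).

(** The sequence is squeezed between a n - 2 C / 2^n, which increases, and a n
    + 2 C / 2^n, which decreases. *)
Lemma geometric_cvg (a : R^nat) (C : R) : 0 <= C ->
  (forall n, `|a n.+1 - a n| <= C * 2^-1 ^+ n) ->
  exists2 l, a @ \oo --> l & forall n, `|l - a n| <= 2 * C * 2^-1 ^+ n.
Proof.
move=> C0 aC.
pose b n := a n - 2 * C * 2^-1 ^+ n; pose c n := a n + 2 * C * 2^-1 ^+ n.
have p0 n : 0 <= 2^-1 ^+ n :> R by rewrite exprn_ge0.
have nb : nondecreasing_seq b.
  apply/nondecreasing_seqP => n; rewrite /b exprS.
  have := aC n; rewrite ler_norml => /andP[+ _].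
  have := mulr_ge0 C0 (p0 n); lra.
have nc : nonincreasing_seq c.
  apply/nonincreasing_seqP => n; rewrite /c exprS.
  have := aC n; rewrite ler_norml => /andP[_].
  have := mulr_ge0 C0 (p0 n); lra.
have bc n m : b n <= c m.
  apply: (@le_trans _ _ (b (maxn n m))); first by apply: nb; exact: leq_maxl.
  apply: (@le_trans _ _ (c (maxn n m))); last by apply: nc; exact: leq_maxr.
  by rewrite /b /c lerD2l; have := mulr_ge0 C0 (p0 (maxn n m)); lra.
have cb : cvgn b.
  apply: nondecreasing_is_cvgn => //; exists (c 0%N) => _ [n _ <-]; exact: bc.
have cg : (fun n => 2 * C * 2^-1 ^+ n : R) @ \oo --> 0.
  rewrite -[0](mulr0 (2 * C)); apply: cvgMr; apply: cvg_expr.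
  by rewrite ger0_norm ?invr_ge0// invf_lt1// ltr1n.
have ca : a @ \oo --> limn b.
  rewrite -[limn b]addr0 (_ : a = fun n => b n + 2 * C * 2^-1 ^+ n); last first.
    by apply/funext => n; rewrite /b subrK.
  exact: cvgD.
exists (limn b) => // n; rewrite ler_norml; apply/andP; split.
  by have := nondecreasing_cvgn_le nb cb n; rewrite /b; lra.
have : limn b <= c n by apply: limr_le => //; apply: nearW => m; exact: bc.
by rewrite /c; lra.
Qed.

End geometric.

Section picard.
Context (R : realType) (T : R).
Hypothesis T0 : 0 < T.

Let weight c (s : R) := expR (c * `|s|).

Lemma weight_cont c : continuous (weight c).
Proof.
move=> s; rewrite /weight.
apply: (@continuous_comp _ _ _ (fun s => c * `|s|) expR).
  by apply: cvgM; [exact: cvg_cst|exact: norm_continuous].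
exact: continuous_expR.
Qed.

Lemma weight_meas c : measurable_fun setT (weight c).
Proof. by apply: continuous_measurable_fun; exact: weight_cont. Qed.

Lemma weight_itg c : itg (tau T) (weight c).
Proof.
apply/(itg_tau T (weight_meas c)); apply: cont_itv_itg; exact: weight_cont.
Qed.

Lemma weight_ge1 c s : 0 <= c -> 1 <= weight c s.
Proof. by move=> c0; rewrite -expR0 ler_expR mulr_ge0. Qed.

(** The weight exp (c |s|) has a primitive c^-1 times itself; with c = 2 L the
    integral operator of a map with Lipschitz constant L becomes a contraction
    by 1 / 2. *)
Lemma prim_weight c t : 0 < c -> prim T (weight c) t <= c^-1 * (weight c t - 1).
Proof.
move=> c0; have mw := weight_meas c.
have P1 s : 0 <= s -> \int[lebesgue_measure]_(r in `[0, s]) weight c r = c^-1 * (weight c s - 1).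
  move=> s0; transitivity (\int[lebesgue_measure]_(r in `[0, s]) expR (c * r)).
    by apply: eq_Rintegral => r; rewrite inE/= in_itv/= => /andP[r0 _]; rewrite /weight ger0_norm.
  have der (x : R) : is_derive x 1 (fun r => c^-1 * expR (c * r)) (expR (c * x)).
    have h1 : is_derive x 1 ( *%R c) c.
      have := @is_deriveZ _ _ _ id c x 1 1 (is_derive_id x 1).
      by rewrite /GRing.scale/= mulr1.
    have h2 := is_derive1_comp (is_derive_expR (c * x)) h1.
    have := @is_deriveZ _ _ _ (expR \o *%R c) c^-1 x 1 _ h2.
    rewrite /GRing.scale/= mulrCA mulrC.
    by rewrite mulVf ?gt_eqF// mul1r.
  rewrite (FTC2 s0 _ der).
    by rewrite mulr0 expR0 /weight ger0_norm// mulr1 mulrBr mulr1.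
  move=> x; apply: (@continuous_comp _ _ _ (fun s => c * s) expR).
    by apply: cvgM; [exact: cvg_cst|exact: cvg_id].
  exact: continuous_expR.
have w1 := weight_ge1 t (ltW c0).
have [t0|t0] := leP t 0.
  rewrite (prim0 T0)// mulr_ge0 ?invr_ge0 ?(ltW c0)//; lra.
have [tT|tT] := leP t T.
  by rewrite prim_cut// ?P1 ?(ltW t0)// in_itv/= tT ltW.
rewrite (primT mw (ltW tT)) Rint_tau// P1 ?(ltW T0)//.
rewrite ler_pM2l ?invr_gt0// lerD2r ler_expR ler_pM2l//.
by rewrite !gtr0_norm// ltW.
Qed.

Context d (X : measurableType d) (F : (X -> R) -> X -> R) (B u0 : X -> R) (L : R).
Hypothesis L0 : 0 < L.
Hypothesis B0 : forall x, 0 <= B x.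
Hypothesis Fmeas : forall u : R -> X -> R, meas2 (u : measurableTypeR R -> X -> R) ->
  meas2 ((fun t => F (u t)) : measurableTypeR R -> X -> R).
Hypothesis F0 : forall x, F (fun=> 0) x = 0.
Hypothesis Flip : forall (f g : X -> R) (c c' : R), measurable_fun setT f -> measurable_fun setT g ->
  (forall x, `|f x| <= c' * B x) -> (forall x, `|g x| <= c' * B x) ->
  0 <= c -> (forall x, `|f x - g x| <= c * B x) ->
  forall x, `|F f x - F g x| <= L * c * B x.
Hypothesis mu0 : measurable_fun setT u0.
Hypothesis u0B : forall x, `|u0 x| <= B x.

Let w := weight (2 * L).

Lemma Fbound (f : X -> R) (c : R) : measurable_fun setT f -> 0 <= c -> (forall x, `|f x| <= c * B x) ->
  forall x, `|F f x| <= L * c * B x.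
Proof.
move=> mf c0 fc x; rewrite -[F f x]subr0 -(F0 x); apply: (@Flip f (fun=> 0) c c) => //.
  by move=> y; rewrite normr0 mulr_ge0.
by move=> y; rewrite subr0.
Qed.

Fixpoint iter_picard n : R -> X -> R :=
  if n is m.+1 then fun t x => u0 x + prim T (fun s => F (iter_picard m s) x) t
  else fun _ => u0.

Let it := iter_picard.

Let wp t : 0 <= w t. Proof. exact: expR_ge0. Qed.

Let L20 : 0 < 2 * L. Proof. by rewrite mulr_gt0. Qed.

Let w1 t : 1 <= w t. Proof. by apply: weight_ge1; exact: ltW. Qed.

Let pw t : L * prim T w t <= 2^-1 * (w t - 1).
Proof.
have := prim_weight t L20; rewrite -(ler_pM2l L0) => /le_trans; apply.
by rewrite mulrA invfM mulrCA mulfV ?gt_eqF// mulr1.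
Qed.

Let it_meas n : meas2 (it n : measurableTypeR R -> X -> R).
Proof.
elim: n => [|n ih]; first exact: (measurableT_comp mu0 measurable_fst).
apply: measurable_funD; first exact: (measurableT_comp mu0 measurable_fst).
exact: (meas_prim T (Fmeas ih)).
Qed.

Let prim_dom (h : R -> R) c t : measurable_fun setT h -> (forall s, `|h s| <= L * (c * w s)) ->
  0 <= c -> `|prim T h t| <= c * (2^-1 * (w t - 1)).
Proof.
move=> mh hw c0.
have iw : itg (tau T) (fun s => (L * c) * w s) by apply: itgZ; exact: weight_itg.
apply: (@le_trans _ _ (prim T (fun s => (L * c) * w s) t)).
  apply: abs_Rint_le.
  - apply: cut_itg; apply: (itg_le _ iw) => [|s]; first exact: mh.
    by rewrite -mulrA; exact: hw.
  - exact: cut_itg.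
  - move=> s; rewrite normrM ger0_norm//; apply: ler_wpM2l => //.
    by rewrite -mulrA; exact: hw.
rewrite (primZ _ _ (weight_itg _)) mulrAC mulrC; apply: ler_wpM2l => //.
Qed.

Let it_bnd n t x : `|it n t x| <= w t * B x.
Proof.
elim: n t x => [|n ih] t x.
  by rewrite (le_trans (u0B x))// ler_peMl.
have h : `|prim T (fun s => F (it n s) x) t| <= B x * (2^-1 * (w t - 1)).
  apply: prim_dom => //.
    exact: (meas2_2 x (Fmeas (it_meas n))).
  move=> s; rewrite [B x * _]mulrC mulrA.
  by apply: Fbound => //; exact: (meas2_1 s (it_meas n)).
rewrite /= (le_trans (ler_normD _ _))// (le_trans (lerD (u0B x) h))//.
have := mulr_ge0 (B0 x) (_ : 0 <= w t - 1); rewrite subr_ge0 => /(_ (w1 t)); lra.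
Qed.

Let it_diff n t x : `|it n.+1 t x - it n t x| <= w t * B x * 2^-1 ^+ n.
Proof.
elim: n t x => [|n ih] t x.
  rewrite expr0 mulr1 /= addrC addKr.
  apply: (@le_trans _ _ (B x * (2^-1 * (w t - 1)))).
    apply: prim_dom => //.
    move=> s; rewrite [B x * _]mulrC mulrA.
    by apply: Fbound => //; exact: (it_bnd 0).
  have := mulr_ge0 (B0 x) (_ : 0 <= w t); rewrite wp => /(_ isT); have := B0 x; lra.
have mF m : measurable_fun setT (fun s => F (it m s) x) by exact: (meas2_2 x (Fmeas (it_meas m))).
have iF m : itg (tau T) (fun s => F (it m s) x).
  apply: (itg_le _ (itgZ (L * B x) (weight_itg (2 * L)))) => [|s]; first exact: mF.
  by rewrite mulrAC; apply: Fbound => //; exact: (meas2_1 s (it_meas m)).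
have itS m : it m.+1 t x = u0 x + prim T (fun s => F (it m s) x) t by [].
rewrite (itS n.+1) (itS n) (_ : forall a b c : R, a + b - (a + c) = b - c); last by move=> *; ring.
rewrite -primB//.
apply: (@le_trans _ _ (B x * 2^-1 ^+ n * (2^-1 * (w t - 1)))).
  apply: prim_dom => //.
  - by apply: measurable_funB.
  - move=> s; rewrite (_ : L * _ = L * (w s * 2^-1 ^+ n) * B x); last by ring.
    apply: (@Flip _ _ _ (w s)) => //; try exact: (meas2_1 s (it_meas _)).
    + by rewrite mulr_ge0 ?exprn_ge0.
    + by move=> y; rewrite mulrAC; exact: ih.
  - by rewrite mulr_ge0 ?exprn_ge0.
rewrite exprS; have : 0 <= B x * 2^-1 ^+ n by rewrite mulr_ge0 ?exprn_ge0.
by lra.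
Qed.

(** The Lipschitz hypothesis is pointwise relative to the envelope B, so the
    iterates converge at every point (t, x), and the limit solves the equation
    everywhere and not only almost everywhere. *)
Lemma picard_weight : exists u : R -> X -> R,
  [/\ meas2 (u : measurableTypeR R -> X -> R), forall t x, `|u t x| <= w t * B x &
      forall t x, u t x = u0 x + prim T (fun s => F (u s) x) t].
Proof.
have lim t x : {l | it ^~ t ^~ x @ \oo --> l & forall n, `|l - it n t x| <= 2 * (w t * B x) * 2^-1 ^+ n}.
  apply: cid2; apply: geometric_cvg; first by rewrite mulr_ge0.
  by move=> n; exact: it_diff.
pose u t x := s2val (lim t x).
have uc t x : it ^~ t ^~ x @ \oo --> u t x by exact: (s2valP (lim t x)).
have ud t x n : `|u t x - it n t x| <= 2 * (w t * B x) * 2^-1 ^+ n by exact: (s2valP' (lim t x)).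
have mu : meas2 (u : measurableTypeR R -> X -> R).
  apply: (measurable_fun_cvg (h := fun n (z : X * measurableTypeR R) => it n z.2 z.1)).
    by move=> n; exact: it_meas.
  by move=> [x t] _; exact: uc.
have ub t x : `|u t x| <= w t * B x.
  have h : `|it n t x| @[n --> \oo] --> `|u t x| by apply: cvg_norm; exact: uc.
  rewrite -(cvg_lim _ h)//; apply: limr_le; first by apply/cvg_ex; exists `|u t x|.
  by apply: nearW => n; exact: it_bnd.
exists u; split => // t x; apply/eqP; rewrite -subr_eq0 -normr_le0.
have mF v : meas2 (v : measurableTypeR R -> X -> R) -> measurable_fun setT (fun s => F (v s) x).
  by move=> mv; exact: (meas2_2 x (Fmeas mv)).
have iF v : meas2 (v : measurableTypeR R -> X -> R) -> (forall s y, `|v s y| <= w s * B y) ->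
    itg (tau T) (fun s => F (v s) x).
  move=> mv vb; apply: (itg_le _ (itgZ (L * B x) (weight_itg (2 * L)))) => [|s]; first exact: mF.
  by rewrite mulrAC; apply: Fbound => //; exact: (meas2_1 s mv).
pose C := 2 * (w t * B x).
have C0 : 0 <= C by rewrite !mulr_ge0.
have key n : `|u t x - (u0 x + prim T (fun s => F (u s) x) t)| <= 2 * C * 2^-1 ^+ n.
  have p0 : 0 <= 2^-1 ^+ n :> R by rewrite exprn_ge0.
  have h1 := ud t x n.+1.
  have h2 : `|prim T (fun s => F (it n s) x) t - prim T (fun s => F (u s) x) t| <=
      2 * B x * 2^-1 ^+ n * (2^-1 * (w t - 1)).
    rewrite -primB; [|exact: iF|exact: iF].
    apply: prim_dom; first by apply: measurable_funB; exact: mF.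
      move=> s; rewrite (_ : L * _ = L * (2 * w s * 2^-1 ^+ n) * B x); last by ring.
      apply: (@Flip _ _ _ (w s)) => //; try exact: (meas2_1 s (it_meas _)).
      + exact: (meas2_1 s mu).
      + by rewrite !mulr_ge0.
      + by move=> y; rewrite distrC (le_trans (ud s y n))// le_eqVlt; apply/orP; left; apply/eqP; ring.
    by rewrite !mulr_ge0.
  rewrite (_ : _ - _ = (u t x - it n.+1 t x) + (prim T (fun s => F (it n s) x) t - prim T (fun s => F (u s) x) t)); last first.
    by rewrite /=; ring.
  rewrite (le_trans (ler_normD _ _))// (le_trans (lerD h1 h2))// exprS /C.
  have := B0 x; have : 0 <= B x * 2^-1 ^+ n by rewrite mulr_ge0.
  have := w1 t; nra.
have cg : (fun n => 2 * C * 2^-1 ^+ n : R) @ \oo --> 0.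
  rewrite -[0](mulr0 (2 * C)); apply: cvgMr; apply: cvg_expr.
  by rewrite ger0_norm ?invr_ge0// invf_lt1// ltr1n.
rewrite -(cvg_lim _ cg)//; apply: limr_ge; first by apply/cvg_ex; exists 0.
by apply: nearW => n; exact: key.
Qed.

Lemma picard : exists u : R -> X -> R, exists2 c : R, 0 <= c &
  [/\ meas2 (u : measurableTypeR R -> X -> R), forall t x, `|u t x| <= c * B x &
      forall t x, u t x = u0 x + prim T (fun s => F (u s) x) t].
Proof.
have [u [mu ub ue]] := picard_weight.
exists u, (w T) => //; split => // t x.
have mF : measurable_fun setT (fun s => F (u s) x) by exact: (meas2_2 x (Fmeas mu)).
have [t0|t0] := leP t 0.
  by rewrite ue (prim0 T0)// addr0 (le_trans (u0B x))// ler_peMl.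
have [tT|tT] := leP t T.
  rewrite (le_trans (ub t x))// ler_wpM2r// ler_expR ler_pM2l//.
  by rewrite !gtr0_norm.
by rewrite ue (primT mF (ltW tT)) -(primT mF (lexx T)) -ue.
Qed.

End picard.

(** * The regularised flow *)

Section energy_pointwise.
Context (R : realType) (T : R).
Hypothesis T0 : 0 < T.

Lemma meas_prim1 (h : R -> R) : measurable_fun setT h -> measurable_fun setT (prim T h).
Proof.
move=> mh; apply: (meas2_2 (u := fun t (x : measurableTypeR R) => prim T h t) (0 : measurableTypeR R)).
apply: (meas_prim T (u := fun t (x : measurableTypeR R) => h t)).
by apply: measurableT_comp; [exact: mh|exact: measurable_snd].
Qed.

Lemma prim_antiderivative (h H : R -> R) t : continuous h ->
  (forall x : R, is_derive x 1 H (h x)) -> t \in `[0, T] -> prim T h t = H t - H 0.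
Proof.
move=> ch dH tT; rewrite prim_cut//; last exact: continuous_measurable_fun.
by apply: FTC2 => //; move: tT; rewrite in_itv/= => /andP[].
Qed.

(** A primitive of a nondecreasing function is convex, hence above its tangents. *)
Lemma antiderivative_convex (psi Psi : R -> R) (a b : R) : {homo psi : x y / x <= y} ->
  (forall x : R, is_derive x 1 Psi (psi x)) -> psi a * (b - a) <= Psi b - Psi a.
Proof.
move=> nd dP.
have cP : continuous Psi := is_derive_continuous dP.
have [ab|ba|->] := ltgtP a b; last by rewrite !subrr mulr0.
- have [c /[!in_itv]/= /andP[ac cb] ->] := MVT ab (fun x _ => dP x) (continuous_subspaceT cP).
  by rewrite ler_pM2r ?subr_gt0//; apply: nd; exact: ltW.
- have [c /[!in_itv]/= /andP[ac cb] e] := MVT ba (fun x _ => dP x) (continuous_subspaceT cP).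
  have -> : Psi b - Psi a = psi c * (b - a) by rewrite -opprB e -mulrN opprB.
  by rewrite ler_nM2r ?subr_lt0//; apply: nd; exact: ltW.
Qed.

(** The integral is Psi (y T) - Psi z0 for the curve y = z0 + prim zeta and a
    primitive Psi of psi. As psi has the sign of its argument, Psi is smallest
    at 0, and convexity at z0 bounds Psi z0 - Psi 0 by z0 * psi z0. *)
Lemma energy_pointwise (psi zeta : R -> R) z0 : continuous psi ->
  {homo psi : x y / x <= y} -> psi 0 = 0 -> continuous zeta ->
  - (z0 * psi z0) <= \int[tau T]_s (psi (z0 + prim T zeta s) * zeta s).
Proof.
move=> cpsi nd p0 cz.
have [Psi dPsi] := antiderivative cpsi.
have [Z dZ] := antiderivative cz.
have mz : measurable_fun setT zeta by exact: continuous_measurable_fun.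
have mpsi : measurable_fun setT psi by exact: continuous_measurable_fun.
rewrite Rint_tau; last first.
  apply: measurable_funM => //; apply: measurableT_comp => //.
  by apply: measurable_funD => //; exact: meas_prim1.
pose y (s : R) := z0 + (Z s - Z 0).
have dy (s : R) : is_derive s 1 y (zeta s).
  rewrite -[zeta s]add0r -[in X in is_derive _ _ _ X](subr0 (zeta s)).
  apply: is_deriveD; apply: is_deriveB.
have dG (s : R) : is_derive s 1 (Psi \o y) (psi (y s) * zeta s).
  exact: is_derive1_comp.
have cy : continuous y := is_derive_continuous dy.
rewrite (_ : Rintegral _ _ _ = \int[lebesgue_measure]_(s in `[0, T]) (psi (y s) * zeta s)); last first.
  apply: eq_Rintegral => s; rewrite inE/= => sT.
  by rewrite (prim_antiderivative cz dZ sT).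
rewrite (FTC2 (ltW T0) _ dG); last first.
  move=> x; apply: cvgM; last exact: cz.
  by apply: (@continuous_comp _ _ _ y psi); [exact: cy|exact: cpsi].
have h1 := antiderivative_convex 0 (y T) nd dPsi.
have h2 := antiderivative_convex z0 0 nd dPsi.
rewrite /= (_ : y 0 = z0); last by rewrite /y subrr addr0.
move: h1 h2; rewrite p0 mul0r sub0r; lra.
Qed.

End energy_pointwise.

Lemma lip_continuous (R : realType) (f : R -> R) (c : R) : 0 <= c ->
  (forall s s', `|f s - f s'| <= c * `|s - s'|) -> continuous f.
Proof.
move=> c0 f_lip x; apply/cvgrPdist_le => e e0.
have L1 : 0 < c + 1 by rewrite ltr_wpDl.
have d0 : 0 < e / (c + 1) by exact: divr_gt0.
near=> y; rewrite (le_trans (f_lip x y))//.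
have h : `|x - y| <= e / (c + 1) by near: y; apply: cvgr_dist_le => //; exact: cvg_id.
rewrite (le_trans (ler_wpM2l c0 h))// mulrCA ler_piMr ?(ltW e0)//.
by rewrite ler_pdivrMr// mul1r lerDl.
Unshelve. all: by end_near. Qed.

Section itg_prim2.
Context d (X : measurableType d) (R : realType) (mu : {finite_measure set X -> \bar R}) (T : R).

Lemma itg_prim2 (v : R -> X -> R) t : itg2 mu (tau T) v ->
  itg mu (fun x => prim T (v ^~ x) t).
Proof.
move=> iv; apply: itg2_Rint2; apply: itg2_le (_ : itg2 mu (tau T) (fun s x => `|v s x|)) _.
- apply: measurable_funM; last exact: itg2_meas iv.
  by apply: meas_le => //; exact: measurable_snd.
- exact: (integrable_norm iv).
- by move=> s x; exact: abs_bool_mul.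
Qed.

End itg_prim2.

Section itg2_square.
Context d (X : measurableType d) (R : realType) (mu : {finite_measure set X -> \bar R}) (T : R).
Hypothesis T0 : 0 < T.
Notation TR := (measurableTypeR R).

Lemma itg2_sq (f : R -> X -> R) : meas2 (f : TR -> X -> R) ->
  itg2 mu (tau T) (fun t x => f t x ^+ 2) -> itg2 mu (tau T) f.
Proof.
move=> mf f2.
have one : itg2 mu (tau T) (fun _ _ => 1).
  by apply: (itg2_mul (f := fun=> 1) (g := fun=> 1)) => [|||y x];
    [exact: measurable_cst|exact: itg_cst|exact: itg_cst|rewrite normr1 mul1r].
apply: itg2_le (_ : itg2 mu (tau T) (fun t x => 1 + f t x ^+ 2)) _ => //.
  exact: itgD one f2.
move=> t x; rewrite -(real_normK (num_real (f t x))).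
have := sqr_ge0 (`|f t x| - 1); have := normr_ge0 (f t x); nra.
Qed.

Lemma itg2_sq_mul (f g : R -> X -> R) : meas2 (f : TR -> X -> R) -> meas2 (g : TR -> X -> R) ->
  itg2 mu (tau T) (fun t x => f t x ^+ 2) -> itg2 mu (tau T) (fun t x => g t x ^+ 2) ->
  itg2 mu (tau T) (fun t x => f t x * g t x).
Proof.
move=> mf mg f2 g2; apply: itg2_le (_ : itg2 mu (tau T) (fun t x => f t x ^+ 2 + g t x ^+ 2)) _.
- exact: measurable_funM.
- exact: itgD f2 g2.
- by move=> t x; rewrite ler_norml; apply/andP; split; nra.
Qed.

Lemma itg2_sqB (f g : R -> X -> R) : meas2 (f : TR -> X -> R) -> meas2 (g : TR -> X -> R) ->
  itg2 mu (tau T) (fun t x => f t x ^+ 2) -> itg2 mu (tau T) (fun t x => g t x ^+ 2) ->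
  itg2 mu (tau T) (fun t x => (f t x - g t x) ^+ 2).
Proof.
move=> mf mg f2 g2; apply: itg2_le (_ : itg2 mu (tau T) (fun t x => 2 * (f t x ^+ 2 + g t x ^+ 2))) _.
- by apply: measurable_funX; exact: measurable_funB.
- exact: itgZ (itgD f2 g2).
- by move=> t x; rewrite ger0_norm ?sqr_ge0//; have := sqr_ge0 (f t x + g t x); nra.
Qed.

Lemma prim_sqr_le (h : R -> R) t : sqi (tau T) h ->
  (prim T h t) ^+ 2 <= T * \int[tau T]_s h s ^+ 2.
Proof.
move=> sh; rewrite -{2}(massE T0); apply: le_trans (sqr_Rint_abs_le sh).
rewrite -(real_normK (num_real (prim T h t))) ler_sqr ?nnegrE ?Rint_ge0//.
exact: prim_abs (sqi_itg sh).
Qed.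

(** Cauchy-Schwarz for h against the indicator of the interval between s and
    t, whose square integrates to at most |t - s|. *)
Lemma prim_diff_sqr_le (h : R -> R) s t : sqi (tau T) h ->
  (prim T h t - prim T h s) ^+ 2 <= `|t - s| * \int[tau T]_r h r ^+ 2.
Proof.
move=> sh; have ih := sqi_itg sh.
pose c (r : R) : R := (r <= t)%R%:R - (r <= s)%R%:R.
have mc : measurable_fun setT (c : TR -> R).
  by apply: measurable_funB; apply: meas_le.
have cb r : `|c r| <= 1.
  by rewrite /c; case: (r <= t); case: (r <= s); rewrite ?subrr ?subr0 ?sub0r ?normrN ?normr1 ?normr0.
have sc : sqi (tau T) c by exact: sqi_bnd mc cb.
have -> : prim T h t - prim T h s = \int[tau T]_r (c r * h r).
  rewrite /prim -RintB; [|exact: cut_itg|exact: cut_itg].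
  by apply: eq_Rint => r; rewrite mulrBl.
apply: (le_trans (cauchy_schwarz sc sh)); apply: ler_wpM2r.
  by apply: Rint_ge0 => r; exact: sqr_ge0.
have h1 : \int[tau T]_r c r ^+ 2 = `|prim T (fun=> 1) t - prim T (fun=> 1) s|.
  have i1 : itg (tau T) (fun=> 1 : R) by exact: itg_cst.
  rewrite /prim -RintB; [|exact: (cut_itg t i1)|exact: (cut_itg s i1)].
  have [st|/ltW ts] := leP s t.
    rewrite ger0_norm; last first.
      apply: Rint_ge0 => r; rewrite !mulr1; case: (leP r s) => rs; last by rewrite subr0.
      by rewrite (le_trans rs st) subrr.
    apply: eq_Rint => r; rewrite /c !mulr1; case: (leP r s) => rs.
      by rewrite (le_trans rs st) subrr expr0n.
    by case: (_ <= t); rewrite subr0 ?expr0n ?expr1n.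
  rewrite -normrN -RintN; last by apply: itgB; exact: (cut_itg _ i1).
  rewrite ger0_norm; last first.
    apply: Rint_ge0 => r; rewrite !mulr1 opprB; case: (leP r t) => rs; last by rewrite subr0.
    by rewrite (le_trans rs ts) subrr.
  apply: eq_Rint => r; rewrite /c !mulr1 opprB; case: (leP r t) => rs.
    by rewrite (le_trans rs ts) subrr expr0n.
  by case: (r <= s) => /=; ring.
rewrite h1; have := @prim_lip R T (fun=> 1) 1 s t; rewrite mul1r; apply => //.
by move=> r; rewrite normr1.
Qed.

(** Fubini on the triangle r <= s in place of the product rule, since g is
    merely integrable. *)
Lemma prim_by_parts (rho F g : R -> R) : continuous rho -> (forall x : R, is_derive x 1 F (rho x)) ->
  itg (tau T) g -> itg (tau T) (fun s => rho s * prim T g s) /\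
  \int[tau T]_s (rho s * prim T g s) = \int[tau T]_s ((F T - F s) * g s).
Proof.
move=> cr dF ig.
have mr : measurable_fun setT rho by exact: continuous_measurable_fun.
have ir : itg (tau T) rho by apply/(itg_tau T mr); exact: cont_itv_itg.
pose v (s r : R) := (r <= s)%R%:R * (rho s * g r).
have iv : itg2 (tau T) (tau T) v.
  apply: (itg2_mul _ (itg_abs ig) (itg_abs ir)) => [|s r].
    apply: measurable_funM; first by apply: meas_le; [exact: measurable_fst|exact: measurable_snd].
    apply: measurable_funM; first exact: (measurableT_comp mr measurable_snd).
    exact: (measurableT_comp (itg_meas ig) measurable_fst).
  by rewrite (le_trans (abs_bool_mul _ _))// normrM.
have e1 s : \int[tau T]_r v s r = rho s * prim T g s.
  by rewrite /prim -RintZ; [apply: eq_Rint => r; rewrite /v mulrCA|exact: cut_itg].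
split.
  by apply: itg_ext (itg2_Rint1 iv) => s; rewrite e1.
rewrite -(eq_Rint (tau T) e1) -(fubiniR iv).
have mF : measurable_fun setT F.
  exact: continuous_measurable_fun (is_derive_continuous dF).
rewrite (@Rint_tau _ _ (fun r => \int[tau T]_s v s r)); last exact: (meas_Rint2 (tau T) (itg2_meas iv)).
rewrite Rint_tau; last by apply: measurable_funM; [exact: measurable_funB|exact: itg_meas ig].
apply: eq_Rintegral => r; rewrite inE/= => rT.
have rT' := rT; move: rT'; rewrite in_itv/= => /andP[r0 rT'].
have irr : itg (tau T) (fun s => (s <= r)%R%:R * rho s) by exact: cut_itg.
have iB := itgB ir irr.
rewrite mulrC; have TT : T \in `[0, T] by rewrite in_itv/= lexx ltW.
have -> : F T - F r = \int[tau T]_s (rho s - (s <= r)%R%:R * rho s).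
  rewrite RintB// -(primT mr (lexx T)) (prim_antiderivative cr dF TT).
  rewrite -/(prim T rho r) (prim_antiderivative cr dF rT); ring.
rewrite -(RintZ _ iB); apply: ae_eq_Rint.
- by have := meas2_2 r (itg2_meas iv); apply.
- by apply: measurable_funM => //; exact: itg_meas iB.
(* The two integrands differ on the diagonal s = r only. *)
- exists [set r]; split; [exact: measurable_set1|exact: tau_set1|].
  move=> s /= h1; apply: contrapT => sr; apply: h1.
  rewrite /v; have [rs|rs|rs] := ltgtP r s; last by case: sr.
    by rewrite mul0r subr0 mul1r mulrC.
  by rewrite mul1r subrr mulr0 mul0r.
Qed.

End itg2_square.

Section approx.
Context d (X : measurableType d) (R : realType) (mu : {finite_measure set X -> \bar R}).
Variables (k : X -> X -> R) (M : R).
Hypothesis mk : measurable_fun setT (fun z : X * X => k z.1 z.2).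
Hypothesis k_ge0 : forall x y, 0 <= k x y.
Hypothesis k_le : forall x y, k x y <= M.
Hypothesis k_sym : forall x y, k x y = k y x.
Variables (Om : set X) (mOm : measurable Om) (T : R).
Hypothesis T0 : 0 < T.
Hypothesis M0 : 0 <= M.

Notation Dl := (Dop mu k).
Notation chi := (\1_Om : X -> R).
Notation TR := (measurableTypeR R).

Variable u0 : X -> R.
Hypothesis su0 : sqi mu u0.
Hypothesis u0_chi : forall x, chi x * u0 x = u0 x.

Implicit Types (f g : X -> R) (c : R).

(** All functions of the regularised problem are dominated by multiples of
    this square-integrable envelope. The summand 1 absorbs the bounded
    function Kop f, and |u0| the multiplication part of the operator. *)
Definition env x := 1 + `|u0 x|.
Definition envA := M * \int[mu]_x env x + M * mass mu.

Lemma env_ge1 x : 1 <= env x. Proof. by rewrite lerDl. Qed.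
Lemma env_ge0 x : 0 <= env x. Proof. by rewrite (le_trans _ (env_ge1 x)). Qed.
Lemma env_sqi : sqi mu env.
Proof. by apply: sqiD; [exact: sqi_cst|exact: sqi_abs]. Qed.
Lemma env_itg : itg mu env. Proof. exact: sqi_itg env_sqi. Qed.
Lemma envA_ge0 : 0 <= envA.
Proof.
rewrite addr_ge0// mulr_ge0 ?mass_ge0//; apply: Rint_ge0 => x; exact: env_ge0.
Qed.

Lemma dom_itg f c : measurable_fun setT f -> (forall x, `|f x| <= c * env x) -> itg mu f.
Proof. by move=> mf fc; exact: (itg_le mf (itgZ c env_itg)). Qed.

Lemma dom_sqi f c : measurable_fun setT f -> (forall x, `|f x| <= c * env x) -> sqi mu f.
Proof. by move=> mf fc; apply: (sqi_le mf (sqiZ c env_sqi)) => x; rewrite (le_trans (fc x))// ler_norm. Qed.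

Lemma Dop_dom f c : measurable_fun setT f -> 0 <= c -> (forall x, `|f x| <= c * env x) ->
  forall x, `|Dl f x| <= envA * c * env x.
Proof.
move=> mf c0 fc x; have fi := dom_itg mf fc.
rewrite (le_trans (Dop_abs mk k_ge0 k_le x fi))// /envA.
have h : \int[mu]_y `|f y| <= c * \int[mu]_x env x.
  rewrite -(RintZ _ env_itg); apply: le_Rint => //; first exact: itg_abs.
  by apply: itgZ; exact: env_itg.
have h1 : M * \int[mu]_y `|f y| <= M * \int[mu]_x env x * c * env x.
  apply: (le_trans (ler_wpM2l M0 h)).
  rewrite [c * _]mulrC mulrA ler_peMr ?env_ge1//.
  rewrite !mulr_ge0//; apply: Rint_ge0 => y; exact: env_ge0.
have h2 : M * mass mu * `|f x| <= M * mass mu * c * env x.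
  by rewrite -(mulrA _ c); apply: ler_wpM2l; [rewrite mulr_ge0 ?mass_ge0|exact: fc].
by rewrite (le_trans (lerD h1 h2))// -!mulrDl.
Qed.

Section psi.
Variables (psi : R -> R) (Lp : R).
Hypothesis Lp0 : 0 <= Lp.
Hypothesis psi_lip : forall s s', `|psi s - psi s'| <= Lp * `|s - s'|.
Hypothesis psi_nd : {homo psi : x y / x <= y}.
Hypothesis psi0 : psi 0 = 0.

Lemma psi_cont : continuous psi.
Proof. exact: lip_continuous Lp0 psi_lip. Qed.

Lemma psi_sign s : 0 <= s * psi s.
Proof. exact: phi_sign. Qed.

Lemma psi_meas : measurable_fun setT psi.
Proof. by apply: continuous_measurable_fun; exact: psi_cont. Qed.

Definition flux (f : X -> R) := fun y => psi (Dl f y).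

(** The right-hand side of the equation, set to 0 outside the domain Om so
    that solutions keep vanishing there. *)
Definition field (f : X -> R) := fun x => - (chi x * Dl (flux f) x).

Definition fieldL := envA * (Lp * envA).

Lemma meas_flux (u : R -> X -> R) : meas2 (u : TR -> X -> R) ->
  meas2 ((fun t => flux (u t)) : TR -> X -> R).
Proof. by move=> mu2; apply: (measurableT_comp psi_meas); exact: meas_Dop. Qed.

Lemma meas_chi d' (Z : measurableType d') (f : Z -> X) : measurable_fun setT f ->
  measurable_fun setT (fun z => chi (f z)).
Proof. by move=> mf; apply: (measurableT_comp _ mf); exact: measurable_indic. Qed.

Lemma meas_field (u : R -> X -> R) : meas2 (u : TR -> X -> R) ->
  meas2 ((fun t => field (u t)) : TR -> X -> R).
Proof.
move=> mu2; apply: measurableT_comp => //; apply: measurable_funM.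
  exact: meas_chi.
by apply: (meas_Dop mu mk (u := fun t => flux (u t))); exact: meas_flux.
Qed.

Lemma meas_flux1 f : measurable_fun setT f -> measurable_fun setT (flux f).
Proof. by move=> mf; apply: (measurableT_comp psi_meas); exact: meas_Dop1. Qed.

Lemma chi_abs x r : `|chi x * r| <= `|r|.
Proof. by rewrite indicE abs_bool_mul. Qed.

Lemma flux_lip f g c c' : measurable_fun setT f -> measurable_fun setT g ->
  (forall x, `|f x| <= c' * env x) -> (forall x, `|g x| <= c' * env x) -> 0 <= c ->
  (forall x, `|f x - g x| <= c * env x) ->
  forall x, `|flux f x - flux g x| <= Lp * envA * c * env x.
Proof.
move=> mf mg fc gc c0 fgc x; rewrite (le_trans (psi_lip _ _))// -!mulrA; apply: ler_wpM2l => //.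
rewrite -(DopB mk k_ge0 k_le)//; [|exact: dom_itg fc|exact: dom_itg gc].
by rewrite mulrA; apply: Dop_dom => //; exact: measurable_funB.
Qed.

Lemma flux0 x : flux (fun=> 0) x = 0.
Proof.
rewrite /flux /Dop mulr0 subr0 /Kop (eq_Rint _ (g := fun=> 0)) ?Rint_zero ?psi0//.
by move=> y; rewrite mulr0.
Qed.

Lemma flux_dom f c : measurable_fun setT f -> 0 <= c -> (forall x, `|f x| <= c * env x) ->
  forall x, `|flux f x| <= Lp * envA * c * env x.
Proof.
move=> mf c0 fc x; rewrite -[flux f x]subr0 -(flux0 x).
apply: (@flux_lip f (fun=> 0) c c) => //.
  by move=> y; rewrite normr0 mulr_ge0// env_ge0.
by move=> y; rewrite subr0.
Qed.

Lemma field_lip f g c c' : measurable_fun setT f -> measurable_fun setT g ->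
  (forall x, `|f x| <= c' * env x) -> (forall x, `|g x| <= c' * env x) -> 0 <= c ->
  (forall x, `|f x - g x| <= c * env x) ->
  forall x, `|field f x - field g x| <= fieldL * c * env x.
Proof.
move=> mf mg fc gc c0 fgc x.
have c'0 : 0 <= c' by have := le_trans (normr_ge0 _) (fc x); rewrite pmulr_lge0// (lt_le_trans _ (env_ge1 x)).
rewrite /field -opprD normrN -mulrBr (le_trans (chi_abs _ _))//.
have i1 : itg mu (flux f) by apply: dom_itg (flux_dom mf c'0 fc); exact: meas_flux1.
have i2 : itg mu (flux g) by apply: dom_itg (flux_dom mg c'0 gc); exact: meas_flux1.
rewrite -(DopB mk k_ge0 k_le)// /fieldL -(mulrA envA); apply: Dop_dom.
- by apply: measurable_funB; exact: meas_flux1.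
- by rewrite !mulr_ge0// envA_ge0.
- exact: flux_lip fgc.
Qed.

Lemma field0 x : field (fun=> 0) x = 0.
Proof.
rewrite /field (_ : flux _ = fun=> 0); last by apply/funext => y; exact: flux0.
rewrite /Dop mulr0 subr0 /Kop (eq_Rint _ (g := fun=> 0)) ?Rint_zero ?mulr0 ?oppr0//.
by move=> y; rewrite mulr0.
Qed.

Definition approx_solution (u : R -> X -> R) := exists2 c, 0 <= c &
  [/\ meas2 (u : TR -> X -> R), forall t x, `|u t x| <= c * env x &
      forall t x, u t x = u0 x + prim T (fun s => field (u s) x) t].

Lemma approx_exists : exists u, approx_solution u.
Proof.
have L0 : 0 < fieldL + 1 by rewrite ltr_wpDl// /fieldL !mulr_ge0// envA_ge0.
have := @picard R T T0 _ X field env u0 (fieldL + 1) L0 env_ge0 meas_field field0.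
case=> //.
- move=> f g c c' mf mg fc gc c0 fgc x; apply: (le_trans (field_lip mf mg fc gc c0 fgc x)).
  by rewrite ler_wpM2r ?env_ge0// ler_wpM2r// lerDl.
- exact: su0.1.
- by move=> x; rewrite /env lerDr.
- by move=> u [c c0 h]; exists u, c.
Qed.

Lemma dom_itg2 (v : R -> X -> R) c : meas2 (v : TR -> X -> R) ->
  (forall t x, `|v t x| <= c * env x) -> itg2 mu (tau T) v.
Proof. by move=> mv vc; apply: (itg2_mul mv env_itg (itg_cst _ c)). Qed.

Lemma dom2_itg2 (v : R -> X -> R) c : meas2 (v : TR -> X -> R) ->
  (forall t x, `|v t x| <= c * env x ^+ 2) -> itg2 mu (tau T) v.
Proof. by move=> mv vc; apply: (itg2_mul mv env_sqi.2 (itg_cst _ c)). Qed.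

Lemma dom2_mul f g c c' x : 0 <= c -> `|f x| <= c * env x -> `|g x| <= c' * env x ->
  `|f x * g x| <= c * c' * env x ^+ 2.
Proof.
move=> c0 h1 h2; rewrite normrM (le_trans (ler_pM _ _ h1 h2))//.
by rewrite expr2 mulrACA.
Qed.

Section sol.
Variables (u : R -> X -> R) (cu : R).
Hypothesis cu0 : 0 <= cu.
Hypothesis mu2 : meas2 (u : TR -> X -> R).
Hypothesis ub : forall t x, `|u t x| <= cu * env x.
Hypothesis ueq : forall t x, u t x = u0 x + prim T (fun s => field (u s) x) t.

Let g t := field (u t).
Let w t := flux (u t).
Let z t := Dl (u t).
Let cz := envA * cu.
Let cw := Lp * envA * cu.
Let cg := fieldL * cu.

Let cz0 : 0 <= cz. Proof. by rewrite mulr_ge0// envA_ge0. Qed.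
Let cw0 : 0 <= cw. Proof. by rewrite !mulr_ge0// envA_ge0. Qed.
Let cg0 : 0 <= cg. Proof. by rewrite !mulr_ge0// envA_ge0. Qed.

Let mz : meas2 (z : TR -> X -> R). Proof. exact: meas_Dop. Qed.
Let mw : meas2 (w : TR -> X -> R). Proof. exact: meas_flux. Qed.
Let mg : meas2 (g : TR -> X -> R). Proof. exact: meas_field. Qed.

Let z_dom t x : `|z t x| <= cz * env x.
Proof. by apply: Dop_dom => //; exact: (meas2_1 t mu2). Qed.

Let w_dom t x : `|w t x| <= cw * env x.
Proof. by apply: flux_dom => //; exact: (meas2_1 t mu2). Qed.

Let g_dom t x : `|g t x| <= cg * env x.
Proof.
rewrite -[g t x]subr0 -(field0 x); apply: (@field_lip (u t) (fun=> 0) cu cu) => //.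
- exact: (meas2_1 t mu2).
- by move=> y; rewrite normr0 mulr_ge0// env_ge0.
- by move=> y; rewrite subr0.
Qed.

Let su t : sqi mu (u t). Proof. by apply: dom_sqi (ub t); exact: (meas2_1 t mu2). Qed.
Let sw t : sqi mu (w t). Proof. by apply: dom_sqi (w_dom t); exact: (meas2_1 t mw). Qed.
Let sg t : sqi mu (g t). Proof. by apply: dom_sqi (g_dom t); exact: (meas2_1 t mg). Qed.
Let sz t : sqi mu (z t). Proof. by apply: dom_sqi (z_dom t); exact: (meas2_1 t mz). Qed.
Let ix_g x : itg (tau T) (g ^~ x).
Proof.
apply: (@itg_bnd _ _ _ (tau T) _ (cg * env x)) => [|t]; last exact: g_dom.
exact: (meas2_2 x mg).
Qed.

(** Both u0 and the right-hand side vanish outside Om. *)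
Lemma approx_chi t x : chi x * u t x = u t x.
Proof.
rewrite ueq mulrDr u0_chi; congr (_ + _).
rewrite indicE; case: (boolP (x \in Om)) => xO; first by rewrite mul1r.
rewrite mul0r -(Rint_zero (tau T)); apply: eq_Rint => s.
by rewrite /field indicE (negbTE xO) mul0r oppr0 mulr0.
Qed.

Let chi_sq x : chi x * chi x = chi x.
Proof. by rewrite indicE; case: (_ \in _); rewrite ?mulr0 ?mulr1. Qed.

(** Symmetry of the nonlocal operator; the cut-off by Om disappears against u,
    which vanishes outside Om. *)
Lemma power_identity t :
  \int[mu]_x (g t x * u t x) = - \int[mu]_x (w t x * z t x).
Proof.
rewrite -(Dop_sym mk k_ge0 k_le k_sym (sw t) (su t)) -RintN.
  by apply: eq_Rint => x; rewrite /g /field mulNr mulrAC approx_chi mulrC.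
by apply: sqi_mul => //; exact: Dop_sqi.
Qed.

(** The time derivative of the squared norm is twice the power, which is
    nonpositive because psi has the sign of its argument. *)
Lemma approx_energy t : \int[mu]_x u t x ^+ 2 <= \int[mu]_x u0 x ^+ 2.
Proof.
have igu : itg2 mu (tau T) (fun s x => g s x * u s x).
  apply: (dom2_itg2 (c := cg * cu)); first exact: measurable_funM.
  by move=> s x; exact: dom2_mul.
have e x : u t x ^+ 2 = u0 x ^+ 2 + 2 * prim T (fun s => g s x * u s x) t.
  by rewrite ueq (prim_sqr (u0 x) t (ix_g x)); congr (_ + 2 * _); apply: eq_prim => s; rewrite -ueq.
rewrite (eq_Rint _ e) RintD; [|exact: su0.2|by apply: itgZ; exact: itg_prim2].
rewrite RintZ; last exact: itg_prim2.
rewrite prim_fubini// gerDl pmulr_rle0// /prim -oppr_ge0 -RintN; last first.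
  by apply: cut_itg; exact: itg2_Rint1 igu.
apply: Rint_ge0 => s; rewrite power_identity mulrN opprK mulr_ge0//.
by apply: Rint_ge0 => x; rewrite mulrC; exact: psi_sign.
Qed.

Let u_lip t s x : `|u t x - u s x| <= cg * `|t - s| * env x.
Proof.
rewrite !ueq.
have -> : forall a b c : R, a + b - (a + c) = b - c by move=> *; ring.
rewrite mulrAC; apply: prim_lip; first exact: (meas2_2 x mg).
by move=> r; exact: g_dom.
Qed.

Let zeta_cont x : continuous (fun s => Dl (g s) x).
Proof.
have lip t s : `|Dl (g t) x - Dl (g s) x| <= envA * (fieldL * cg) * env x * `|t - s|.
  rewrite -(DopB mk k_ge0 k_le); [|exact: sqi_itg|exact: sqi_itg].
  rewrite [leRHS](_ : _ = envA * (fieldL * (cg * `|t - s|)) * env x); last by ring.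
  apply: Dop_dom => //.
  - by apply: measurable_funB; exact: (meas2_1 _ mg).
  - by rewrite !mulr_ge0// envA_ge0.
  - move=> y; apply: (@field_lip _ _ _ cu) => //; try exact: (meas2_1 _ mu2).
    by rewrite mulr_ge0.
apply: lip_continuous lip; first by rewrite !mulr_ge0 ?envA_ge0 ?env_ge0.
Qed.

(** The equation is the gradient flow of the energy given by the integral of
    Psi (Dop u), Psi a primitive of psi: its loss over [0, T] is the squared
    norm of the time derivative, and the initial energy is bounded by the
    integral of z0 * psi z0. *)
Lemma approx_dissipation :
  \int[tau T]_s \int[mu]_x g s x ^+ 2 <= \int[mu]_x (Dl u0 x * psi (Dl u0 x)).
Proof.
have mz0 : measurable_fun setT (Dl u0) by apply: meas_Dop1 => //; exact: su0.1.
have ig : itg2 mu (tau T) g by exact: dom_itg2 mg g_dom.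
have zE t x : z t x = Dl u0 x + prim T (fun s => Dl (g s) x) t.
  rewrite -(Dop_prim mk k_ge0 k_le)//.
  rewrite (_ : (fun y => _) = (fun y => u t y - u0 y)); last first.
    by apply/funext => y; rewrite ueq addrC addKr.
  rewrite (DopB mk k_ge0 k_le); [by rewrite addrC subrK|exact: sqi_itg|exact: sqi_itg].
have mDg : meas2 ((fun s => Dl (g s)) : TR -> X -> R) by exact: meas_Dop.
have ig2 : itg2 mu (tau T) (fun s x => g s x ^+ 2).
  apply: (dom2_itg2 (c := cg * cg)); first exact: measurable_funX.
  by move=> s x; rewrite expr2; exact: dom2_mul.
have iwd : itg2 mu (tau T) (fun s x => w s x * Dl (g s) x).
  apply: (dom2_itg2 (c := cw * (envA * cg))); first exact: measurable_funM.
  move=> s x; apply: dom2_mul => //; apply: Dop_dom => //; exact: (meas2_1 s mg).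
have pt x : - (Dl u0 x * psi (Dl u0 x)) <= \int[tau T]_s (w s x * Dl (g s) x).
  have := energy_pointwise T0 (Dl u0 x) psi_cont psi_nd psi0 (@zeta_cont x).
  by congr (_ <= _); apply: eq_Rint => s; rewrite -zE.
have s0 : sqi mu (Dl u0) by exact: Dop_sqi.
have sp : sqi mu (fun x => psi (Dl u0 x)).
  apply: (sqi_le (g := fun x => Lp * Dl u0 x)) => //.
  - exact: measurableT_comp psi_meas mz0.
  - exact: sqiZ.
  - move=> x; rewrite -[psi _]subr0 -psi0 (le_trans (psi_lip _ _))// subr0.
    by rewrite normrM (ger0_norm Lp0).
have := le_Rint (itgN (sqi_mul s0 sp)) (itg2_Rint2 iwd) pt.
rewrite (fubiniR iwd) RintN; last exact: sqi_mul.
have -> : \int[tau T]_s \int[mu]_x (w s x * Dl (g s) x) = - \int[tau T]_s \int[mu]_x g s x ^+ 2.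
  rewrite -RintN.
    apply: eq_Rint => s; rewrite -(Dop_sym mk k_ge0 k_le k_sym (sw s) (sg s)) -RintN; last exact: (sg s).2.
    apply: eq_Rint => x; rewrite /g /field -/(w s) mulrN; congr (- _).
    by rewrite expr2 mulNr mulrN opprK mulrACA chi_sq mulrCA.
  exact: itg2_Rint1 ig2.
by rewrite lerN2.
Qed.

Section flux_bound.
Variables (a0 C1 C2 : R).
Hypothesis a00 : 0 < a0.
Hypothesis C10 : 0 <= C1.
Hypothesis deg : (forall x, Om x -> a0 <= degree mu k x) \/ (forall x y, k x y = 0).
Hypothesis psi_absorb : forall s, `|psi s| <= C1 + s * psi s.
Let N0 := \int[mu]_x u0 x ^+ 2.
Hypothesis psi_bnd : forall s, `|s| <= M * (1 + mass mu * N0) -> `|psi s| <= C2.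

Let N00 : 0 <= N0. Proof. by apply: Rint_ge0 => x; exact: sqr_ge0. Qed.

Let G s := \int[mu]_x g s x ^+ 2.
Let G0 s : 0 <= G s. Proof. by apply: Rint_ge0 => x; exact: sqr_ge0. Qed.

(** By absorption the L^1 norm of the flux is controlled by the power, hence
    by the time derivative through Cauchy-Schwarz. *)
Let W1_le s : (\int[mu]_x `|w s x|) ^+ 2 <= 2 * (C1 * mass mu) ^+ 2 + 2 * (G s * N0).
Proof.
have iwz := sqi_mul (sw s) (sz s); have iw := sqi_itg (sw s).
set P := \int[mu]_x (g s x * u s x).
have h1 : \int[mu]_x `|w s x| <= C1 * mass mu - P.
  rewrite /P power_identity opprK -Rint_cst -RintD//; last exact: itg_cst.
  apply: le_Rint; [exact: itg_abs|by apply: itgD => //; exact: itg_cst|].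
  by move=> x; rewrite (le_trans (psi_absorb _))// mulrC.
have h2 : P ^+ 2 <= G s * N0.
  apply: (le_trans (cauchy_schwarz (sg s) (su s))).
  by apply: ler_wpM2l; [exact: G0|exact: approx_energy].
have h0 : 0 <= \int[mu]_x `|w s x| by apply: Rint_ge0.
have h3 : (\int[mu]_x `|w s x|) ^+ 2 <= (C1 * mass mu - P) ^+ 2 by rewrite ler_sqr// nnegrE (le_trans h0).
rewrite (le_trans h3)//; have := sqr_ge0 (C1 * mass mu + P); nra.
Qed.

Let L1_u s : \int[mu]_x `|u s x| <= 1 + mass mu * N0.
Proof.
have h0 : 0 <= \int[mu]_x `|u s x| by apply: Rint_ge0.
have h : (\int[mu]_x `|u s x|) ^+ 2 <= mass mu * N0.
  by rewrite (le_trans (sqr_Rint_abs_le (su s)))// ler_wpM2l ?mass_ge0// approx_energy.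
have := mulr_ge0 (mass_ge0 mu) N00; nra.
Qed.

(** On Om the equation reads degree * w = Kop w + g with degree at least a0,
    and Kop w is bounded by the L^1 norm of w. Outside Om, u vanishes, so z =
    Kop u is bounded and w with it. *)
Let w_point s x : w s x ^+ 2 <=
  2 / a0 ^+ 2 * (g s x ^+ 2 + M ^+ 2 * (\int[mu]_x `|w s x|) ^+ 2) + C2 ^+ 2.
Proof.
have pos : 0 <= 2 / a0 ^+ 2 * (g s x ^+ 2 + M ^+ 2 * (\int[mu]_x `|w s x|) ^+ 2).
  apply: mulr_ge0; first by rewrite divr_ge0// sqr_ge0.
  by rewrite addr_ge0 ?sqr_ge0// mulr_ge0 ?sqr_ge0.
case: deg => [dg|k0]; last first.
  rewrite /w /flux /Dop /Kop (eq_Rint _ (g := fun=> 0)); last by move=> y; rewrite k0 mul0r.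
  rewrite /degree (eq_Rint _ (f := k x) (g := fun=> 0)); last by move=> y; rewrite k0.
  by rewrite Rint_zero mul0r subrr psi0 expr0n/= addr_ge0// sqr_ge0.
have [xO|xO] := pselect (Om x).
  have wE : degree mu k x * w s x = Kop mu k (w s) x + g s x.
    by rewrite /g /field /Dop -/(w s) indicE mem_set// mul1r; ring.
  have h1 : a0 * `|w s x| <= M * \int[mu]_x `|w s x| + `|g s x|.
    apply: (@le_trans _ _ `|degree mu k x * w s x|).
      by rewrite normrM ler_wpM2r// (le_trans (dg _ xO))// ler_norm.
    rewrite wE (le_trans (ler_normD _ _))// lerD2r.
    exact: (Kop_abs mk k_ge0 k_le x (sqi_itg (sw s))).
  have h2 : (a0 * `|w s x|) ^+ 2 <= (M * \int[mu]_x `|w s x| + `|g s x|) ^+ 2.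
    rewrite ler_sqr ?nnegrE// ?mulr_ge0 ?(ltW a00)//.
    by rewrite (le_trans _ h1)// mulr_ge0// ltW.
  have h3 : (M * \int[mu]_x `|w s x| + `|g s x|) ^+ 2 <=
      2 * (g s x ^+ 2 + M ^+ 2 * (\int[mu]_x `|w s x|) ^+ 2).
    rewrite -(real_normK (num_real (g s x))) -exprMn.
    have := sqr_ge0 (M * \int[mu]_x `|w s x| - `|g s x|); nra.
  apply: ler_wpDr; first exact: sqr_ge0.
  rewrite mulrAC ler_pdivlMr ?exprn_gt0// (le_trans _ h3)// (le_trans _ h2)//.
  by rewrite exprMn real_normK ?num_real// mulrC.
have uE : u s x = 0 by rewrite -approx_chi indicE memNset// mul0r.
have h : `|w s x| <= C2.
  apply: psi_bnd; rewrite /Dop uE mulr0 subr0.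
  rewrite (le_trans (Kop_abs mk k_ge0 k_le x (sqi_itg (su s))))// ler_wpM2l//.
apply: ler_wpDl => //; rewrite -(real_normK (num_real (w s x))) ler_sqr ?nnegrE//.
by rewrite (le_trans _ h).
Qed.

Definition fluxK0 := 2 / a0 ^+ 2 * (mass mu * (M ^+ 2 * (2 * (C1 * mass mu) ^+ 2))) + mass mu * C2 ^+ 2.
Definition fluxK1 := 2 / a0 ^+ 2 * (1 + mass mu * (M ^+ 2 * (2 * N0))).

(** Integrates the pointwise bound. The constants depend on psi only through
    C1 and C2, which are uniform for the Yosida approximations. *)
Lemma approx_flux_bound :
  \int[tau T]_s \int[mu]_x w s x ^+ 2 <=
  fluxK0 * T + fluxK1 * \int[mu]_x (Dl u0 x * psi (Dl u0 x)).
Proof.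
have iw2 : itg2 mu (tau T) (fun s x => w s x ^+ 2).
  apply: (dom2_itg2 (c := cw * cw)); first exact: measurable_funX.
  by move=> s x; rewrite expr2; exact: dom2_mul.
have ig2 : itg2 mu (tau T) (fun s x => g s x ^+ 2).
  apply: (dom2_itg2 (c := cg * cg)); first exact: measurable_funX.
  by move=> s x; rewrite expr2; exact: dom2_mul.
have iG : itg (tau T) G by exact: itg2_Rint1 ig2.
have a2 : 0 <= 2 / a0 ^+ 2 by rewrite divr_ge0// sqr_ge0.
have slice s : \int[mu]_x w s x ^+ 2 <= fluxK0 + fluxK1 * G s.
  set W := (\int[mu]_x `|w s x|) ^+ 2.
  have i1 : itg mu (fun x => 2 / a0 ^+ 2 * (g s x ^+ 2 + M ^+ 2 * W)).
    by apply: itgZ; apply: itgD; [exact: (sg s).2|exact: itg_cst].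
  apply: (@le_trans _ _ (\int[mu]_x (2 / a0 ^+ 2 * (g s x ^+ 2 + M ^+ 2 * W) + C2 ^+ 2))).
    apply: le_Rint; [exact: (sw s).2| |exact: w_point].
    by apply: itgD => //; exact: itg_cst.
  rewrite (RintD i1 (itg_cst _ _)) RintZ; last by apply: itgD; [exact: (sg s).2|exact: itg_cst].
  rewrite (RintD (sg s).2 (itg_cst _ _)) !Rint_cst -/(G s) /fluxK0 /fluxK1.
  have hW : mass mu * (M ^+ 2 * W) <= mass mu * (M ^+ 2 * (2 * (C1 * mass mu) ^+ 2 + 2 * (G s * N0))).
    by rewrite ler_wpM2l ?mass_ge0// ler_wpM2l ?sqr_ge0// W1_le.
  have : 2 / a0 ^+ 2 * (G s + M ^+ 2 * W * mass mu) <=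
    2 / a0 ^+ 2 * (G s + mass mu * (M ^+ 2 * (2 * (C1 * mass mu) ^+ 2 + 2 * (G s * N0)))).
    by apply: ler_wpM2l => //; rewrite lerD2l mulrC.
  lra.
apply: (@le_trans _ _ (\int[tau T]_s (fluxK0 + fluxK1 * G s))).
  apply: le_Rint => //; first exact: itg2_Rint1 iw2.
  by apply: itgD; [exact: itg_cst|exact: itgZ].
rewrite (RintD (itg_cst _ _) (itgZ _ iG)) (RintZ _ iG) Rint_cst massE// lerD2l.
apply: ler_wpM2l; last exact: approx_dissipation.
by rewrite mulr_ge0// addr_ge0// !mulr_ge0 ?mass_ge0 ?sqr_ge0.
Qed.

End flux_bound.

Lemma sol_dom : exists2 c, 0 <= c & forall t x,
  [/\ `|u t x| <= c * env x, `|Dl (u t) x| <= c * env x,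
      `|flux (u t) x| <= c * env x & `|field (u t) x| <= c * env x].
Proof.
exists (cu + cz + cw + cg); first by rewrite !addr_ge0.
by move=> t x; split; [apply: (le_trans (ub t x))|apply: (le_trans (z_dom t x))
  |apply: (le_trans (w_dom t x))|apply: (le_trans (g_dom t x))];
  apply: ler_wpM2r => //; rewrite ?env_ge0//; move: cu0 cz0 cw0 cg0; lra.
Qed.

Lemma sol_lip : exists2 c, 0 <= c & forall t s x, `|u t x - u s x| <= c * `|t - s| * env x.
Proof. by exists cg => // t s x; exact: u_lip. Qed.

End sol.

End psi.
End approx.

(** * Limits of square-integrable functions *)

Section convergence.
Context d (X : measurableType d) (R : realType) (mu : {finite_measure set X -> \bar R}).
Implicit Types (f : X -> R) (fs : nat -> X -> R).

Lemma fatou_Rint fs f (c : R^nat) (c0 : R) :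
  (forall n, itg mu (fs n)) -> (forall n x, 0 <= fs n x) ->
  measurable_fun setT f -> (forall x, 0 <= f x) ->
  {ae mu, forall x, fs ^~ x @ \oo --> f x} ->
  (forall n, \int[mu]_x fs n x <= c n) -> c @ \oo --> c0 ->
  itg mu f /\ \int[mu]_x f x <= c0.
Proof.
move=> ifs fs0 mf f0 ff fc cc.
have mfs n := itg_meas (ifs n).
have h : (\int[mu]_x (f x)%:E <= c0%:E)%E.
  have e : (\int[mu]_x (f x)%:E = \int[mu]_x limn_einf (fun n => (fs n x)%:E))%E.
    apply: ae_eq_integral => //.
    - exact/measurable_EFinP.
    - have := @measurable_fun_limn_esup _ X R setT (fun n x => - (fs n x)%:E)%E.
      move=> h; rewrite (_ : (fun x => _) = (fun x => - limn_esup (fun n => - (fs n x)%:E))%E); last first.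
        by apply/funext => x; rewrite -limn_einfN; congr limn_einf; apply/funext => n; rewrite /= ?oppeK ?opprK.
      apply: measurableT_comp => //; apply: h => n.
      by apply: measurableT_comp => //; exact/measurable_EFinP.
    - apply: filterS ff => x fx _.
      by apply/esym; apply: (cvg_limn_einf_sup _).1; apply: cvg_EFin => //; exact: nearW.
  have hF : (\int[mu]_x limn_einf (fun n => (fs n x)%:E) <=
      limn_einf (fun n => \int[mu]_x (fs n x)%:E))%E.
    apply: fatou => //; first by move=> n; exact/measurable_EFinP.
    by move=> n x _; rewrite lee_fin.
  rewrite e (le_trans hF)//.
  have cE : (fun n => (c n)%:E) @ \oo --> c0%:E by apply: cvg_EFin => //; exact: nearW.
  rewrite limn_einf_lim -(cvg_lim _ cE)//; apply: lee_lim.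
  - exact: is_cvg_einfs.
  - by apply/cvg_ex; exists c0%:E.
  - apply: nearW => n; apply: (@le_trans _ _ (\int[mu]_x (fs n x)%:E)%E).
      by apply: ereal_inf_lbound; exists n => /=.
    by rewrite -fin_Rint// lee_fin.
have iff : itg mu f by apply: itg_ge0_fin => //; exact: le_lt_trans h (ltry _).
by split => //; rewrite -lee_fin fin_Rint.
Qed.

Lemma bounded_cvg0 fs (c : R) : (forall n, measurable_fun setT (fs n)) ->
  (forall n x, `|fs n x| <= c) -> {ae mu, forall x, fs ^~ x @ \oo --> 0} ->
  (fun n => \int[mu]_x fs n x) @ \oo --> 0.
Proof.
move=> mf fc f0.
have [|||||_ _] := @dominated_convergence _ X R mu setT measurableT (fun n x => (fs n x)%:E) (fun=> 0%E) (fun=> c%:E).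
- by move=> n; exact/measurable_EFinP.
- exact: measurable_cst.
- by apply: filterS f0 => x h _; apply: cvg_EFin => //; exact: nearW.
- exact: itg_cst.
- by apply: aeW => x n _ /=; rewrite lee_fin.
- rewrite integral0 => h.
  have := fine_cvg (h : _ @ \oo --> 0%:E); exact.
Qed.

Lemma ae_cvg_series fs (K : R) : (forall n, measurable_fun setT (fs n)) ->
  (forall n, itg mu (fun x => fs n.+1 x - fs n x)) ->
  (forall n, \int[mu]_x `|fs n.+1 x - fs n x| <= K * 2^-1 ^+ n) ->
  {ae mu, forall x, cvgn (fs ^~ x)}.
Proof.
move=> mf idf dK.
pose dd n x := `|fs n.+1 x - fs n x|.
have mdd n : measurable_fun setT (fun x => (dd n x)%:E).
  by apply/measurable_EFinP; apply: measurableT_comp => //; exact: measurable_funB.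
pose S x := (\sum_(0 <= n <oo) (dd n x)%:E)%E.
have S0 x : (0 <= S x)%E by apply: nneseries_ge0 => n _ _; rewrite lee_fin normr_ge0.
have mS : measurable_fun setT S.
  by apply: ge0_emeasurable_sum => // n x _ _; rewrite lee_fin normr_ge0.
have iS : (\int[mu]_x S x < +oo)%E.
  rewrite /S integral_nneseries//; last by move=> n x _; rewrite lee_fin normr_ge0.
  apply: (@le_lt_trans _ _ (\sum_(0 <= n <oo) (K * 2^-1 ^+ n)%:E)%E).
    apply: lee_nneseries => [n *|n *].
      by apply: integral_ge0 => x _; rewrite lee_fin normr_ge0.
    by rewrite -fin_Rint ?lee_fin ?dK//; exact: itg_abs.
  have h : (series (geometric K 2^-1)) @ \oo --> K * (1 - 2^-1)^-1.
    by apply: cvg_geometric_series; rewrite ger0_norm ?invr_ge0// invf_lt1// ltr1n.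
  rewrite (_ : (\sum_(0 <= n <oo) (K * 2^-1 ^+ n)%:E)%E = (K * (1 - 2^-1)^-1)%:E) ?ltry//.
  apply/cvg_lim => //.
  rewrite (_ : (fun n => _) = (EFin \o series (geometric K 2^-1))).
    by apply: cvg_EFin => //; exact: nearW.
  by apply/funext => n /=; rewrite /series/= sumEFin.
have : mu.-integrable setT S.
  by apply/integrableP; split => //; under eq_integral do rewrite gee0_abs//.
move=> /(integrable_ae measurableT); apply: filterS => x /= /(_ I) Sfin.
have cs : cvgn (series (fun n => `|fs n.+1 x - fs n x|)).
  apply: nondecreasing_is_cvgn.
    by apply/nondecreasing_seqP => n; rewrite !seriesEnat/= big_nat_recr//= lerDl.
  exists (fine (S x)) => _ [n _ <-].
  rewrite -lee_fin fineK// seriesEnat/= -sumEFin.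
  exact: (nneseries_lim_ge n (fun i _ _ => _)).
have := normed_cvg cs.
rewrite (_ : series _ = (fun n => fs n x - fs 0%N x)).
  move=> c1; have : cvgn (fun n => (fs n x - fs 0%N x) + fs 0%N x) by apply: is_cvgD => //; exact: is_cvg_cst.
  by congr (cvgn _); apply/funext => n; rewrite subrK.
by apply/funext => n; rewrite seriesEnat/= telescope_sumr.
Qed.

End convergence.

Section limits2.
Context d d' (X : measurableType d) (Y : measurableType d') (R : realType)
  (mu : {finite_measure set X -> \bar R}).

(** The rate 4^-n for squared norms makes the increments summable in L^1, so
    the whole sequence converges almost everywhere; taking the upper limit as
    the definition of u gives joint measurability. *)
Lemma L2_limit (v : nat -> Y -> X -> R) (C : R) : 0 <= C ->
  (forall n, meas2 (v n)) ->
  (forall i j t, sqi mu (fun x => v i t x - v j t x)) ->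
  (forall i j t, \int[mu]_x (v i t x - v j t x) ^+ 2 <= C * (4^-1 ^+ i + 4^-1 ^+ j)) ->
  exists u : Y -> X -> R, [/\ meas2 u,
    forall t, {ae mu, forall x, (fun n => v n t x) @ \oo --> u t x} &
    forall t j, sqi mu (fun x => u t x - v j t x) /\
      \int[mu]_x (u t x - v j t x) ^+ 2 <= C * 4^-1 ^+ j].
Proof.
move=> C0 mv sv vC.
pose u t x := fine (limn_esup (fun n => (v n t x)%:E)).
have mu2 : meas2 u.
  apply: (measurableT_comp (f := @fine R)); first exact: fine_measurable.
  by apply: measurable_fun_limn_esup => n; apply/measurable_EFinP; exact: mv.
have uE t x (l : R) : (fun n => v n t x) @ \oo --> l -> u t x = l.
  move=> vl; rewrite /u (cvg_limn_einf_sup (l := l%:E) _).2//.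
  by apply: cvg_EFin => //; exact: nearW.
have cvg t : {ae mu, forall x, (fun n => v n t x) @ \oo --> u t x}.
  have : {ae mu, forall x, cvgn ((fun n => v n t) ^~ x)}.
    apply: (ae_cvg_series (K := 1 + mass mu * (C * 2))) => [n|n|n].
    - exact: meas2_1.
    - exact: sqi_itg.
    - have h := sqr_Rint_abs_le (sv n.+1 n t).
      have h0 : 0 <= \int[mu]_x `|v n.+1 t x - v n t x| by apply: Rint_ge0.
      set y := \int[mu]_x `|_| in h h0 *; set q := 2^-1 ^+ n.
      have q0 : 0 <= q by rewrite exprn_ge0.
      have q4 : 4^-1 ^+ n = q ^+ 2 :> R.
        by rewrite -exprM mulnC exprM; congr (_ ^+ _); rewrite expr2 -invfM -natrM.
      have h2 : y ^+ 2 <= mass mu * (C * 2) * q ^+ 2.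
        rewrite (le_trans h)// -mulrA ler_wpM2l ?mass_ge0//.
        rewrite (le_trans (vC _ _ _))// -mulrA ler_wpM2l// exprS q4.
        have := sqr_ge0 q; lra.
      set m := mass mu * (C * 2) in h2 *.
      have m0 : 0 <= m by rewrite mulr_ge0 ?mass_ge0// mulr_ge0.
      rewrite -(@ler_sqr R)// ?nnegrE ?mulr_ge0 ?addr_ge0// (le_trans h2)//.
      rewrite exprMn ler_wpM2r ?sqr_ge0//; nra.
  by apply: filterS => x /cvg_ex[l vl]; rewrite (uE _ _ _ vl).
exists u; split => // t j.
have mut : measurable_fun setT (fun x => u t x - v j t x).
  by apply: measurable_funB; exact: meas2_1.
have c4 : (fun i => C * (4^-1 ^+ i + 4^-1 ^+ j) : R) @ \oo --> C * (0 + 4^-1 ^+ j).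
  apply: cvgMr; apply: cvgD; last exact: cvg_cst.
  by apply: cvg_expr; rewrite ger0_norm ?invr_ge0// invf_lt1// ltr1n.
have [||||||i1 i2] := @fatou_Rint _ X R mu (fun i x => (v i t x - v j t x) ^+ 2) (fun x => (u t x - v j t x) ^+ 2) _ _ _ _ _ _ _ _ c4.
- by move=> i; exact: (sv i j t).2.
- by move=> i x; exact: sqr_ge0.
- exact: measurable_funX.
- by move=> x; exact: sqr_ge0.
- apply: filterS (cvg t) => x cx.
  by apply: cvgM; apply: cvgB => //; exact: cvg_cst.
- by move=> i; exact: vC.
by split => //; rewrite add0r in i2.
Qed.

Variable nu : {finite_measure set Y -> \bar R}.

Lemma fatou2 (f : nat -> Y -> X -> R) (g : Y -> X -> R) (C : R) :
  (forall n, itg2 mu nu (f n)) -> (forall n t x, 0 <= f n t x) ->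
  meas2 g -> (forall t x, 0 <= g t x) ->
  (forall t, {ae mu, forall x, (fun n => f n t x) @ \oo --> g t x}) ->
  (forall n, \int[nu]_t \int[mu]_x f n t x <= C) ->
  itg2 mu nu g /\ \int[nu]_t \int[mu]_x g t x <= C.
Proof.
move=> fi f0 mg g0 fg fC.
pose F n t := (\int[mu]_x (f n t x)%:E)%E.
pose G t := (\int[mu]_x (g t x)%:E)%E.
have mf n : measurable_fun setT (fun z : X * Y => (f n z.2 z.1)%:E).
  by apply/measurable_EFinP; exact: itg2_meas (fi n).
have mgE : measurable_fun setT (fun z : X * Y => (g z.2 z.1)%:E) by exact/measurable_EFinP.
have F0 n t : (0 <= F n t)%E by apply: integral_ge0 => x _; rewrite lee_fin.
have G0 t : (0 <= G t)%E by apply: integral_ge0 => x _; rewrite lee_fin.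
have mF n : measurable_fun setT (F n).
  by apply: (measurable_fun_fubini_tonelli_G (m1 := mu) _ (mf n)) => z; rewrite lee_fin.
have mG : measurable_fun setT G.
  by apply: (measurable_fun_fubini_tonelli_G (m1 := mu) _ mgE) => z; rewrite lee_fin.
have mEinf d0 (Z : measurableType d0) (h : nat -> Z -> \bar R) : (forall n, measurable_fun setT (h n)) ->
    measurable_fun setT (fun z => limn_einf (h ^~ z)).
  move=> mh; rewrite (_ : (fun z => _) = (fun z => - limn_esup (fun n => - h n z))%E); last first.
    by apply/funext => z; rewrite -limn_einfN; congr limn_einf; apply/funext => n; rewrite /= oppeK.
  apply: measurableT_comp => //; apply: measurable_fun_limn_esup => n.
  exact: measurableT_comp.
have GF t : (G t <= limn_einf (F ^~ t))%E.
  have -> : G t = (\int[mu]_x limn_einf (fun n => (f n t x)%:E))%E.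
    apply: ae_eq_integral => //.
    - by apply/measurable_EFinP; exact: meas2_1.
    - apply: (mEinf _ _ (fun n x => (f n t x)%:E)) => n.
      by apply/measurable_EFinP; apply: meas2_1; exact: itg2_meas (fi n).
    - apply: filterS (fg t) => x fx _.
      by apply/esym; apply: (cvg_limn_einf_sup _).1; apply: cvg_EFin => //; exact: nearW.
  apply: fatou => //; last by move=> n x _; rewrite lee_fin.
  by move=> n; apply/measurable_EFinP; apply: meas2_1; exact: itg2_meas (fi n).
have FE n : (\int[nu]_t F n t <= C%:E)%E.
  have h := fubini_tonelli2 (m1 := mu) (m2 := nu) _ (mf n) (fun z => _).
  have : (\int[(mu \x nu)%E]_z (f n z.2 z.1)%:E = \int[nu]_t F n t)%E by apply: h => z; rewrite lee_fin.
  move=> <-; rewrite -[leLHS]fineK; last exact: integrable_fin_num (fi n).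
  by rewrite lee_fin itg2_prodE.
have GC : (\int[nu]_t G t <= C%:E)%E.
  apply: (@le_trans _ _ (\int[nu]_t limn_einf (F ^~ t))%E).
    apply: ge0_le_integral => //.
    exact: (mEinf _ _ (fun n t => F n t)).
  apply: (@le_trans _ _ (limn_einf (fun n => \int[nu]_t F n t))%E).
    by apply: fatou.
  rewrite limn_einf_lim -(lim_cst (F := \oo) (@ereal_hausdorff R) C%:E); apply: lee_lim.
  - exact: is_cvg_einfs.
  - exact: is_cvg_cst.
  - apply: nearW => n; apply: (@le_trans _ _ (\int[nu]_t F n t)%E) => //.
    by apply: ereal_inf_lbound; exists n => /=.
have ig : itg2 mu nu g.
  apply/(integrable21ltyP mu nu mgE); apply: le_lt_trans (ltry C).
  by move: GC; congr (_ <= _)%E; apply: eq_integral => t _; apply: eq_integral => x _ /=; rewrite ger0_norm.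
split => //; rewrite -lee_fin -(itg2_prodE ig) fineK; last exact: integrable_fin_num ig.
by rewrite fubini_tonelli2// => z; rewrite lee_fin.
Qed.

(** Where |e| <= r, dominated convergence applies; the rest is at most e^2 / r,
    whose integral is at most C / r. *)
Lemma L1_limit (e : nat -> Y -> X -> R) (C : R) :
  (forall n, meas2 (e n)) ->
  (forall t, {ae mu, forall x, (fun n => e n t x) @ \oo --> 0}) ->
  (forall n, itg2 mu nu (fun t x => e n t x ^+ 2)) ->
  (forall n, \int[nu]_t \int[mu]_x e n t x ^+ 2 <= C) ->
  (forall n, itg2 mu nu (fun t x => `|e n t x|)) /\
  (fun n => \int[nu]_t \int[mu]_x `|e n t x|) @ \oo --> 0.
Proof.
move=> me e0 ie eC.
have ic (c : R) : itg2 mu nu (fun _ _ => c).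
  by apply: (itg2_mul (f := fun=> `|c|) (g := fun=> 1)) => [|||y x];
    [exact: measurable_cst|exact: itg_cst|exact: itg_cst|rewrite mul1r].
have i1 n : itg2 mu nu (fun t x => `|e n t x|).
  apply: itg2_le (_ : itg2 mu nu (fun t x => 1 + e n t x ^+ 2)) _.
  - exact: measurableT_comp (me n).
  - exact: itgD (ic 1) (ie n).
  - move=> t x; rewrite normr_id -(real_normK (num_real (e n t x))).
    have := sqr_ge0 (`|e n t x| - 1); have := normr_ge0 (e n t x); nra.
split=> //.
have C0 : 0 <= C.
  by apply: le_trans (eC 0%N); apply: Rint_ge0 => t; apply: Rint_ge0 => x; exact: sqr_ge0.
pose b r n t x := Num.min `|e n t x| r.
have mb r n : meas2 (b r n).
  by apply: measurable_minr => //; exact: measurableT_comp (me n).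
have bb r n t x : 0 < r -> `|b r n t x| <= r.
  by move=> r0; rewrite ger0_norm ?ge_min ?lexx ?orbT// le_min normr_ge0 ltW.
have ib r n : 0 < r -> itg2 mu nu (b r n).
  by move=> r0; apply: itg2_le (ic r) _ => // t x; exact: bb.
have cb r : 0 < r -> (fun n => \int[nu]_t \int[mu]_x b r n t x) @ \oo --> 0.
  move=> r0; apply: (bounded_cvg0 (c := r * mass mu)).
  - by move=> n; exact: meas_Rint1.
  - move=> n t; rewrite -Rint_cst; apply: abs_Rint_le.
    + by apply: (itg_bnd mu (c := r)) => [|x]; [exact: meas2_1|exact: bb].
    + exact: itg_cst.
    + by move=> x; exact: bb.
  - apply: aeW => t; apply: (bounded_cvg0 (c := r)).
    + by move=> n; exact: meas2_1.
    + by move=> n x; exact: bb.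
    + apply: filterS (e0 t) => x /cvgr0Pnorm_le ex.
      apply/cvgr0Pnorm_le => d0 d00; have := ex _ d00; apply: filterS => n h.
      by rewrite ger0_norm ?le_min ?normr_ge0 ?(ltW r0)// ge_min h.
apply/cvgr0Pnorm_le => d0 d00.
pose r := 2 * (C + 1) / d0.
have C1 : 0 < C + 1 by rewrite ltr_wpDl.
have r0 : 0 < r by rewrite !divr_gt0 ?mulr_gt0.
have := cb _ r0 => /cvgr0Pnorm_le/(_ _ (_ : 0 < d0 / 2)); rewrite divr_gt0// => /(_ isT).
apply: filterS => n hb.
rewrite ger0_norm; last by apply: Rint_ge0 => t; apply: Rint_ge0.
have Ib := itg2_Rint1 (ib r n r0).
have Ie := itg2_Rint1 (ie n).
apply: (@le_trans _ _ (\int[nu]_t (\int[mu]_x b r n t x + r^-1 * \int[mu]_x e n t x ^+ 2))).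
  apply: ae_le_Rint.
  - exact: itg2_Rint1 (i1 n).
  - by apply: itgD => //; exact: itgZ.
  - have := itg2_ae1 (i1 n); have := itg2_ae1 (ie n); have := itg2_ae1 (ib r n r0).
    apply: filterS3 => t it1 it2 it3.
    rewrite -RintZ// -RintD//; last exact: itgZ.
    apply: le_Rint => //; first by apply: itgD => //; exact: itgZ.
    move=> x; rewrite /b; case: (leP `|e n t x| r) => h.
      by rewrite lerDl mulr_ge0 ?invr_ge0 ?sqr_ge0// ltW.
    apply: ler_wpDl; first exact: ltW.
    rewrite -(real_normK (num_real (e n t x))) mulrC ler_pdivlMr// expr2.
    by rewrite ler_wpM2l// ltW.
rewrite RintD//; last exact: itgZ.
rewrite RintZ// (splitr d0); apply: lerD.
  by rewrite (le_trans (ler_norm _)).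
rewrite mulrC ler_pdivrMr// (le_trans (eC n))//.
have -> : d0 / 2 * r = C + 1 by rewrite /r; field; rewrite gt_eqF.
by rewrite lerDl.
Qed.

End limits2.

(** * Existence for the integral equation *)

Section existence.
Context d (X : measurableType d) (R : realType) (mu : {finite_measure set X -> \bar R}).
Variables (k : X -> X -> R) (M : R).
Hypothesis mk : measurable_fun setT (fun z : X * X => k z.1 z.2).
Hypothesis k_ge0 : forall x y, 0 <= k x y.
Hypothesis k_le : forall x y, k x y <= M.
Hypothesis k_sym : forall x y, k x y = k y x.
Variables (Om : set X) (mOm : measurable Om) (T : R).
Hypothesis T0 : 0 < T.
Hypothesis M0 : 0 <= M.
Variable u0 : X -> R.
Hypothesis su0 : sqi mu u0.
Hypothesis u0_chi : forall x, (\1_Om x : R) * u0 x = u0 x.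
Variable phi : R -> R.
Hypothesis phi_cont : continuous phi.
Hypothesis phi_nd : {homo phi : x y / x <= y}.
Hypothesis phi0 : phi 0 = 0.
Variable a0 : R.
Hypothesis a00 : 0 < a0.
Hypothesis deg : (forall x, Om x -> a0 <= degree mu k x) \/ (forall x y, k x y = 0).
Hypothesis energy0 : itg mu (fun x => Dop mu k u0 x * phi (Dop mu k u0 x)).

Notation Dl := (Dop mu k).
Notation chi := (\1_Om : X -> R).
Notation TR := (measurableTypeR R).

Let Z := M * (1 + mass mu * \int[mu]_x u0 x ^+ 2).
(** A bound for the flux in L^2 that does not depend on the Yosida
    parameter. *)
Let Cw := fluxK0 mu M a0 (phi_one phi) (`|phi Z| + `|phi (- Z)|) * T +
  fluxK1 mu M u0 a0 * \int[mu]_x (Dl u0 x * phi (Dl u0 x)).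

Let good l (u : R -> X -> R) := [/\ meas2 (u : TR -> X -> R),
  forall t x, chi x * u t x = u t x,
  exists2 c, 0 <= c & forall t x, [/\ `|u t x| <= c * env u0 x, `|Dl (u t) x| <= c * env u0 x,
      `|flux mu k (yos phi l) (u t) x| <= c * env u0 x & `|field mu k Om (yos phi l) (u t) x| <= c * env u0 x],
  exists2 c, 0 <= c & forall t s x, `|u t x - u s x| <= c * `|t - s| * env u0 x &
  (forall t x, u t x = u0 x + prim T (fun s => field mu k Om (yos phi l) (u s) x) t) /\
  \int[tau T]_s \int[mu]_x flux mu k (yos phi l) (u s) x ^+ 2 <= Cw].

Let good_exists l : 0 < l -> exists u, good l u.
Proof.
move=> l0; have Lp0 : 0 <= l^-1 by rewrite invr_ge0 ltW.
have lip := yos_lip phi_cont phi_nd phi0 l0.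
have y0 := yos0 phi_cont phi_nd phi0 l0.
have nd : {homo yos phi l : x y / x <= y} by move=> x y; exact: yos_nd.
have [u [c c0 [mu2 ub ue]]] := approx_exists mk k_ge0 k_le mOm T0 M0 su0 Lp0 lip y0.
have abs := yos_absorb phi_cont phi_nd phi0 l0.
have bnd s : `|s| <= Z -> `|yos phi l s| <= `|phi Z| + `|phi (- Z)|.
  move=> sZ; rewrite (le_trans (yos_le phi_cont phi_nd phi0 l0 s))//.
  move: sZ; rewrite ler_norml => /andP[s1 s2].
  have h1 := phi_nd s1; have h2 := phi_nd s2.
  rewrite ler_norml; have := ler_norm (phi Z); have := lerNnormlW (lexx `|phi (- Z)|).
  by have := normr_ge0 (phi Z); have := normr_ge0 (phi (- Z)); move=> *; apply/andP; split; lra.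
exists u; split => //.
- exact: (approx_chi u0_chi ue).
- exact: (sol_dom mk k_ge0 k_le Om M0 su0 Lp0 lip y0 c0 mu2 ub).
- exact: (sol_lip mk k_ge0 k_le mOm M0 su0 Lp0 lip y0 c0 mu2 ub ue).
- split => //.
  apply: (le_trans (approx_flux_bound mk k_ge0 k_le k_sym mOm T0 M0 su0 u0_chi Lp0 lip nd y0 c0 mu2 ub ue a00 deg abs bnd)).
  rewrite lerD2l; apply: ler_wpM2l.
    rewrite /fluxK1 mulr_ge0//; first by rewrite divr_ge0 ?sqr_ge0.
    rewrite addr_ge0// !mulr_ge0 ?mass_ge0 ?sqr_ge0//.
    by apply: Rint_ge0 => x; exact: sqr_ge0.
  have mz : measurable_fun setT (Dl u0) by apply: meas_Dop1 => //; exact: su0.1.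
  apply: le_Rint => //; last by move=> x; exact: yos_mul_le.
  apply: itg_le energy0 _.
    apply: measurable_funM => //; apply: measurableT_comp => //.
    exact: (psi_meas Lp0 lip).
  by move=> x; rewrite ger0_norm ?yos_sign// yos_mul_le.
Qed.

Let Cw0 : 0 <= Cw.
Proof.
have [u [_ _ _ _ [_]]] := good_exists ltr01; apply: le_trans.
by apply: Rint_ge0 => t; apply: Rint_ge0 => x; exact: sqr_ge0.
Qed.

Let prim_le_total h t : itg (tau T) h -> (forall s, 0 <= h s) -> prim T h t <= \int[tau T]_s h s.
Proof.
move=> ih h0; apply: le_Rint => //; first exact: cut_itg.
by move=> s; rewrite ler_piMl// lern1 leq_b1.
Qed.

Let good_meas_flux l u : 0 < l -> good l u ->
  meas2 ((fun t => flux mu k (yos phi l) (u t)) : TR -> X -> R).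
Proof.
move=> l0 [mu2 _ _ _ _]; apply: (meas_flux mu mk (Lp := l^-1)) => //.
  by rewrite invr_ge0 ltW.
exact: yos_lip.
Qed.

Let good_meas_field l u : 0 < l -> good l u ->
  meas2 ((fun t => field mu k Om (yos phi l) (u t)) : TR -> X -> R).
Proof.
move=> l0 [mu2 _ _ _ _]; apply: (meas_field mu mk mOm (Lp := l^-1)) => //.
  by rewrite invr_ge0 ltW.
exact: yos_lip.
Qed.

Let good_sqi_flux l u t : 0 < l -> good l u -> sqi mu (flux mu k (yos phi l) (u t)).
Proof.
move=> l0 gu; have [_ _ [c c0 hc] _ _] := gu; apply: (dom_sqi su0 (c := c)).
  exact: (meas2_1 (u := (fun t => flux mu k (yos phi l) (u t))) t (good_meas_flux l0 gu)).
by move=> x; have [] := hc t x.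
Qed.

Let good_sqi l u t : good l u -> sqi mu (u t).
Proof.
move=> gu; have [m _ [c c0 hc] _ _] := gu; apply: (dom_sqi su0 (c := c)).
  exact: (meas2_1 t m).
by move=> x; have [] := hc t x.
Qed.

Let good_flux2 l u : 0 < l -> good l u ->
  itg2 mu (tau T) (fun s x => flux mu k (yos phi l) (u s) x ^+ 2).
Proof.
move=> l0 gu; have [_ _ [c c0 hc] _ _] := gu.
apply: (dom2_itg2 T su0 (c := c * c)).
  by apply: measurable_funX; exact: good_meas_flux l0 gu.
by move=> s x; rewrite expr2; apply: dom2_mul => //; have [] := hc s x.
Qed.

Let arith (a b c : R) : a <= b * (c + c) -> 2 * a <= 4 * c * b.
Proof. lra. Qed.

(** The squared distance is twice the primitive of the pairing of the
    derivatives with the difference, which by symmetry is minus the pairing of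
    the fluxes with the difference of the nonlocal Laplacians; almost
    monotonicity bounds it by (l1 + l2) times the squared norms of the
    fluxes. *)
Let cauchy l1 l2 u1 u2 t : 0 < l1 -> 0 < l2 -> good l1 u1 -> good l2 u2 ->
  \int[mu]_x (u1 t x - u2 t x) ^+ 2 <= 4 * Cw * (l1 + l2).
Proof.
move=> l10 l20 g1 g2.
have [m1 ch1 [c1 c10 b1] _ [e1 f1]] := g1.
have [m2 ch2 [c2 c20 b2] _ [e2 f2]] := g2.
pose w1 s := flux mu k (yos phi l1) (u1 s); pose w2 s := flux mu k (yos phi l2) (u2 s).
pose h s x := field mu k Om (yos phi l1) (u1 s) x - field mu k Om (yos phi l2) (u2 s) x.
pose D s x := u1 s x - u2 s x.
have mh : meas2 (h : TR -> X -> R).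
  by apply: measurable_funB; [exact: good_meas_field l10 g1|exact: good_meas_field l20 g2].
have mD : meas2 (D : TR -> X -> R) by exact: measurable_funB.
have sw1 s : sqi mu (w1 s) by exact: good_sqi_flux.
have sw2 s : sqi mu (w2 s) by exact: good_sqi_flux.
have su1 s : sqi mu (u1 s) by exact: good_sqi g1.
have su2 s : sqi mu (u2 s) by exact: good_sqi g2.
have hb s x : `|h s x| <= (c1 + c2) * env u0 x.
  rewrite (le_trans (ler_normB _ _))// mulrDl; apply: lerD.
    by have [] := b1 s x.
  by have [] := b2 s x.
have Db s x : `|D s x| <= (c1 + c2) * env u0 x.
  rewrite (le_trans (ler_normB _ _))// mulrDl; apply: lerD.
    by have [] := b1 s x.
  by have [] := b2 s x.
have c0 : 0 <= c1 + c2 by rewrite addr_ge0.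
have ih x : itg (tau T) (h ^~ x).
  apply: (itg_bnd (tau T) (c := (c1 + c2) * env u0 x)) => [|s]; last exact: hb.
  exact: (meas2_2 x mh).
have ifield (l : R) u (c : R) x : 0 < l -> good l u -> (forall s, `|field mu k Om (yos phi l) (u s) x| <= c) ->
    itg (tau T) (fun s => field mu k Om (yos phi l) (u s) x).
  move=> l0 gu fc; apply: (itg_bnd (tau T) (c := c)) => // .
  exact: (meas2_2 x (good_meas_field l0 gu)).
have DE s x : D s x = 0 + prim T (h ^~ x) s.
  rewrite /D e1 e2 add0r (primB s (h := fun s => field mu k Om (yos phi l1) (u1 s) x)).
  - by ring.
  - by apply: (ifield l1 u1 (c1 * env u0 x)) => // r; have [] := b1 r x.
  - by apply: (ifield l2 u2 (c2 * env u0 x)) => // r; have [] := b2 r x.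
have ihD : itg2 mu (tau T) (fun s x => h s x * D s x).
  apply: (dom2_itg2 T su0 (c := (c1 + c2) * (c1 + c2))); first exact: measurable_funM.
  by move=> s x; exact: dom2_mul.
have E x : (u1 t x - u2 t x) ^+ 2 = 2 * prim T (fun s => h s x * D s x) t.
  rewrite -/(D t x) DE (prim_sqr 0 t (ih x)) expr0n/= add0r; congr (2 * _).
  by apply: eq_prim => s; rewrite -DE.
rewrite (eq_Rint _ E) RintZ; last exact: itg_prim2.
rewrite prim_fubini//.
have iW1 := itg2_Rint1 (good_flux2 l10 g1); have iW2 := itg2_Rint1 (good_flux2 l20 g2).
pose B s := (l1 + l2) * (\int[mu]_x w1 s x ^+ 2 + \int[mu]_x w2 s x ^+ 2).
have iB : itg (tau T) B by apply: itgZ; exact: itgD.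
have lp : 0 <= l1 + l2 by rewrite addr_ge0 ?ltW.
have key s : \int[mu]_x (h s x * D s x) <= B s.
  have sw := sqiB (sw1 s) (sw2 s); have sD := sqiB (su1 s) (su2 s).
  have -> : \int[mu]_x (h s x * D s x) = - \int[mu]_x ((w1 s x - w2 s x) * (Dl (u1 s) x - Dl (u2 s) x)).
    transitivity (- \int[mu]_x (Dl (fun y => w1 s y - w2 s y) x * D s x)).
      rewrite -RintN; last by apply: sqi_mul => //; exact: Dop_sqi.
      apply: eq_Rint => x; rewrite (DopB mk k_ge0 k_le); [|exact: sqi_itg|exact: sqi_itg].
      rewrite /h /field -/(w1 s) -/(w2 s) -[in RHS](_ : chi x * D s x = D s x); last first.
        by rewrite /D mulrBr ch1 ch2.
      by ring.
    rewrite (Dop_sym mk k_ge0 k_le k_sym sw sD); congr (- _).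
    by apply: eq_Rint => x; rewrite (DopB mk k_ge0 k_le); [|exact: sqi_itg|exact: sqi_itg].
  rewrite lerNl /B -(RintD (sw1 s).2 (sw2 s).2).
  rewrite -RintZ; last by apply: itgD; [exact: (sw1 s).2|exact: (sw2 s).2].
  rewrite -RintN; last by apply: itgZ; apply: itgD; [exact: (sw1 s).2|exact: (sw2 s).2].
  apply: le_Rint.
  - by apply: itgN; apply: itgZ; apply: itgD; [exact: (sw1 s).2|exact: (sw2 s).2].
  - by apply: sqi_mul => //; apply: sqiB; exact: Dop_sqi.
  - by move=> x; exact: yos_almost_monotone.
have B0 s : 0 <= B s.
  by rewrite mulr_ge0// addr_ge0//; apply: Rint_ge0 => x; exact: sqr_ge0.
have h1 : prim T (fun s => \int[mu]_x (h s x * D s x)) t <= \int[tau T]_s B s.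
  apply: (le_trans (prim_le t (itg2_Rint1 ihD) iB key)).
  exact: prim_le_total.
have h2 : \int[tau T]_s B s <= (l1 + l2) * (Cw + Cw).
  rewrite (RintZ _ (itgD iW1 iW2)) (RintD iW1 iW2).
  by apply: ler_wpM2l; [exact: lp|exact: lerD f1 f2].
exact: arith (le_trans h1 h2).
Qed.

Let lam (n : nat) : R := 4^-1 ^+ n.
Let lam0 n : 0 < lam n. Proof. by rewrite exprn_gt0. Qed.
Let lam_cvg : lam @ \oo --> 0.
Proof. by apply: cvg_expr; rewrite ger0_norm ?invr_ge0// invf_lt1// ltr1n. Qed.

Let Dop_itg2 (w : R -> X -> R) : itg2 mu (tau T) w -> itg2 mu (tau T) (fun s => Dl (w s)).
Proof.
move=> iw; apply: itg2_tonelli.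
- exact: meas_Dop (itg2_meas iw).
- by apply: filterS (itg2_ae1 iw) => s is_; exact: Dop_itg.
- have iwa := itg2_Rint1 (integrable_norm iw : itg2 mu (tau T) (fun s x => `|w s x|)).
  have m1 : meas2 ((fun s => Dl (w s)) : TR -> X -> R) by exact: meas_Dop (itg2_meas iw).
  apply: (itg_ae_le _ (itgZ (2 * (M * mass mu)) iwa)).
    apply: (meas_Rint1 mu (u := fun s x => `|Dl (w s) x|)); exact: measurableT_comp m1.
  apply: filterS (itg2_ae1 iw) => s is_; rewrite ger0_norm ?Rint_ge0//.
  exact: (Dop_Rint_abs mk k_ge0 k_le is_).
Qed.

Let Dop_Rint2 (w : R -> X -> R) : itg2 mu (tau T) w ->
  \int[tau T]_s \int[mu]_x `|Dl (w s) x| <= 2 * (M * mass mu) * \int[tau T]_s \int[mu]_x `|w s x|.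
Proof.
move=> iw; have iwa := itg2_Rint1 (integrable_norm iw : itg2 mu (tau T) (fun s x => `|w s x|)).
rewrite -RintZ//; apply: ae_le_Rint.
- exact: (itg2_Rint1 (integrable_norm (Dop_itg2 iw) : itg2 mu (tau T) (fun s x => `|Dl (w s) x|))).
- exact: itgZ.
- by apply: filterS (itg2_ae1 iw) => s is_; exact: (Dop_Rint_abs mk k_ge0 k_le is_).
Qed.

Let sqr_cvg (y : R^nat) (c : R) : (forall n, 0 <= y n) -> (forall n, y n ^+ 2 <= c * lam n) ->
  y @ \oo --> 0.
Proof.
move=> y0 yc; apply/cvgr0Pnorm_le => e e0.
have h : (fun n => c * lam n) @ \oo --> 0 by rewrite -[0](mulr0 c); exact: cvgMr.
have e2 : 0 < e ^+ 2 by rewrite exprn_gt0.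
move/cvgr0Pnorm_le : h => /(_ _ e2); apply: filterS => n hn.
rewrite ger0_norm// -(@ler_sqr R)// ?nnegrE ?(ltW e0)//.
by rewrite (le_trans (yc n))// (le_trans _ hn)// ler_norm.
Qed.

(** The approximations with parameters 4^-n converge in L^2 uniformly in time,
    and for each t almost everywhere. Then their fluxes converge almost
    everywhere, and, being bounded in L^2, in L^1 of space-time. This passes
    to the limit in the integral equation, whose nonlocal operator is bounded
    on L^1. *)
Theorem core_existence : exists u : R -> X -> R,
  [/\ meas2 (u : TR -> X -> R) /\ (forall t x, chi x * u t x = u t x),
      forall t, sqi mu (u t),
      forall t e, 0 < e -> \forall s \near t, \int[mu]_x (u s x - u t x) ^+ 2 <= e,
      itg2 mu (tau T) (fun t x => flux mu k phi (u t) x ^+ 2) &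
      forall t, {ae mu, forall x, u t x = u0 x + prim T (fun s => field mu k Om phi (u s) x) t}].
Proof.
have vex n : {u | good (lam n) u} by apply: cid; exact: good_exists.
pose v n := sval (vex n).
have gv n : good (lam n) (v n) by exact: svalP.
have C0 : 0 <= 4 * Cw by rewrite mulr_ge0.
have mv n : meas2 (v n : TR -> X -> R) by have [] := gv n.
have sv n t : sqi mu (v n t) by exact: good_sqi (gv n).
have [uu [muu cuu buu]] := L2_limit C0 mv (fun i j t => sqiB (sv i t) (sv j t))
  (fun i j t => cauchy t (lam0 i) (lam0 j) (gv i) (gv j)).
pose u t x := chi x * uu t x.
have chi_sq x : chi x * chi x = chi x.
  by rewrite indicE; case: (_ \in _); rewrite ?mulr0 ?mulr1.
have chv n t x : chi x * v n t x = v n t x by have [] := gv n.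
have mu2 : meas2 (u : TR -> X -> R) by apply: measurable_funM => //; exact: meas_chi.
have chu t x : chi x * u t x = u t x by rewrite /u mulrA chi_sq.
have cu t : {ae mu, forall x, (fun n => v n t x) @ \oo --> u t x}.
  apply: filterS (cuu t) => x h.
  rewrite (_ : (fun n => v n t x) = (fun n => chi x * v n t x)).
    exact: cvgMr.
  by apply/funext => n; rewrite chv.
have suv t n : sqi mu (fun x => u t x - v n t x).
  apply: (sqi_le _ (buu t n).1); first by apply: measurable_funB; exact: meas2_1.
  by move=> x; rewrite /u -[in leLHS](chv n) -mulrBr; exact: chi_abs.
have buv t n : \int[mu]_x (u t x - v n t x) ^+ 2 <= 4 * Cw * lam n.
  apply: (le_trans _ (buu t n).2); apply: le_Rint; [exact: (suv t n).2|exact: (buu t n).1.2|].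
  move=> x; rewrite /u -[in leLHS](chv n) -mulrBr.
  rewrite -(real_normK (num_real (chi x * _))) -(real_normK (num_real (uu t x - _))).
  by rewrite ler_sqr ?nnegrE//; exact: chi_abs.
have su t : sqi mu (u t).
  rewrite (_ : u t = fun x => (u t x - v 0%N t x) + v 0%N t x); first exact: sqiD.
  by apply/funext => x; rewrite subrK.
have L1uv t : (fun n => \int[mu]_x `|u t x - v n t x|) @ \oo --> 0.
  apply: (@sqr_cvg _ (mass mu * (4 * Cw))) => n; first by apply: Rint_ge0.
  rewrite (le_trans (sqr_Rint_abs_le (suv t n)))// -mulrA.
  by rewrite ler_wpM2l ?mass_ge0.
pose w t := flux mu k phi (u t).
pose wn n t := flux mu k (yos phi (lam n)) (v n t).
have mw : meas2 (w : TR -> X -> R).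
  apply: (measurableT_comp (f := phi)); first exact: continuous_measurable_fun.
  exact: meas_Dop.
have mwn n : meas2 (wn n : TR -> X -> R) by exact: good_meas_flux (gv n).
have cz t : {ae mu, forall x, (fun n => Dl (v n t) x) @ \oo --> Dl (u t) x}.
  apply: filterS (cu t) => x cx.
  apply: cvgB; last by apply: cvgMr.
  have h : (fun n => M * \int[mu]_y `|u t y - v n t y|) @ \oo --> 0.
    by rewrite -[0](mulr0 M); exact: cvgMr.
  apply/cvgrPdist_le => e e0.
  move/cvgr0Pnorm_le : h => /(_ _ e0); apply: filterS => n hn.
  rewrite -(KopB mk k_ge0 k_le); [|exact: sqi_itg|exact: sqi_itg].
  apply: (le_trans (Kop_abs mk k_ge0 k_le x (sqi_itg (suv t n)))).
  by rewrite (le_trans _ hn)// ler_norm.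
have cw t : {ae mu, forall x, (fun n => wn n t x) @ \oo --> w t x}.
  by apply: filterS (cz t) => x cx; exact: yos_cvg.
have wn2 n := good_flux2 (lam0 n) (gv n).
have wnC n : \int[tau T]_t \int[mu]_x wn n t x ^+ 2 <= Cw by have [_ _ _ _ []] := gv n.
have [iw2 w2C] : itg2 mu (tau T) (fun t x => w t x ^+ 2) /\ \int[tau T]_t \int[mu]_x w t x ^+ 2 <= Cw.
  apply: (@fatou2 _ _ X _ R mu (tau T) (fun n t x => wn n t x ^+ 2) (fun t x => w t x ^+ 2) Cw wn2).
  - by move=> n t x; exact: sqr_ge0.
  - exact: measurable_funX mw.
  - by move=> t x; exact: sqr_ge0.
  - by move=> t; apply: filterS (cw t) => x cx; exact: cvgM.
  - exact: wnC.
pose e n t x := wn n t x - w t x.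
have me n : meas2 (e n : TR -> X -> R) by exact: (measurable_funB (mwn n) mw).
have e2_le n t x : e n t x ^+ 2 <= 2 * (wn n t x ^+ 2 + w t x ^+ 2).
  by rewrite /e; have := sqr_ge0 (wn n t x + w t x); nra.
have ib n : itg2 mu (tau T) (fun t x => 2 * (wn n t x ^+ 2 + w t x ^+ 2)).
  by apply: itgZ; apply: itgD => //; exact: wn2.
have ie2 n : itg2 mu (tau T) (fun t x => e n t x ^+ 2).
  apply: itg2_le (ib n) _; first exact: (measurable_funX 2 (me n)).
  by move=> t x; rewrite ger0_norm ?sqr_ge0.
have e2C n : \int[tau T]_t \int[mu]_x e n t x ^+ 2 <= 4 * Cw.
  have -> : 4 * Cw = 2 * (Cw + Cw) by ring.
  apply: (@le_trans _ _ (\int[tau T]_t (2 * (\int[mu]_x wn n t x ^+ 2 + \int[mu]_x w t x ^+ 2)))).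
    apply: ae_le_Rint; first exact: itg2_Rint1 (ie2 n).
      by apply: itgZ; apply: itgD; [exact: itg2_Rint1 (wn2 n)|exact: itg2_Rint1 iw2].
    have := itg2_ae1 (ie2 n); have := itg2_ae1 (wn2 n); have := itg2_ae1 iw2.
    apply: filterS3 => t i1 i2 i3; rewrite -RintD// -RintZ; last exact: itgD.
    apply: le_Rint => //; first by apply: itgZ; exact: itgD.
  rewrite RintZ; last by apply: itgD; [exact: itg2_Rint1 (wn2 n)|exact: itg2_Rint1 iw2].
  rewrite RintD; [|exact: itg2_Rint1 (wn2 n)|exact: itg2_Rint1 iw2].
  by apply: ler_wpM2l; [by []|exact: (lerD (wnC n) w2C)].
have e0 t : {ae mu, forall x, (fun n => e n t x) @ \oo --> 0}.
  apply: filterS (cw t) => x cx; rewrite -[0](subrr (w t x)).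
  by apply: cvgB => //; exact: cvg_cst.
have [ie1 ce] := L1_limit me e0 ie2 e2C.
have ie n : itg2 mu (tau T) (e n).
  by apply: itg2_le (ie1 n) _.
have iw := itg2_sq mw iw2.
have iwn n := itg2_sq (mwn n) (wn2 n).
have ichi (f : R -> X -> R) : itg2 mu (tau T) f -> itg2 mu (tau T) (fun t x => - (chi x * f t x)).
  move=> fi; apply: itg2_le (integrable_norm fi : itg2 mu (tau T) (fun t x => `|f t x|)) _.
    apply: measurableT_comp => //; apply: measurable_funM; first exact: meas_chi.
    exact: itg2_meas fi.
  by move=> t x; rewrite normrN; exact: chi_abs.
have iF := ichi _ (Dop_itg2 iw).
have iFn n := ichi _ (Dop_itg2 (iwn n)).
exists u; split => //.
  move=> t eps eps0.
  (* (a + b - c)^2 <= 3 (a^2 + b^2 + c^2), where the three squares integrate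
      to at most eps / 12, eps / 6 and eps / 12. *)
  have [n hn] : exists n, 4 * Cw * lam n <= eps / 12.
    have h : (fun n => 4 * Cw * lam n) @ \oo --> 0 by rewrite -[0](mulr0 (4 * Cw)); exact: cvgMr.
    have e12 : 0 < eps / 12 by rewrite divr_gt0.
    move/cvgr0Pnorm_le : h => /(_ _ e12) [n _ /(_ n (leqnn n)) hn].
    by exists n; rewrite (le_trans _ hn)// ler_norm.
  have [_ _ _ [c c0 lip] _] := gv n.
  pose I := \int[mu]_x env u0 x ^+ 2.
  have I0 : 0 <= I by apply: Rint_ge0 => x; exact: sqr_ge0.
  have hc : (fun s : R => c ^+ 2 * `|s - t| ^+ 2 * I) @ t --> c ^+ 2 * `|t - t| ^+ 2 * I.
    apply: cvgM; last exact: cvg_cst.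
    apply: cvgM; first exact: cvg_cst.
    have hN : (fun s : R => `|s - t|) @ t --> `|t - t|.
      by apply: cvg_norm; apply: cvgB; [exact: cvg_id|exact: cvg_cst].
    exact: (cvgM hN hN).
  rewrite subrr normr0 expr0n/= mulr0 mul0r in hc.
  have e6 : 0 < eps / 6 by rewrite divr_gt0.
  move/cvgr0Pnorm_le : hc => /(_ _ e6); apply: filterS => s hs.
  have i1 := (suv s n).2; have i3 := (suv t n).2; have i2 := (sqiB (sv n s) (sv n t)).2.
  have b2 : \int[mu]_x (v n s x - v n t x) ^+ 2 <= eps / 6.
    apply: (@le_trans _ _ (c ^+ 2 * `|s - t| ^+ 2 * I)); last by rewrite (le_trans _ hs)// ler_norm.
    rewrite -RintZ; last exact: (env_sqi su0).2.
    apply: le_Rint => //; first by apply: itgZ; exact: (env_sqi su0).2.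
    move=> x; rewrite -(real_normK (num_real (v n s x - _))) -!exprMn ler_sqr ?nnegrE ?mulr_ge0 ?env_ge0//.
  apply: (@le_trans _ _ (\int[mu]_x (3 * ((u s x - v n s x) ^+ 2 + (v n s x - v n t x) ^+ 2 + (u t x - v n t x) ^+ 2)))).
    apply: le_Rint; first exact: (sqiB (su s) (su t)).2.
      by apply: itgZ; apply: itgD => //; exact: itgD.
    move=> x; set a := u s x - v n s x; set b := v n s x - v n t x; set g := u t x - v n t x.
    have -> : u s x - u t x = a + b - g by rewrite /a /b /g; ring.
    have := sqr_ge0 (a - b); have := sqr_ge0 (a + g); have := sqr_ge0 (b + g); nra.
  rewrite RintZ; last by apply: itgD => //; exact: itgD.
  rewrite RintD//; last exact: itgD.
  rewrite RintD//; have := buv s n; have := buv t n; lra.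
move=> t.
pose U x := u0 x + prim T (fun s => field mu k Om phi (u s) x) t.
have iU : itg mu U by apply: itgD; [exact: sqi_itg|exact: itg_prim2].
have iuU := itgB (sqi_itg (su t)) iU.
suff h : \int[mu]_x `|u t x - U x| = 0.
  have := Rint_eq0_ae (itg_abs iuU) (fun x => normr_ge0 _) h.
  by apply: filterS => x /normr0_eq0/eqP; rewrite subr_eq0 => /eqP.
apply/eqP; rewrite eq_le Rint_ge0// andbT.
have key n : \int[mu]_x `|u t x - U x| <= \int[mu]_x `|u t x - v n t x| +
    2 * (M * mass mu) * \int[tau T]_s \int[mu]_x `|e n s x|.
  pose hn s x := field mu k Om (yos phi (lam n)) (v n s) x - field mu k Om phi (u s) x.
  have ihn : itg2 mu (tau T) hn := itgB (iFn n) iF.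
  have ihna : itg2 mu (tau T) (fun s x => `|hn s x|) := integrable_norm ihn.
  have i1 := itg_abs (sqi_itg (suv t n)); have i2 := itg2_Rint2 ihna.
  have s1 : \int[mu]_x `|u t x - U x| <= \int[mu]_x (`|u t x - v n t x| + \int[tau T]_s `|hn s x|).
    apply: ae_le_Rint; [exact: itg_abs|exact: itgD|].
    have := itg2_ae2 iF; have := itg2_ae2 (iFn n); have := itg2_ae2 ihn.
    apply: filterS3 => x j1 j2 j3.
    have [_ _ _ _ [ve _]] := gv n.
    have vU : v n t x - U x = prim T (hn ^~ x) t.
      by rewrite /U ve (primB t j2 j3); ring.
    have -> : u t x - U x = (u t x - v n t x) + (v n t x - U x) by rewrite addrA subrK.
    by rewrite (le_trans (ler_normD _ _))// lerD2l vU; exact: prim_abs.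
  apply: (le_trans s1); rewrite RintD// lerD2l (fubiniR ihna).
  apply: (le_trans _ (Dop_Rint2 (ie n))).
  apply: ae_le_Rint.
  - exact: itg2_Rint1 ihna.
  - exact: (itg2_Rint1 (integrable_norm (Dop_itg2 (ie n)) : itg2 mu (tau T) (fun s x => `|Dl (e n s) x|))).
  - have := itg2_ae1 ihna; have := itg2_ae1 iw; have := itg2_ae1 (iwn n).
    apply: filterS3 => s j1 j2 j3; apply: le_Rint => //.
      by apply: itg_abs; apply: Dop_itg => //; exact: itgB.
    move=> x; rewrite /hn /field -/(w s) -/(wn n s) -opprD normrN -mulrBr.
    by rewrite (DopB mk k_ge0 k_le x j1 j2); exact: chi_abs.
have cc : (fun n => \int[mu]_x `|u t x - v n t x| +
    2 * (M * mass mu) * \int[tau T]_s \int[mu]_x `|e n s x|) @ \oo --> 0.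
  rewrite -[0]addr0; apply: cvgD => //.
  by rewrite -[0](mulr0 (2 * (M * mass mu))); exact: cvgMr.
rewrite -(cvg_lim _ cc)//; apply: limr_ge; first by apply/cvg_ex; exists 0.
by apply: nearW => n; exact: key.
Qed.

End existence.

(** * Smooth bumps *)

Section bump.
Context (R : realType).
Variable m : {poly R}.
Implicit Types (q : {poly R}) (j : nat).

(** The functions q m^-j exp (- 1 / m), extended by 0 to the set where the
    polynomial m is not positive. They form a class closed under
    differentiation, which gives smoothness by induction. *)
Definition flat q j (x : R) : R :=
  if 0 < m.[x] then q.[x] * (m.[x])^-1 ^+ j * expR (- (m.[x])^-1) else 0.

(** The numerator of the derivative over m^(j + 2). *)
Definition flatD q j : {poly R} := q^`() * m ^+ 2 - (q * m^`() * m) *+ j + q * m^`().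

Let der_horner q (x : R) : is_derive x 1 (horner q) q^`().[x].
Proof. exact: is_derive_poly. Qed.

(** The exponential exp s dominates s^(j + 2) / (j + 2)!, with s = 1 / m. *)
Lemma flat_bound q j x : `|flat q j x| <= (j.+2)`!%:R * `|q.[x]| * (m.[x]) ^+ 2.
Proof.
rewrite /flat; case: ltP => [m0|_]; last first.
  by rewrite normr0 mulr_ge0 ?sqr_ge0// mulr_ge0.
have mV : 0 < (m.[x])^-1 by rewrite invr_gt0.
rewrite !normrM normrX (ger0_norm (expR_ge0 _)) (gtr0_norm mV).
rewrite (mulrC _%:R) -!mulrA; apply: ler_wpM2l; first exact: normr_ge0.
set s := (m.[x])^-1; have s0 : 0 < s by rewrite invr_gt0.
have := expR_ge1Dxn j.+1 (ltW s0) => h.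
have f0 : 0 < (j.+2)`!%:R :> R by rewrite ltr0n fact_gt0.
have h1 : s ^+ j.+2 <= (j.+2)`!%:R * expR s.
  rewrite mulrC -ler_pdivrMr//; apply: le_trans h; lra.
have -> : m.[x] = s^-1 by rewrite /s invrK.
move: s s0 {h} h1 {mV} => s s0 h1.
rewrite expRN ler_pdivrMr ?expR_gt0// -mulrA mulrCA exprVn.
rewrite ler_pdivlMl ?exprn_gt0// -exprD add2n; exact: h1.
Qed.

(** At a zero of m the difference quotient is bounded by |m| times a
    difference quotient of m, by the quadratic bound, and tends to 0. *)
Lemma is_derive_flat q j (x : R) : is_derive x 1 (flat q j) (flat (flatD q j) j.+2 x).
Proof.
have cm : continuous (horner m) := @continuous_horner R m.
have cq : continuous (horner q) := @continuous_horner R q.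
have [m0|m0|m0] := ltgtP (m.[x]) 0.
- rewrite {2}/flat ltNge (ltW m0)/=.
  apply: near_eq_is_derive (is_derive_cst 0 x 1).
  have : \forall y \near x, horner m y < 0 by have := lt_nbhsl m0; exact: (@cm x).
  by apply: filterS => y my; rewrite /flat ltNge (ltW my).
- pose G (y : R) := horner q y * (horner m y)^-1 ^+ j * expR (- (horner m y)^-1).
  have nz : m.[x] != 0 by rewrite gt_eqF.
  have dV := is_deriveV nz (der_horner m x).
  have d1 : is_derive x 1 (fun y => (horner m y)^-1 ^+ j)
      (- (j%:R * (m.[x])^-1 ^+ j.+1 * m^`().[x])).
    have d1 := is_deriveX j dV; rewrite exprfctE in d1.
    apply: is_derive_eq d1 _; rewrite /GRing.scale/= -exprVn.
    by case: (j) => [|i]; rewrite ?mul0r ?oppr0// !exprS; ring.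
  have d2 := is_deriveM (der_horner q x) d1.
  have d3 := @is_derive1_comp _ expR (fun y => - (horner m y)^-1) x _ _
      (is_derive_expR _) (is_deriveN dV).
  have d4 := is_deriveM d2 d3.
  have dG : is_derive x 1 G (flat (flatD q j) j.+2 x).
    apply: is_derive_eq d4 _.
    rewrite /flat m0 /flatD (exprS _ j.+1) !(exprS _ j) mulrfctE.
    rewrite !hornerE hornerMn !hornerE /GRing.scale/= -mulr_natl.
    have e3 : m.[x] ^- 2 = (m.[x])^-1 ^+ 2 by rewrite exprVn.
    rewrite e3 expr2; set P := (m.[x])^-1 ^+ j; set E := expR _.
    by field.
  apply: near_eq_is_derive dG.
  have : \forall y \near x, 0 < horner m y by have := lt_nbhsr m0; exact: (@cm x).
  by apply: filterS => y my; rewrite /flat my.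
- have f0 p i : flat p i x = 0 by rewrite /flat m0 ltxx.
  rewrite f0.
  suff h : (fun h => h^-1 *: (flat q j (h *: 1 + x) - flat q j x)) @ 0^' --> (0 : R).
    by apply: DeriveDef; [apply/cvg_ex; exists 0|exact: cvg_lim].
  have dm : (fun h => h^-1 *: (horner m (h *: 1 + x) - horner m x)) @ 0^' --> (m^`().[x] : R).
    by have [dm <-] := der_horner m x; exact: dm.
  have sh : (fun h : R => h *: 1 + x) @ 0^' --> x.
    have : (fun h : R => h *: 1 + x) @ 0 --> 0 *: 1 + x.
      apply: cvgD; last exact: cvg_cst.
      by apply: cvgZl; exact: cvg_id.
    by rewrite scale0r add0r; apply: cvg_trans; apply: cvg_app; exact: cvg_within.
  have cmh : (fun h : R => horner m (h *: 1 + x)) @ 0^' --> 0.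
    by have := cvg_comp _ _ sh (@cm x); rewrite m0.
  have cqh : (fun h : R => horner q (h *: 1 + x)) @ 0^' --> horner q x.
    exact: cvg_comp _ _ sh (@cq x).
  pose C : R := (j.+2)`!%:R.
  have c0 : (fun h : R => C * `|horner q (h *: 1 + x)| * `|horner m (h *: 1 + x)| *
     `|h^-1 *: (horner m (h *: 1 + x) - horner m x)|) @ 0^' --> 0.
    have := cvgM (cvgM (cvgM (cvg_cst C) (cvg_norm cqh)) (cvg_norm cmh)) (cvg_norm dm).
    by rewrite normr0 mulr0 mul0r; exact.
  apply/cvgr0Pnorm_le => e e0; move/cvgr0Pnorm_le : c0 => /(_ _ e0).
  apply: filterS => h; apply: le_trans.
  rewrite f0 subr0 -/(horner m x) m0 subr0 /GRing.scale/=.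
  apply: le_trans (ler_norm _).
  rewrite [leLHS]normrM [in leRHS](normrM h^-1) [leRHS]mulrCA; apply: ler_wpM2l => //.
  by apply: (le_trans (flat_bound q j _)); rewrite -real_normK ?num_real// expr2 !mulrA.
Qed.

Lemma flat_smooth q j n (x : R) : derivable (derive1n n (flat q j)) x 1.
Proof.
elim: n q j => [|n ih] q j; first by have [] := is_derive_flat q j x.
rewrite derive1Sn (_ : derive1 (flat q j) = flat (flatD q j) j.+2) //.
by apply/funext => y; rewrite derive1E; have [_ ->] := is_derive_flat q j y.
Qed.

Lemma flat_cont q j : continuous (flat q j).
Proof.
exact: is_derive_continuous (is_derive_flat q j).
Qed.

End bump.

(** The bump is the normalised flat function of m = (x - a) (b - x). *)
Lemma bump_exists (R : realType) (a b : R) : a < b -> exists rho F : R -> R,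
  [/\ forall n (x : R), derivable (derive1n n rho) x 1,
      forall x, 0 <= rho x, forall x, (x <= a) || (b <= x) -> rho x = 0,
      forall x : R, is_derive x 1 F (rho x) &
      (forall x, x <= a -> F x = 0) /\ (forall x, b <= x -> F x = 1)].
Proof.
move=> ab; pose m : {poly R} := ('X - a%:P) * (b%:P - 'X).
have mE x : m.[x] = (x - a) * (b - x) by rewrite /m !hornerE.
pose f := flat m 1 0.
have f0 x : 0 <= f x.
  by rewrite /f /flat; case: ifP => // _; rewrite expr0 mulr1 hornerC mul1r expR_ge0.
have fout x : (x <= a) || (b <= x) -> f x = 0.
  move=> h; rewrite /f /flat mE ifF//; apply/negbTE; rewrite -leNgt.
  case/orP : h => h.
    by rewrite mulr_le0_ge0 ?subr_le0 ?subr_ge0// (le_trans h)// ltW.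
  by rewrite mulr_ge0_le0 ?subr_le0 ?subr_ge0// (le_trans _ h)// ltW.
have [F dF] := antiderivative (@flat_cont _ m 1 0).
have cF : continuous F := is_derive_continuous dF.
have Fin : 0 < F b - F a.
  have [c /[!in_itv]/= /andP[ac cb] ->] := MVT ab (fun x _ => dF x) (continuous_subspaceT cF).
  rewrite mulr_gt0 ?subr_gt0// /f /flat mE mulr_gt0 ?subr_gt0//.
  by rewrite expr0 mulr1 hornerC mul1r expR_gt0.
have Fcst x y : x < y -> (forall z, x < z < y -> f z = 0) -> F y = F x.
  move=> xy fz; have [c /[!in_itv]/= cxy e] := MVT xy (fun x _ => dF x) (continuous_subspaceT cF).
  by apply/eqP; rewrite -subr_eq0 e -/f fz// mul0r.
set I := F b - F a.
exists (fun x => I^-1 * f x), (fun x => I^-1 * (F x - F a)); split.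
- move=> n x; rewrite (_ : (fun y => _) = flat m (I^-1)%:P 0); first exact: flat_smooth.
  by apply/funext => y; rewrite /f /flat; case: ifP => _; rewrite ?mulr0// !hornerC expr0 !mulr1 mul1r.
- by move=> x; rewrite mulr_ge0// invr_ge0 ltW.
- by move=> x /fout ->; rewrite mulr0.
- move=> x; have := is_deriveB (dF x) (is_derive_cst (F a) x 1); rewrite subr0 => h.
  exact: (is_deriveZ I^-1 h).
- split => x.
    rewrite le_eqVlt => /predU1P[->|xa]; first by rewrite subrr mulr0.
    rewrite (Fcst _ _ xa) ?subrr ?mulr0// => z /andP[_ za].
    by apply: fout; rewrite (ltW za).
  rewrite le_eqVlt => /predU1P[<-|bx]; first by rewrite mulVf// gt_eqF.
  rewrite (Fcst _ _ bx) ?mulVf ?gt_eqF// => z /andP[bz _].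
  by apply: fout; rewrite (ltW bz) orbT.
Qed.

Lemma derive1nB (R : realType) (f g : R -> R) n :
  (forall i (x : R), derivable (derive1n i f) x 1) ->
  (forall i (x : R), derivable (derive1n i g) x 1) ->
  derive1n n (fun x => f x - g x) = (fun x => derive1n n f x - derive1n n g x).
Proof.
move=> df dg; elim: n => [|n ih]//.
rewrite !derive1nS ih; apply/funext => x; rewrite !derive1E.
by rewrite deriveB.
Qed.

(** Each F is a smooth step from 0 to 1, so the difference of two steps has
    compact support, and its derivative is the difference of two bumps. *)
Lemma test_function_bumps (R : realType) (T a1 b1 a2 b2 : R) :
  0 < a1 -> a1 < b1 -> b1 < T -> 0 < a2 -> a2 < b2 -> b2 < T ->
  forall rho1 F1 rho2 F2 : R -> R,
  (forall n (x : R), derivable (derive1n n rho1) x 1) ->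
  (forall n (x : R), derivable (derive1n n rho2) x 1) ->
  (forall x : R, is_derive x 1 F1 (rho1 x)) -> (forall x : R, is_derive x 1 F2 (rho2 x)) ->
  (forall x, x <= a1 -> F1 x = 0) -> (forall x, x <= a2 -> F2 x = 0) ->
  (forall x, b1 <= x -> F1 x = 1) -> (forall x, b2 <= x -> F2 x = 1) ->
  test_function T (fun x => F1 x - F2 x) /\
  (forall x, derive1 (fun x => F1 x - F2 x) x = rho1 x - rho2 x).
Proof.
move=> a10 ab1 b1T a20 ab2 b2T rho1 F1 rho2 F2 s1 s2 d1 d2 z1 z2 o1 o2.
have D x : derive1 (fun x => F1 x - F2 x) x = rho1 x - rho2 x.
  by rewrite derive1E; have [_ ->] := is_deriveB (d1 x) (d2 x).
have sub : supp (fun x => F1 x - F2 x) `<=` `[Num.min a1 a2, Num.max b1 b2].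
  rewrite /supp closureE; apply: smallest_sub; first exact: interval_closed.
  move=> x /=; apply: contraNP => /negP; rewrite in_itv/= negb_and -!ltNge => /orP[|].
    by rewrite lt_min => /andP[h1 h2]; rewrite z1 ?z2 ?subrr ?ltW.
  by rewrite gt_max => /andP[h1 h2]; rewrite o1 ?o2 ?subrr ?ltW.
split; last exact: D.
split.
- move=> [|n] x.
    by have [] := is_deriveB (d1 x) (d2 x).
  rewrite derive1Sn (_ : derive1 _ = fun x => rho1 x - rho2 x); last exact/funext.
  by rewrite derive1nB//; apply: derivableB.
- apply: subclosed_compact sub; last exact: segment_compact.
  exact: closed_closure.
- apply: (subset_trans sub) => x /=; rewrite !in_itv/= => /andP[h1 h2].
  apply/andP; split.
    by rewrite (lt_le_trans _ h1)// lt_min a10 a20.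
  by rewrite (le_lt_trans h2)// gt_max b1T b2T.
Qed.

(** * The fundamental lemma for weak time derivatives *)

Section du_bois_reymond.
Context d (X : measurableType d) (R : realType) (mu : {finite_measure set X -> \bar R}) (T : R).
Hypothesis T0 : 0 < T.
Notation TR := (measurableTypeR R).

Lemma subinterval_near (t e : R) : t \in `[0, T] -> 0 < e ->
  exists a b, [/\ 0 < a, a < b, b < T & forall s, a <= s -> s <= b -> `|s - t| < e].
Proof.
rewrite in_itv/= => /andP[t0 tT] e0.
(* With h <= T / 8, the interval [t + h, t + 2 h] stays below T when t is in
    the first half, and [t - 2 h, t - h] stays above 0 otherwise. *)
pose h := Num.min e T / 8.
have h0 : 0 < h by rewrite divr_gt0// lt_min e0.
have he : 8 * h <= e by rewrite /h mulrC divfK// ge_min lexx.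
have hT : 8 * h <= T by rewrite /h mulrC divfK// ge_min lexx orbT.
move: h h0 he hT => h h0 he hT.
have [tT2|tT2] := leP (2 * t) T.
  exists (t + h), (t + 2 * h); split; [lra|lra|lra|].
  by move=> s s1 s2; rewrite ltr_norml; apply/andP; split; lra.
exists (t - 2 * h), (t - h); split; [lra|lra|lra|].
by move=> s s1 s2; rewrite ltr_norml; apply/andP; split; lra.
Qed.

Definition L2_continuous (u : R -> X -> R) := forall t, t \in `[0, T] -> forall e, 0 < e ->
  exists2 d, 0 < d & forall s, s \in `[0, T] -> `|s - t| < d ->
    \int[mu]_x (u s x - u t x) ^+ 2 <= e.

(** The null set may depend on the test function; below only one test function
    is used at a time. *)
Definition weakly_differentiable (u g : R -> X -> R) := forall phi, test_function T phi ->
  {ae mu, forall x, \int[tau T]_s (derive1 phi s * u s x) = - \int[tau T]_s (phi s * g s x)}.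

Variables (u g : R -> X -> R).
Hypothesis mu2 : meas2 (u : TR -> X -> R).
Hypothesis su : forall t, t \in `[0, T] -> sqi mu (u t).
Hypothesis cu : L2_continuous u.
Hypothesis mg : meas2 (g : TR -> X -> R).
Hypothesis g2 : itg2 mu (tau T) (fun t x => g t x ^+ 2).
Hypothesis wk : weakly_differentiable u g.

Let ig : itg2 mu (tau T) g. Proof. exact: itg2_sq. Qed.

Let P t x := u t x - prim T (g ^~ x) t.
Let mP : meas2 (P : TR -> X -> R).
Proof. by apply: measurable_funB => //; exact: meas_prim. Qed.

Let ae_sq : {ae mu, forall x, sqi (tau T) (g ^~ x)}.
Proof. by apply: filterS (itg2_ae2 g2) => x h; split => //; exact: (meas2_2 x mg). Qed.

Let G := \int[mu]_x \int[tau T]_s g s x ^+ 2.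
Let G0 : 0 <= G.
Proof. by apply: Rint_ge0 => x; apply: Rint_ge0 => s; exact: sqr_ge0. Qed.
Let iG : itg mu (fun x => \int[tau T]_s g s x ^+ 2). Proof. exact: itg2_Rint2 g2. Qed.

Let sP t : t \in `[0, T] -> sqi mu (P t).
Proof.
move=> tT; apply: sqiB; first exact: su.
have mp : measurable_fun setT (fun x => prim T (g ^~ x) t).
  exact: (meas2_1 t (meas_prim T mg)).
split => //; apply: itg_ae_le (itgZ T iG) _; first exact: measurable_funX.
apply: filterS ae_sq => x sx; rewrite ger0_norm ?sqr_ge0//; exact: prim_sqr_le.
Qed.

(** The primitive of g is 1 / 2-Hoelder in time with values in L^2 by
    Cauchy-Schwarz. *)
Let P_near t e : t \in `[0, T] -> 0 < e ->
  exists2 r, 0 < r & forall s, s \in `[0, T] -> `|s - t| < r ->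
    \int[mu]_x `|P t x - P s x| <= e.
Proof.
move=> tT e0.
have m1 : 0 < mass mu + 1 by rewrite ltr_wpDl// mass_ge0.
(* Chosen so that mass mu * (4 e') <= e^2, for the comparison of the L^1 and
    L^2 norms. *)
pose e' := e ^+ 2 / (4 * (mass mu + 1)).
have e'0 : 0 < e' by rewrite divr_gt0 ?exprn_gt0// mulr_gt0.
have [r1 r10 h1] := cu tT e'0.
have GG : 0 < G + 1 by rewrite ltr_wpDl.
exists (Num.min r1 (e' / (G + 1))); first by rewrite lt_min r10 divr_gt0.
move=> s sT; rewrite lt_min => /andP[st1 st2].
have {}h1 := h1 s sT st1.
have sPP := sqiB (sP tT) (sP sT).
have iu := (sqiB (su sT) (su tT)).2.
have h2 : \int[mu]_x (P t x - P s x) ^+ 2 <= 4 * e'.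
  apply: (@le_trans _ _ (\int[mu]_x (2 * ((u s x - u t x) ^+ 2 + `|s - t| * \int[tau T]_r g r x ^+ 2)))).
    apply: ae_le_Rint; first exact: sPP.2.
      by apply: itgZ; apply: itgD => //; exact: itgZ.
    apply: filterS ae_sq => x sx; have := prim_diff_sqr_le t s sx.
    rewrite /P; set p := prim T _ s; set q := prim T _ t => h.
    apply: (@le_trans _ _ (2 * ((u s x - u t x) ^+ 2 + (p - q) ^+ 2))).
      have := sqr_ge0 (u s x - u t x + (p - q)); nra.
    by rewrite ler_pM2l// lerD2l.
  rewrite RintZ; last by apply: itgD => //; exact: itgZ.
  rewrite RintD//; last exact: itgZ.
  rewrite RintZ// -/G.
  have : `|s - t| * G <= e'.
    rewrite (le_trans (ler_wpM2r G0 (ltW st2)))// mulrAC ler_pdivrMr//.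
    by apply: ler_wpM2l; [exact: ltW|rewrite lerDl].
  lra.
rewrite -(@ler_sqr R) ?nnegrE ?Rint_ge0 ?(ltW e0)//.
rewrite (le_trans (sqr_Rint_abs_le sPP))//.
rewrite (le_trans (ler_wpM2l (mass_ge0 mu) h2))//.
have -> : mass mu * (4 * e') = e ^+ 2 * (mass mu / (mass mu + 1)).
  by rewrite /e'; field; rewrite gt_eqF.
rewrite ler_piMr ?sqr_ge0// ler_pdivrMr// mul1r lerDl//.
Qed.

(** A bump of integral 1 supported near t averages P over times close to t; as
    P is continuous with values in L^1, the average is close to P t. The
    interval must stay inside ]0, T[ even when t is an endpoint. *)
Let mean_close t e : t \in `[0, T] -> 0 < e ->
  exists a b (rho F : R -> R), [/\ 0 < a, a < b & b < T] /\
   [/\ forall n (x : R), derivable (derive1n n rho) x 1,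
      forall x : R, is_derive x 1 F (rho x),
      (forall x, x <= a -> F x = 0) /\ (forall x, b <= x -> F x = 1),
      itg2 mu (tau T) (fun s x => rho s * (P t x - P s x)) &
      \int[mu]_x `|\int[tau T]_s (rho s * (P t x - P s x))| <= e].
Proof.
move=> tT e0; have [r r0 Pr] := P_near tT e0.
have [a [b [a0 ab bT abt]]] := subinterval_near tT r0.
have [rho [F [srho rho0 rhoN dF [F0 F1]]]] := bump_exists ab.
have cr : continuous rho := @smooth_continuous R rho 0 srho.
have mr : measurable_fun setT rho by exact: continuous_measurable_fun.
have ir : itg (tau T) rho by apply/(itg_tau T mr); exact: cont_itv_itg.
have TT : T \in `[0, T] by rewrite in_itv/= lexx ltW.
have r1 : \int[tau T]_s rho s = 1.
  by rewrite -(primT mr (lexx T)) (prim_antiderivative cr dF TT) F1 ?(ltW bT)// F0 ?(ltW a0)// subr0.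
pose v s x := rho s * (P t x - P s x).
have mv : meas2 (v : TR -> X -> R).
  apply: measurable_funM; first exact: (measurableT_comp mr measurable_snd).
  apply: measurable_funB => //.
  exact: (measurableT_comp (meas2_1 t mP) measurable_fst).
have vs s : itg mu (v s) /\ \int[mu]_x `|v s x| <= e * rho s.
  have [sab|sab] := boolP ((s <= a) || (b <= s)).
    rewrite /v rhoN// mulr0.
    have z : (fun x => 0 * (P t x - P s x)) = fun=> 0 by apply/funext => x; rewrite mul0r.
    rewrite z; split; first exact: itg0.
    by under eq_Rint do rewrite mul0r normr0; rewrite Rint_zero.
  move: sab; rewrite negb_or -!ltNge => /andP[as_ sb].
  have sT : s \in `[0, T] by rewrite in_itv/= (ltW (lt_trans a0 as_)) (ltW (lt_trans sb bT)).
  have i1 : itg mu (fun x => P t x - P s x) by exact: sqi_itg (sqiB (sP tT) (sP sT)).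
  split; first exact: itgZ.
  rewrite /v (eq_Rint _ (g := fun x => rho s * `|P t x - P s x|)); last first.
    by move=> x; rewrite normrM ger0_norm.
  rewrite RintZ; last exact: itg_abs.
  by rewrite mulrC ler_wpM2r// Pr// abt// ltW.
have iv : itg2 mu (tau T) v.
  apply: itg2_tonelli => //; first by apply: aeW => s; exact: (vs s).1.
  apply: (itg_le _ (itgZ e ir)) => [|s].
    by apply: meas_Rint1; apply: measurableT_comp mv.
  by rewrite ger0_norm ?Rint_ge0//; exact: (vs s).2.
exists a, b, rho, F; split => //; split => //.
have iva : itg2 mu (tau T) (fun s x => `|v s x|) := integrable_norm iv.
apply: (@le_trans _ _ (\int[mu]_x \int[tau T]_s `|v s x|)).
  apply: ae_le_Rint; [exact: itg_abs (itg2_Rint2 iv)|exact: itg2_Rint2 iva|].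
  by apply: filterS (itg2_ae2 iv) => x; exact: abs_Rint.
rewrite (fubiniR iva) -[leRHS]mulr1 -r1 -RintZ//.
by apply: le_Rint; [exact: itg2_Rint1 iva|exact: itgZ|move=> s; exact: (vs s).2].
Qed.

(** P = u - prim g has weak derivative 0, so its averages against any two
    bumps agree. Bumps near t and near 0 give averages close to P t and P 0,
    hence P t = P 0. *)
Theorem du_bois_reymond t : t \in `[0, T] ->
  {ae mu, forall x, u t x = u 0 x + prim T (g ^~ x) t}.
Proof.
move=> tT; have zT : 0 \in `[0, T] by rewrite in_itv/= lexx ltW.
have TT : T \in `[0, T] by rewrite in_itv/= lexx ltW.
have iPP := sqi_itg (sqiB (sP tT) (sP zT)).
suff h : \int[mu]_x `|P t x - P 0 x| = 0.
  have := Rint_eq0_ae (itg_abs iPP) (fun x => normr_ge0 _) h.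
  apply: filterS => x /normr0_eq0; rewrite /P (prim0 T0 (h := g ^~ x) _ (lexx 0)); last exact: (meas2_2 x mg).
  lra.
apply/eqP; rewrite eq_le Rint_ge0// andbT; apply/ler_addgt0Pl => e e0; rewrite addr0.
have e2 : 0 < e / 2 by rewrite divr_gt0.
have [a1 [b1 [rho1 [F1 [[a10 ab1 b1T] [s1 d1 [z1 o1] i1 h1]]]]]] := mean_close tT e2.
have [a2 [b2 [rho2 [F2 [[a20 ab2 b2T] [s2 d2 [z2 o2] i2 h2]]]]]] := mean_close zT e2.
have [tf tD] := test_function_bumps a10 ab1 b1T a20 ab2 b2T s1 s2 d1 d2 z1 z2 o1 o2.
have c1 : continuous rho1 := @smooth_continuous R rho1 0 s1.
have c2 : continuous rho2 := @smooth_continuous R rho2 0 s2.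
have itgr (rho : R -> R) : continuous rho -> itg (tau T) rho.
  by move=> c; apply/itg_tau; [exact: continuous_measurable_fun|exact: cont_itv_itg].
have one (rho F : R -> R) (a b : R) : continuous rho -> (forall x : R, is_derive x 1 F (rho x)) -> 0 < a -> b < T ->
   (forall x, x <= a -> F x = 0) -> (forall x, b <= x -> F x = 1) -> \int[tau T]_s rho s = 1.
  move=> cr dF a0 bT F0 FF1; have mr : measurable_fun setT rho by exact: continuous_measurable_fun.
  by rewrite -(primT mr (lexx T)) (prim_antiderivative cr dF TT) FF1 ?(ltW bT)// F0 ?(ltW a0)// subr0.
have r1 := one _ _ _ _ c1 d1 a10 b1T z1 o1.
have r2 := one _ _ _ _ c2 d2 a20 b2T z2 o2.
apply: (@le_trans _ _ (\int[mu]_x (`|\int[tau T]_s (rho1 s * (P t x - P s x))| +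
    `|\int[tau T]_s (rho2 s * (P 0 x - P s x))|))); last first.
  rewrite RintD; [|exact: itg_abs (itg2_Rint2 i1)|exact: itg_abs (itg2_Rint2 i2)].
  by rewrite [leRHS](splitr e); exact: (lerD h1 h2).
apply: ae_le_Rint; first exact: itg_abs.
  by apply: itgD; [exact: itg_abs (itg2_Rint2 i1)|exact: itg_abs (itg2_Rint2 i2)].
apply: filterS3 ae_sq (wk tf) (filterI (itg2_ae2 i1) (itg2_ae2 i2)) => x sx wx [j1 j2].
have igx := sqi_itg sx.
have [k1 p1] := prim_by_parts T0 c1 d1 igx; have [k2 p2] := prim_by_parts T0 c2 d2 igx.
have l1 : itg (tau T) (fun s => rho1 s * P s x).
  apply: (itg_ext _ (itgB (itgZ (P t x) (itgr _ c1)) j1)) => s; ring.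
have l2 : itg (tau T) (fun s => rho2 s * P s x).
  apply: (itg_ext _ (itgB (itgZ (P 0 x) (itgr _ c2)) j2)) => s; ring.
have e1 : \int[tau T]_s (rho1 s * (P t x - P s x)) = P t x - \int[tau T]_s (rho1 s * P s x).
  rewrite (eq_Rint (tau T) (g := fun s => P t x * rho1 s - rho1 s * P s x)); last by move=> s; ring.
  by rewrite RintB//; [rewrite RintZ ?r1 ?mulr1//; exact: itgr|apply: itgZ; exact: itgr].
have e2' : \int[tau T]_s (rho2 s * (P 0 x - P s x)) = P 0 x - \int[tau T]_s (rho2 s * P s x).
  rewrite (eq_Rint (tau T) (g := fun s => P 0 x * rho2 s - rho2 s * P s x)); last by move=> s; ring.
  by rewrite RintB//; [rewrite RintZ ?r2 ?mulr1//; exact: itgr|apply: itgZ; exact: itgr].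
suff E : \int[tau T]_s (rho1 s * P s x) = \int[tau T]_s (rho2 s * P s x).
  rewrite e1 e2' E; set I := Rintegral _ _ _.
  have -> : P t x - P 0 x = (P t x - I) - (P 0 x - I) by ring.
  exact: ler_normB.
have m1 : itg (tau T) (fun s => rho1 s * u s x).
  by apply: (itg_ext _ (itgD l1 k1)) => s; rewrite /P; ring.
have m2 : itg (tau T) (fun s => rho2 s * u s x).
  by apply: (itg_ext _ (itgD l2 k2)) => s; rewrite /P; ring.
have E1 : \int[tau T]_s (rho1 s * P s x) = \int[tau T]_s (rho1 s * u s x) - \int[tau T]_s ((F1 T - F1 s) * g s x).
  by rewrite -p1 -RintB//; apply: eq_Rint => s; rewrite /P mulrBr.
have E2 : \int[tau T]_s (rho2 s * P s x) = \int[tau T]_s (rho2 s * u s x) - \int[tau T]_s ((F2 T - F2 s) * g s x).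
  by rewrite -p2 -RintB//; apply: eq_Rint => s; rewrite /P mulrBr.
have Fb (rho F : R -> R) : (forall x : R, is_derive x 1 F (rho x)) -> continuous rho -> itg (tau T) (fun s => (F T - F s) * g s x).
  move=> dF cr; have cF : continuous F := is_derive_continuous dF.
  have mF : measurable_fun setT F by exact: continuous_measurable_fun.
  have sF : sqi (tau T) (fun s => F T - F s).
    split; first exact: measurable_funB.
    apply/itg_tau; first by apply: measurable_funX; exact: measurable_funB.
    apply: cont_itv_itg => y; have h : (fun y => F T - F y) @ y --> F T - F y.
      by apply: cvgB; [exact: cvg_cst|exact: cF].
    exact: (cvgM h h).
  exact: sqi_mul sF sx.
have := wx; rewrite (eq_Rint (tau T) (g := fun s => rho1 s * u s x - rho2 s * u s x)); last first.
  by move=> s; rewrite tD mulrBl.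
rewrite RintB// (eq_Rint (tau T) (f := fun s => (F1 s - F2 s) * g s x) (g := fun s => (F2 T - F2 s) * g s x - (F1 T - F1 s) * g s x)); last first.
  by move=> s; rewrite (o1 _ (ltW b1T)) (o2 _ (ltW b2T)); ring.
rewrite RintB; [|exact: Fb d2 c2|exact: Fb d1 c1].
by rewrite E1 E2 opprB => /eqP; rewrite subr_eq => /eqP ->; ring.
Qed.

End du_bois_reymond.

(** * Integrability of the flux and uniqueness *)

Section flux_integrability.
Context d (X : measurableType d) (R : realType) (mu : {finite_measure set X -> \bar R}).
Variables (k : X -> X -> R) (M : R).
Hypothesis mk : measurable_fun setT (fun z : X * X => k z.1 z.2).
Hypothesis k_ge0 : forall x y, 0 <= k x y.
Hypothesis k_le : forall x y, k x y <= M.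
Hypothesis k_sym : forall x y, k x y = k y x.
Variables (Om : set X) (mOm : measurable Om).
Hypothesis M0 : 0 <= M.
Variable phi : R -> R.
Hypothesis phi_cont : continuous phi.
Hypothesis phi_nd : {homo phi : x y / x <= y}.
Hypothesis phi0 : phi 0 = 0.
Variable a0 : R.
Hypothesis a00 : 0 < a0.
Hypothesis deg : (forall x, Om x -> a0 <= degree mu k x) \/ (forall x y, k x y = 0).

Notation Dl := (Dop mu k).
Notation chi := (\1_Om : X -> R).

Lemma meas_phi_flux u : measurable_fun setT u -> measurable_fun setT (flux mu k phi u).
Proof.
move=> mu_; apply: (measurableT_comp (f := phi)); first exact: continuous_measurable_fun.
exact: meas_Dop1.
Qed.

(** There u vanishes, so Dop u = Kop u is bounded. *)
Lemma flux_off_domain u x : itg mu u -> (forall x, chi x * u x = u x) -> ~ Om x ->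
  `|flux mu k phi u x| <= `|phi (M * \int[mu]_y `|u y|)| + `|phi (- (M * \int[mu]_y `|u y|))|.
Proof.
move=> iu chu nx; set Z := M * _.
have h : `|Dl u x| <= Z.
  rewrite /Dop -(chu x) indicE memNset// mul0r mulr0 subr0.
  exact: (Kop_abs mk k_ge0 k_le).
move: h; rewrite ler_norml => /andP[h1 h2].
have := phi_nd h1; have := phi_nd h2; rewrite /flux.
have := ler_norm (phi Z); have := lerNnormlW (lexx `|phi (- Z)|).
have := normr_ge0 (phi Z); have := normr_ge0 (phi (- Z)).
by move: (phi Z) (phi (- Z)) (phi _) `|_| `|_| => *; rewrite ler_norml; apply/andP; split; lra.
Qed.

Let flux_zero u : (forall x y, k x y = 0) -> forall x, flux mu k phi u x = 0.
Proof.
move=> k0 x; rewrite /flux /Dop /Kop /degree.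
have -> : \int[mu]_y k x y = 0 by rewrite -[RHS](Rint_zero mu); apply: eq_Rint => y; rewrite k0.
rewrite mul0r subr0 -[RHS]phi0; congr phi.
by rewrite -[RHS](Rint_zero mu); apply: eq_Rint => y; rewrite k0 mul0r.
Qed.

(** On the set where the integral Fr of k |w| is at most n, Fr is integrable;
    integrating it in x first weights |w y| by the part of the degree of y
    that comes from this set. For large n this part is at least a0 / 2 on Om,
    uniformly in y, because k is bounded and the complement of the set has
    small measure. *)
Lemma flux_itg (w : X -> R) (B : R) : measurable_fun setT w ->
  (forall x, ~ Om x -> `|w x| <= B) ->
  (forall x, Om x -> a0 <= degree mu k x) ->
  {ae mu, forall x, itg mu (fun y => k x y * w y)} -> itg mu w.
Proof.
move=> mw wB dg kw.
have mka : measurable_fun setT (fun z : X * X => k z.1 z.2 * `|w z.2|).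
  by apply: measurable_funM => //; apply: measurableT_comp => //; exact: (measurableT_comp mw measurable_snd).
pose Fr x := \int[mu]_y (k x y * `|w y|).
have mFr : measurable_fun setT Fr by exact: (meas_param mu mka).
have Fr0 x : 0 <= Fr x by apply: Rint_ge0 => y; rewrite mulr_ge0.
pose c (n : nat) x : R := (Fr x <= n%:R)%R%:R.
have mc n : measurable_fun setT (c n).
  exact: (meas_le (f := Fr) (g := fun=> n%:R) mFr (measurable_cst _)).
have c_ge0 n x : 0 <= c n x by rewrite /c; case: (Fr x <= _).
have c_le1 n x : c n x <= 1 by rewrite /c; case: (Fr x <= _) => /=; rewrite ?lexx ?ler01.
have cb n x : `|1 - c n x| <= 1 by rewrite ger0_norm ?subr_ge0// gerBl.
have c_abs n x : `|c n x| <= 1 by rewrite ger0_norm.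
have c0 : (fun n => \int[mu]_x (1 - c n x)) @ \oo --> 0.
  apply: (@bounded_cvg0 _ _ _ mu (fun n x => 1 - c n x) 1).
  - by move=> n; exact: measurable_funB.
  - by move=> n x; exact: cb.
  - apply: aeW => x; apply/cvgr0Pnorm_le => e e0.
    have := nbhs_infty_ger (Fr x); apply: filterS => n hn.
    by rewrite /c hn subrr normr0 ltW.
have [n hn] : exists n, M * \int[mu]_x (1 - c n x) <= a0 / 2.
  have h : (fun n => M * \int[mu]_x (1 - c n x)) @ \oo --> 0 by rewrite -[0](mulr0 M); exact: cvgMr.
  have e2 : 0 < a0 / 2 by rewrite divr_gt0.
  move/cvgr0Pnorm_le : h => /(_ _ e2) [n _ /(_ n (leqnn n)) hn].
  by exists n; rewrite (le_trans _ hn)// ler_norm.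
pose v x y := c n x * (k x y * `|w y|).
have mv : meas2 v.
  apply: measurable_funM; first exact: (measurableT_comp (mc n) measurable_snd).
  apply: measurable_funM; first by apply: (meas_k mk); [exact: measurable_snd|exact: measurable_fst].
  by apply: measurableT_comp => //; exact: (measurableT_comp mw measurable_fst).
have kwa : {ae mu, forall x, itg mu (fun y => k x y * `|w y|)}.
  apply: filterS kw => x /itg_abs; apply: itg_ext => y.
  by rewrite normrM ger0_norm.
have iv : itg2 mu mu v.
  apply: itg2_tonelli => //; first by apply: filterS kwa => x h; exact: itgZ.
  apply: (itg_bnd mu (c := n%:R)).
    by apply: meas_Rint1; apply: measurableT_comp.
  move=> x; rewrite ger0_norm ?Rint_ge0//.
  rewrite (eq_Rint mu (g := v x)); last first.
    by move=> y; rewrite ger0_norm// /v !mulr_ge0.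
  rewrite /v /c; case: (leP (Fr x) n%:R) => h.
    by rewrite (eq_Rint mu (g := fun y => k x y * `|w y|)) // => y; rewrite mul1r.
  by rewrite (eq_Rint mu (g := fun=> 0)) ?Rint_zero // => y; rewrite mul0r.
have i1 : itg mu (fun y => \int[mu]_x v x y) := itg2_Rint2 iv.
have ick y : itg mu (fun x => c n x * k x y).
  apply: (itg_bnd mu (c := M)); first by apply: measurable_funM => //; apply: (meas_k mk).
  by move=> x; rewrite /c (le_trans (abs_bool_mul _ _))// (k_abs k_ge0 k_le).
have i1k y : itg mu (fun x => (1 - c n x) * k x y).
  by apply: itg_ext (itgB (k_itg mu mk k_ge0 k_le y) (ick y)) => x; rewrite k_sym; ring.
have low y : Om y -> a0 / 2 <= \int[mu]_x (c n x * k x y).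
  move=> Oy; have := dg y Oy.
  have -> : degree mu k y = \int[mu]_x (c n x * k x y) + \int[mu]_x ((1 - c n x) * k x y).
    by rewrite -RintD//; apply: eq_Rint => x; rewrite k_sym; ring.
  have : \int[mu]_x ((1 - c n x) * k x y) <= a0 / 2.
    apply: (le_trans _ hn); rewrite -RintZ; last first.
      by apply: itgB; [exact: itg_cst|exact: (itg_bnd mu (c := 1))].
    apply: le_Rint => //.
      by apply: itgZ; apply: itgB; [exact: itg_cst|exact: (itg_bnd mu (c := 1))].
    by move=> x; rewrite mulrC ler_wpM2r// subr_ge0.
  by move: (\int[mu]_x (c n x * k x y)) (\int[mu]_x ((1 - c n x) * k x y)) => A B1 *; lra.
have vE y : \int[mu]_x v x y = \int[mu]_x (c n x * k x y) * `|w y|.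
  rewrite mulrC -RintZ//; apply: eq_Rint => x; rewrite /v; ring.
apply: (itg_le mw (itgD (itg_cst mu `|B|) (itgZ (2 / a0) i1))) => y.
have [Oy|nOy] := pselect (Om y).
  apply: ler_wpDl => //; rewrite vE mulrA ler_peMl//.
  rewrite -[leLHS](_ : 2 / a0 * (a0 / 2) = 1); last by field; rewrite gt_eqF.
  by apply: ler_wpM2l; [rewrite divr_ge0// ltW|exact: low].
apply: ler_wpDr; last by rewrite (le_trans (wB y nOy))// ler_norm.
rewrite mulr_ge0 ?divr_ge0 ?(ltW a00)//; apply: Rint_ge0 => x.
by rewrite /v !mulr_ge0.
Qed.

(** On Om the equation reads degree * w = Kop w - Dop w with Dop w in L^2, and
    Kop w is bounded once w is integrable. *)
Theorem flux_sqi u : sqi mu u -> (forall x, chi x * u x = u x) ->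
  {ae mu, forall x, itg mu (fun y => k x y * flux mu k phi u y)} ->
  sqi mu (field mu k Om phi u) -> sqi mu (flux mu k phi u).
Proof.
move=> su chu kw sf; have iu := sqi_itg su.
have mw := meas_phi_flux su.1.
case: deg => [dg|k0]; last first.
  apply: (sqi_le mw (sqi_cst mu 0)) => x.
  by rewrite flux_zero.
set w := flux mu k phi u in kw mw *.
pose B := `|phi (M * \int[mu]_y `|u y|)| + `|phi (- (M * \int[mu]_y `|u y|))|.
have wB x : ~ Om x -> `|w x| <= B by exact: flux_off_domain.
have iw : itg mu w by exact: flux_itg wB dg kw.
pose C := M * \int[mu]_y `|w y|.
apply: (sqi_le mw (sqiD (sqi_cst mu (B + a0^-1 * C)) (sqiZ a0^-1 (sqi_abs sf)))) => x.
have B0 : 0 <= B by rewrite addr_ge0.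
have C0 : 0 <= C by rewrite mulr_ge0// Rint_ge0.
have a0V : 0 <= a0^-1 by rewrite invr_ge0 ltW.
rewrite [leRHS]ger0_norm; last by rewrite addr_ge0 ?(mulr_ge0 a0V)// addr_ge0// mulr_ge0.
have [Ox|nOx] := pselect (Om x); last first.
  rewrite -addrA; apply: ler_wpDr; last exact: wB.
  by rewrite addr_ge0// mulr_ge0.
rewrite -addrA; apply: ler_wpDl => //; rewrite -mulrDr mulrC ler_pdivlMr// mulrC.
have -> : field mu k Om phi u x = - Dl w x by rewrite /field indicE mem_set// mul1r.
apply: (@le_trans _ _ (`|degree mu k x * w x|)).
  by rewrite normrM ler_wpM2r// (le_trans (dg x Ox))// ler_norm.
have -> : degree mu k x * w x = Kop mu k w x - Dl w x by rewrite /Dop; ring.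
rewrite (le_trans (ler_normB _ _))// normrN lerD2r.
exact: (Kop_abs mk k_ge0 k_le).
Qed.

Section uniqueness.
Variable T : R.
Hypothesis T0 : 0 < T.
Notation TR := (measurableTypeR R).

(** The notion of solution on a finite measure space, for functions that
    vanish outside Om. The time derivative g is a parameter, so that it can be
    chosen by each construction. *)
Record weak_solution (u0 : X -> R) (u g : R -> X -> R) : Prop := WeakSolution {
  ws_meas : meas2 (u : TR -> X -> R);
  ws_chi : forall t x, chi x * u t x = u t x;
  ws_sqi : forall t, t \in `[0, T] -> sqi mu (u t);
  ws_cont : L2_continuous mu T u;
  ws_dmeas : meas2 (g : TR -> X -> R);
  ws_dsqr : itg2 mu (tau T) (fun t x => g t x ^+ 2);
  ws_weak : weakly_differentiable mu T u g;
  ws_flux : {ae tau T, forall t, {ae mu, forall x,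
     itg mu (fun y => k x y * flux mu k phi (u t) y)}};
  ws_eq : {ae tau T, forall t, {ae mu, forall x, g t x = field mu k Om phi (u t) x}};
  ws_init : {ae mu, forall x, u 0 x = u0 x} }.

Let ae_tauI (P : R -> Prop) : (forall t, t \in `[0, T] -> P t) -> {ae tau T, forall t, P t}.
Proof. by move=> h; apply/ae_tau; exact: aeW. Qed.

Lemma weak_power u0 u g t : weak_solution u0 u g -> t \in `[0, T] -> 
  {ae mu, forall x, itg mu (fun y => k x y * flux mu k phi (u t) y)} ->
  {ae mu, forall x, g t x = field mu k Om phi (u t) x} -> sqi mu (g t) ->
  sqi mu (flux mu k phi (u t)).
Proof.
move=> ws tT kw ge sg; apply: flux_sqi => //.
- exact: (ws_sqi ws tT).
- exact: (ws_chi ws t).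
- apply: sqi_ae_eq ge sg; apply: measurableT_comp => //; apply: measurable_funM.
    exact: meas_chi.
  by apply: meas_Dop1 => //; apply: meas_phi_flux; exact: (ws_sqi ws tT).1.
Qed.

Lemma flux_monotone (u1 u2 : X -> R) : sqi mu u1 -> sqi mu u2 ->
  (forall x, chi x * u1 x = u1 x) -> (forall x, chi x * u2 x = u2 x) ->
  sqi mu (flux mu k phi u1) -> sqi mu (flux mu k phi u2) ->
  \int[mu]_x ((field mu k Om phi u1 x - field mu k Om phi u2 x) * (u1 x - u2 x)) <= 0.
Proof.
move=> s1 s2 c1 c2 f1 f2.
set w1 := flux mu k phi u1 in f1 *; set w2 := flux mu k phi u2 in f2 *.
have sw := sqiB f1 f2; have su := sqiB s1 s2.
have sD := Dop_sqi mk k_ge0 k_le su.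
rewrite (eq_Rint mu (g := fun x => - (Dl (fun y => w1 y - w2 y) x * (u1 x - u2 x)))); last first.
  move=> x; rewrite (DopB mk k_ge0 k_le x (sqi_itg f1) (sqi_itg f2)) /field -/w1 -/w2.
  have e1 := c1 x; have e2 := c2 x.
  rewrite -[in RHS]e1 -[in RHS]e2; ring.
rewrite RintN; last by apply: sqi_mul => //; exact: Dop_sqi.
rewrite oppr_le0 (Dop_sym mk k_ge0 k_le k_sym sw su); apply: Rint_ge0 => x.
rewrite (DopB mk k_ge0 k_le x (sqi_itg s1) (sqi_itg s2)) /w1 /w2 /flux.
have [h|/ltW h] := leP (Dl u1 x) (Dl u2 x).
  by apply: mulr_le0; rewrite subr_le0// phi_nd.
by apply: mulr_ge0; rewrite subr_ge0// phi_nd.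
Qed.

(** Half the squared norm of the difference is the primitive in time of the
    pairing of the derivatives with the difference, by the fundamental lemma,
    and the pairing is nonpositive by symmetry and monotonicity. The
    integration by parts in space needs the fluxes in L^2, which follows from
    the equation itself. *)
Theorem weak_uniqueness u0 u1 g1 u2 g2 :
  weak_solution u0 u1 g1 -> weak_solution u0 u2 g2 ->
  forall t, t \in `[0, T] -> {ae mu, forall x, u1 t x = u2 t x}.
Proof.
move=> ws1 ws2.
have FF : Filter (nbhs (almost_everywhere (tau T))) by exact: ae_filter_ringOfSetsType.
pose h s x := g1 s x - g2 s x.
pose D t x := prim T (h ^~ x) t.
have mg1 := ws_dmeas ws1; have mg2 := ws_dmeas ws2.
have mh : meas2 (h : TR -> X -> R) by exact: measurable_funB.
have mD : meas2 (D : TR -> X -> R) by exact: meas_prim.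
have h2 : itg2 mu (tau T) (fun t x => h t x ^+ 2).
  exact: itg2_sqB (ws_dsqr ws1) (ws_dsqr ws2).
have ig1 := itg2_sq mg1 (ws_dsqr ws1).
have ig2 := itg2_sq mg2 (ws_dsqr ws2).
have ihx : {ae mu, forall x, sqi (tau T) (h ^~ x)}.
  by apply: filterS (itg2_ae2 h2) => x hx; split => //; exact: (meas2_2 x mh).
have DE t : t \in `[0, T] -> {ae mu, forall x, u1 t x - u2 t x = D t x}.
  move=> tT.
  have e1 := du_bois_reymond T0 (ws_meas ws1) (ws_sqi ws1) (ws_cont ws1) mg1 (ws_dsqr ws1) (ws_weak ws1) tT.
  have e2 := du_bois_reymond T0 (ws_meas ws2) (ws_sqi ws2) (ws_cont ws2) mg2 (ws_dsqr ws2) (ws_weak ws2) tT.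
  apply: filterS3 (filterI e1 e2) (filterI (ws_init ws1) (ws_init ws2)) (filterI (itg2_ae2 ig1) (itg2_ae2 ig2)).
  move=> x [a1 a2] [b1 b2] [j1 j2].
  by rewrite a1 a2 b1 b2 /D /h (primB t j1 j2); ring.
have sD t : t \in `[0, T] -> sqi mu (D t).
  move=> tT; apply: sqi_ae_eq (DE t tT) _; first exact: (meas2_1 t mD).
  by apply: sqiB; [exact: (ws_sqi ws1)|exact: (ws_sqi ws2)].
pose H := \int[mu]_x \int[tau T]_s h s x ^+ 2.
have iH : itg mu (fun x => \int[tau T]_s h s x ^+ 2) := itg2_Rint2 h2.
have D2 : itg2 mu (tau T) (fun t x => D t x ^+ 2).
  apply: itg2_tonelli.
  - exact: (measurable_funX 2 mD).
  - by apply: ae_tauI => t tT; exact: (sD t tT).2.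
  - apply: (itg_ae_le (g := fun=> T * H)).
    + by apply: meas_Rint1; apply: measurableT_comp => //; exact: (measurable_funX 2 mD).
    + exact: itg_cst.
    + apply: ae_tauI => t tT; rewrite ger0_norm ?Rint_ge0// -RintZ//.
      apply: ae_le_Rint; [exact: itg_abs (sD t tT).2|exact: itgZ|].
      by apply: filterS ihx => x hx; rewrite ger0_norm ?sqr_ge0//; exact: prim_sqr_le.
have ihD : itg2 mu (tau T) (fun s x => h s x * D s x) by exact: itg2_sq_mul.
have neg : {ae tau T, forall s, \int[mu]_x (h s x * D s x) <= 0}.
  have hin : {ae tau T, forall s, s \in `[0, T]} by exact: ae_tauI.
  apply: filterS3 (filterI (filterI (itg2_ae1 (ws_dsqr ws1)) (itg2_ae1 (ws_dsqr ws2))) hin)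
    (filterI (ws_flux ws1) (ws_flux ws2)) (filterI (ws_eq ws1) (ws_eq ws2)) => s [[i1 i2] sT] [k1 k2] [q1 q2].
  have sg1 : sqi mu (g1 s) by split => //; exact: (meas2_1 s mg1).
  have sg2 : sqi mu (g2 s) by split => //; exact: (meas2_1 s mg2).
  have w1 := weak_power ws1 sT k1 q1 sg1; have w2 := weak_power ws2 sT k2 q2 sg2.
  have su1 := ws_sqi ws1 sT; have su2 := ws_sqi ws2 sT.
  have mon := flux_monotone su1 su2 (ws_chi ws1 s) (ws_chi ws2 s) w1 w2.
  apply: le_trans mon; rewrite le_eqVlt; apply/orP; left; apply/eqP; apply: ae_eq_Rint.
  - by apply: measurable_funM; [exact: (meas2_1 s mh)|exact: (meas2_1 s mD)].
  - apply: measurable_funM; last by apply: measurable_funB; [exact: su1.1|exact: su2.1].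
    have mf u : measurable_fun setT u -> measurable_fun setT (field mu k Om phi u).
      move=> mu_; apply: measurableT_comp => //; apply: measurable_funM; first exact: meas_chi.
      by apply: meas_Dop1 => //; exact: meas_phi_flux.
    by apply: measurable_funB; apply: mf; [exact: su1.1|exact: su2.1].
  - by apply: filterS3 q1 q2 (DE s sT) => x <- <- <-.
move=> t tT.
suff : \int[mu]_x D t x ^+ 2 = 0.
  move=> /(Rint_eq0_ae (sD t tT).2 (fun x => sqr_ge0 _)).
  apply: filterS2 (DE t tT) => x e /eqP; rewrite sqrf_eq0 -e subr_eq0 => /eqP.
  exact.
apply/eqP; rewrite eq_le; apply/andP; split; last by apply: Rint_ge0 => x; exact: sqr_ge0.
apply: (@le_trans _ _ (\int[mu]_x (2 * prim T (fun s => h s x * D s x) t))).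
  apply: ae_le_Rint; [exact: (sD t tT).2|by apply: itgZ; exact: itg_prim2|].
  apply: filterS ihx => x hx; have := prim_sqr 0 t (sqi_itg hx).
  rewrite !add0r expr0n/= add0r -/(D t x) => ->.
  by rewrite le_eqVlt; apply/orP; left; apply/eqP; congr (_ * _); apply: eq_prim => s; rewrite add0r.
rewrite RintZ; last exact: itg_prim2.
rewrite prim_fubini// pmulr_rle0// /prim -(Rint_zero (tau T)).
apply: ae_le_Rint; [by apply: cut_itg; exact: itg2_Rint1 ihD|exact: itg0|].
by apply: filterS neg => s; case: (_ <= t); rewrite ?mul1r ?mul0r.
Qed.

End uniqueness.
End flux_integrability.

(** * From the integral equation to a weak solution *)

Section weak_existence.
Context d (X : measurableType d) (R : realType) (mu : {finite_measure set X -> \bar R}).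
Variables (k : X -> X -> R) (M : R).
Hypothesis mk : measurable_fun setT (fun z : X * X => k z.1 z.2).
Hypothesis k_ge0 : forall x y, 0 <= k x y.
Hypothesis k_le : forall x y, k x y <= M.
Hypothesis k_sym : forall x y, k x y = k y x.
Variables (Om : set X) (mOm : measurable Om) (T : R).
Hypothesis T0 : 0 < T.
Hypothesis M0 : 0 <= M.
Variable u0 : X -> R.
Hypothesis su0 : sqi mu u0.
Hypothesis u0_chi : forall x, (\1_Om x : R) * u0 x = u0 x.
Variable phi : R -> R.
Hypothesis phi_cont : continuous phi.
Hypothesis phi_nd : {homo phi : x y / x <= y}.
Hypothesis phi0 : phi 0 = 0.
Variable a0 : R.
Hypothesis a00 : 0 < a0.
Hypothesis deg : (forall x, Om x -> a0 <= degree mu k x) \/ (forall x y, k x y = 0).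
Hypothesis energy0 : itg mu (fun x => Dop mu k u0 x * phi (Dop mu k u0 x)).
Notation TR := (measurableTypeR R).
Notation chi := (\1_Om : X -> R).

Lemma Dop_itg2_sqr (w : R -> X -> R) : meas2 (w : TR -> X -> R) ->
  itg2 mu (tau T) (fun t x => w t x ^+ 2) ->
  itg2 mu (tau T) (fun t x => Dop mu k (w t) x ^+ 2).
Proof.
move=> mw w2; have mD : meas2 ((fun t => Dop mu k (w t)) : TR -> X -> R) by exact: meas_Dop.
have mw1 t : measurable_fun setT (w t) by exact: (meas2_1 t mw).
pose C := 2 * (M ^+ 2 * mass mu * mass mu + (M * mass mu) ^+ 2).
have key t : itg mu (fun x => w t x ^+ 2) ->
    itg mu (fun x => Dop mu k (w t) x ^+ 2) /\
    \int[mu]_x (Dop mu k (w t) x ^+ 2) <= C * \int[mu]_x w t x ^+ 2.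
  move=> i2; have sw : sqi mu (w t) by split.
  have sD := Dop_sqi mk k_ge0 k_le sw.
  split; first exact: sD.2.
  set I := \int[mu]_x `|w t x|.
  apply: (@le_trans _ _ (\int[mu]_x (2 * ((M * I) ^+ 2 + (M * mass mu) ^+ 2 * w t x ^+ 2)))).
    apply: le_Rint; first exact: sD.2.
      by apply: itgZ; apply: itgD; [exact: itg_cst|exact: itgZ].
    move=> x; have h := Dop_abs mk k_ge0 k_le x (sqi_itg sw).
    rewrite -/I in h; rewrite -(real_normK (num_real (Dop mu k (w t) x))).
    rewrite -(real_normK (num_real (w t x))) -exprMn.
    have h0 := normr_ge0 (Dop mu k (w t) x).
    move: (`|Dop mu k (w t) x|) (M * I) (M * mass mu * `|w t x|) h h0 => A B1 B2 h h0.
    have : A ^+ 2 <= (B1 + B2) ^+ 2 by rewrite ler_sqr ?nnegrE// (le_trans h0).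
    by have := sqr_ge0 (B1 - B2); nra.
  rewrite RintZ; last by apply: itgD; [exact: itg_cst|exact: itgZ].
  rewrite RintD; [|exact: itg_cst|exact: itgZ].
  rewrite Rint_cst RintZ// /C -mulrA ler_pM2l// mulrDl lerD2r exprMn.
  rewrite -!(mulrA (M ^+ 2)); apply: ler_wpM2l; first exact: sqr_ge0.
  by rewrite mulrC -mulrA; apply: ler_wpM2l; [exact: mass_ge0|exact: sqr_Rint_abs_le].
apply: itg2_tonelli.
- exact: (measurable_funX 2 mD).
- by apply: filterS (itg2_ae1 w2) => t /key[].
- apply: (itg_ae_le _ (itgZ C (itg2_Rint1 w2))).
    by apply: meas_Rint1; apply: measurableT_comp => //; exact: (measurable_funX 2 mD).
  apply: filterS (itg2_ae1 w2) => t /key[_ h].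
  rewrite ger0_norm ?Rint_ge0// (le_trans _ h)// le_eqVlt; apply/orP; left; apply/eqP.
  by apply: eq_Rint => x; rewrite ger0_norm ?sqr_ge0.
Qed.

(** The integral equation gives the weak formulation by Fubini, once its null
    sets, one for each time, are gathered into one null set of the product. *)
Theorem weak_existence : exists u g, weak_solution mu k Om phi T u0 u g.
Proof.
have [u [[mu2 chu] su cu w2 ue]] :=
  core_existence mk k_ge0 k_le k_sym mOm T0 M0 su0 u0_chi phi_cont phi_nd phi0 a00 deg energy0.
pose w t := flux mu k phi (u t).
pose g t := field mu k Om phi (u t).
have mw : meas2 (w : TR -> X -> R).
  apply: (measurableT_comp (f := phi)); first exact: continuous_measurable_fun.
  exact: meas_Dop.
have mDw : meas2 ((fun t => Dop mu k (w t)) : TR -> X -> R) by exact: meas_Dop.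
have mg : meas2 (g : TR -> X -> R).
  by apply: measurableT_comp => //; apply: measurable_funM => //; exact: meas_chi.
have g2 : itg2 mu (tau T) (fun t x => g t x ^+ 2).
  apply: itg2_le (Dop_itg2_sqr mw w2) _; first exact: (measurable_funX 2 mg).
  move=> t x; rewrite /g /field sqrrN ger0_norm ?sqr_ge0// -/(w t).
  rewrite -(real_normK (num_real (chi x * _))) -(real_normK (num_real (Dop mu k (w t) x))).
  by rewrite ler_sqr ?nnegrE//; exact: chi_abs.
have ig := itg2_sq mg g2.
have FF : Filter (nbhs (almost_everywhere (tau T))) by exact: ae_filter_ringOfSetsType.
have mprim : meas2 ((fun t x => prim T (g ^~ x) t) : TR -> X -> R) by exact: meas_prim.
pose r t x := u t x - (u0 x + prim T (g ^~ x) t).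
have mr : meas2 (r : TR -> X -> R).
  apply: measurable_funB => //; apply: measurable_funD => //.
  exact: (measurableT_comp su0.1 measurable_fst).
have r0 : {ae (mu \x tau T)%E, forall z, r z.2 z.1 = 0}.
  apply: ae_prod_swap => //; apply: aeW => t; apply: filterS (ue t) => x e.
  by rewrite /r /g e subrr.
have [rx _] := ae_prod_12 mr r0.
exists u, g; split => //.
- by move=> t _ e e0; have /nbhs_ballP[r1 r10 h] := cu t e e0; exists r1 => // s _ st;
    apply: h; rewrite /ball/= distrC.
- move=> f [sf csupp fsupp].
  have df (x : R) : is_derive x 1 f (derive1 f x).
    by rewrite derive1E; apply: derivableP; exact: (sf 0%N).
  have cf : continuous (derive1 f) := @smooth_continuous R f 1 sf.
  have fout t : ~~ (0 < t < T) -> f t = 0.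
    move=> nt; apply: contrapT => /eqP ft; move/negP : nt; apply.
    have : supp f t by apply: subset_closure.
    by move/fsupp; rewrite /= in_itv.
  have fT : f T = 0 by apply: fout; rewrite ltxx andbF.
  have f00 : f 0 = 0 by apply: fout; rewrite ltxx.
  apply: filterS3 rx (itg2_ae2 ig) (itg2_ae2 g2) => x hx ix ix2.
  have [k1 p1] := prim_by_parts T0 cf df ix.
  have mf : measurable_fun setT (derive1 f) by exact: continuous_measurable_fun.
  have iff : itg (tau T) (derive1 f) by apply/(itg_tau T mf); exact: cont_itv_itg.
  transitivity (\int[tau T]_s (u0 x * derive1 f s + derive1 f s * prim T (g ^~ x) s)).
    apply: ae_eq_Rint.
    + by apply: measurable_funM => //; exact: (meas2_2 x mu2).
    + by apply: measurable_funD; [exact: itg_meas (itgZ (u0 x) iff)|exact: itg_meas k1].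
    + apply: filterS hx => s; rewrite /r => /eqP; rewrite subr_eq0 => /eqP ->.
      by rewrite mulrDr mulrC.
  rewrite RintD//; last exact: itgZ.
  rewrite RintZ// p1 -(primT mf (lexx T)) (prim_antiderivative cf df); last first.
    by rewrite in_itv/= lexx ltW.
  rewrite fT f00 subrr mulr0 add0r -RintN.
    by apply: eq_Rint => s; rewrite sub0r mulNr.
  have cff : continuous f := @smooth_continuous R f 0 sf.
  have mff : measurable_fun setT f by exact: continuous_measurable_fun.
  apply: sqi_mul; split => //; last exact: (meas2_2 x mg).
  apply/itg_tau; first exact: measurable_funX.
  by apply: cont_itv_itg => y; exact: (cvgM (@cff y) (@cff y)).
- have := itg2_ae1 w2; apply: filterS => t it2; apply: aeW => x.
  apply: (kf_itg mk k_ge0 k_le); apply: sqi_itg; split => //.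
  exact: (meas2_1 t mw).
- by apply: aeW => t; exact: aeW.
- apply: filterS (ue 0) => x ->; rewrite prim0 ?addr0//.
  exact: (meas2_2 x mg).
Qed.

End weak_existence.

(** * Measure and connectedness in Euclidean space *)

Section real_valued_continuity.
Context (R : realType) (S : topologicalType).
Implicit Types f g : S -> R.

Lemma continuous_add f g : continuous f -> continuous g -> continuous (fun x => f x + g x).
Proof. by move=> cf cg x; apply: cvgD; [exact: cf|exact: cg]. Qed.

Lemma continuous_mul f g : continuous f -> continuous g -> continuous (fun x => f x * g x).
Proof. by move=> cf cg x; apply: cvgM; [exact: cf|exact: cg]. Qed.

Lemma continuous_gt_near f x a : continuous f -> a < f x -> nbhs x [set y | a < f y].
Proof. by move=> cf ax; apply: (cf x [set y | a < y]); exact: lt_nbhsr. Qed.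

Lemma continuous_lt_near f x a : continuous f -> f x < a -> nbhs x [set y | f y < a].
Proof. by move=> cf ax; apply: (cf x [set y | y < a]); exact: lt_nbhsl. Qed.

End real_valued_continuity.

Lemma affine_continuous (R : realType) (W : normedModType R) (z x : W) (c : R) :
  continuous (fun y : W => z + c *: (x - y)).
Proof.
move=> y; apply: cvgD; first exact: cvg_cst.
by apply: cvgZr; apply: cvgB; [exact: cvg_cst|exact: cvg_id].
Qed.

Section euclidean_space.
Context (R : realType) (n : nat).
Notation V := 'rV[R]_n.
Implicit Types (A : set V) (x y : V).

Lemma nbhs_rV x A : nbhs x A <-> exists2 e, 0 < e & forall y, (forall i, `|x ord0 i - y ord0 i| < e) -> A y.
Proof.
split.
  move=> /nbhs_ballP[e e0 h]; exists e => // y hy; apply: h; split => // i j.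
  by rewrite ord1; exact: hy.
move=> [e e0 h]; apply/nbhs_ballP; exists e => // y [_ hy]; apply: h => i.
exact: hy.
Qed.

Lemma measurable_coord_itv (I : 'I_n -> interval R) :
  measurable [set x : V | forall i, x ord0 i \in I i].
Proof.
rewrite (_ : [set _ | _] = \bigcap_(i in [set: 'I_n])
    ((fun x : V => x ord0 i) @^-1` [set` I i])); last first.
  by apply/seteqP; split => x /= h i; have := h i => //; apply.
apply: fin_bigcap_measurable => // i _.
rewrite -[X in measurable X]setTI; apply: measurable_rV_coord => //.
Qed.

(** The measurable sets are generated by the coordinates; an open set is a
    countable union of boxes with rational corners. *)
Lemma open_measurable_rV A : open A -> measurable A.
Proof.
move=> oA.
pose box (ab : 'rV[rat]_n * 'rV[rat]_n) : set V :=
  [set x | forall i, x ord0 i \in `]ratr (ab.1 ord0 i), ratr (ab.2 ord0 i)[].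
rewrite (_ : A = \bigcup_(ab in [set ab | box ab `<=` A]) box ab); last first.
  apply/seteqP; split => [x Ax|x [ab /= sA]]; last exact: sA.
  have /nbhs_rV[e e0 h] : nbhs x A by apply: open_nbhs_nbhs.
  have /fin_all_exists[a ha] : forall i : 'I_n, exists q : rat, ratr q \in `](x ord0 i - e), (x ord0 i)[.
    by move=> i; apply: rat_in_itvoo; rewrite gtrBl.
  have /fin_all_exists[b hb] : forall i : 'I_n, exists q : rat, ratr q \in `](x ord0 i), (x ord0 i + e)[.
    by move=> i; apply: rat_in_itvoo; rewrite ltrDl.
  exists (\row_i a i, \row_i b i) => /=.
    move=> y /= hy; apply: h => i; have := hy i; rewrite !mxE /= in_itv/=.
    have := ha i; have := hb i; rewrite !in_itv/= => /andP[_ h1] /andP[h2 _] /andP[h3 h4].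
    rewrite distrC ltr_norml; apply/andP; split.
      by rewrite ltrBrDl (lt_trans h2).
    by rewrite ltrBlDl (lt_trans h4).
  move=> i; rewrite !mxE in_itv/=; have := ha i; have := hb i.
  by rewrite !in_itv/= => /andP[-> _] /andP[_ ->].
rewrite bigcup_mkcond; apply: countable_bigcupT_measurable => [|ab].
  exact: countableP.
by case: ifP => _; [exact: measurable_coord_itv|exact: measurable0].
Qed.

Lemma continuous_measurable_rV (f : V -> R) : continuous f -> measurable_fun setT f.
Proof.
move=> cf; apply: (measurability _ (RGenOInfty.measurableE R)) => _ [_ [a ->] <-].
rewrite setTI; apply: open_measurable_rV.
have /continuousP := cf; apply; exact: interval_open.
Qed.

Lemma measurable_sub_rV : measurable_fun setT (fun z : V * V => z.1 - z.2).
Proof.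
apply: measurable_fun_rVP => i; under eq_fun do rewrite !mxE.
apply: measurable_funB.
  exact: (measurableT_comp (measurable_rV_coord i) measurable_fst).
exact: (measurableT_comp (measurable_rV_coord i) measurable_snd).
Qed.

Lemma bounded_lebesgue_fin A : measurable A -> bounded_set A -> (lebesgue_rV n A < +oo)%E.
Proof.
move=> mA [M [_ hM]]; pose B := `|M| + 1.
have B0 : 0 <= B by rewrite addr_ge0.
have hB : M < B by rewrite (le_lt_trans (ler_norm M))// ltrDl.
pose a : V := \row_i (- (B + 1)); pose b : V := \row_i B.
have ab i : a ord0 i <= b ord0 i by rewrite !mxE; lra.
have sub : A `<=` [set x | forall i, x ord0 i \in `]a ord0 i, b ord0 i]].
  move=> x Ax i; rewrite !mxE in_itv/=.
  have : `|x ord0 i| <= B.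
    apply: le_trans (hM _ hB _ Ax).
    rewrite [leRHS]/Num.norm/= mx_normrE; apply/bigmax_geP; right.
    by exists (ord0, i).
  by rewrite ler_norml => /andP[h1 ->]; rewrite andbT (lt_le_trans _ h1)// ltrN2 ltrDl.
apply: (@le_lt_trans _ _ (lebesgue_rV n [set x | forall i, x ord0 i \in `]a ord0 i, b ord0 i]])).
  by apply: le_measure => //; rewrite inE//; exact: measurable_coord_itv.
by rewrite lebesgue_rV_box// ltry.
Qed.

Lemma euclidean_norm_continuous : continuous (@euclidean_norm R n).
Proof.
have csum (s : seq 'I_n) : continuous (fun x : V => \sum_(i <- s) x ord0 i ^+ 2).
  elim: s => [|i s ih].
    rewrite (_ : (fun x => _) = cst 0); first exact: cst_continuous.
    by apply/funext => x; rewrite big_nil.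
  rewrite (_ : (fun x => _) = (fun x : V => x ord0 i * x ord0 i + \sum_(j <- s) x ord0 j ^+ 2)).
    by apply: continuous_add ih; apply: continuous_mul; exact: coord_continuous.
  by apply/funext => x; rewrite big_cons expr2.
move=> x; apply: (@continuous_comp _ _ _ (fun x : V => \sum_i x ord0 i ^+ 2) Num.sqrt).
  exact: csum.
exact: sqrt_continuous.
Qed.

Lemma euclidean_normN x : euclidean_norm (- x) = euclidean_norm x.
Proof. by rewrite /euclidean_norm; congr Num.sqrt; apply: eq_bigr => i _; rewrite mxE sqrrN. Qed.

Lemma euclidean_normZ (c : R) x : euclidean_norm (c *: x) = `|c| * euclidean_norm x.
Proof.
rewrite /euclidean_norm -sqrtr_sqr -sqrtrM ?sqr_ge0// mulr_sumr; congr Num.sqrt.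
by apply: eq_bigr => i _; rewrite mxE exprMn.
Qed.

Lemma euclidean_norm_ge0 x : 0 <= euclidean_norm x.
Proof. exact: sqrtr_ge0. Qed.

Lemma euclidean_norm_eq0 x : euclidean_norm x = 0 -> x = 0.
Proof.
move=> /eqP; rewrite sqrtr_eq0 => h; apply/rowP => i; rewrite mxE.
have s0 : 0 <= \sum_i x ord0 i ^+ 2 by apply: sumr_ge0 => j _; exact: sqr_ge0.
have /eqP : \sum_i x ord0 i ^+ 2 = 0 by apply/eqP; rewrite eq_le h.
rewrite psumr_eq0 => [/allP/(_ i)|j _]; last exact: sqr_ge0.
by rewrite mem_index_enum => /(_ isT); rewrite sqrf_eq0 => /eqP.
Qed.

End euclidean_space.

Section kernel_of_J.
Context (R : realType) (n : nat).
Notation V := 'rV[R]_n.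
Variable J : V -> R.
Hypothesis J_ge0 : forall x, 0 <= J x.
Hypothesis J_cont : continuous J.
Hypothesis J_radial : radial J.
Hypothesis J_supp : compact (supp J).

Definition conv_kernel (x y : V) : R := J (x - y).

Lemma conv_kernel_meas : measurable_fun setT (fun z : V * V => conv_kernel z.1 z.2).
Proof. by apply: measurableT_comp; [exact: continuous_measurable_rV|exact: measurable_sub_rV]. Qed.

Lemma conv_kernel_sym x y : conv_kernel x y = conv_kernel y x.
Proof.
have [j Jj] := J_radial.
by rewrite /conv_kernel !Jj -[y - x]opprB euclidean_normN.
Qed.

Lemma conv_kernel_bounded : exists2 M : R, 0 <= M & forall x y, conv_kernel x y <= M.
Proof.
have cJ : compact (J @` supp J).
  by apply: continuous_compact => //; exact: continuous_subspaceT.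
have [B [_ hB]] := compact_bounded cJ.
exists (`|B| + 1); first by rewrite addr_ge0.
move=> x y; rewrite /conv_kernel; set z := x - y.
have [->|Jz] := eqVneq (J z) 0; first by rewrite addr_ge0.
apply: (le_trans (ler_norm _)); apply: (hB (`|B| + 1)).
  by rewrite (le_lt_trans (ler_norm B))// ltrDl.
by exists z => //; exact: subset_closure.
Qed.

Variables Omega E : set V.
Hypothesis Omega_bdd : bounded_set Omega.
Hypothesis Omega_sub : Omega `<=` E.
Hypothesis E_open : open E.
Hypothesis E_conn : connected E.
Hypothesis Omega_supp_sub : [set x + 2 *: z | x in Omega & z in supp J] `<=` E.

(** The distance to xb is continuous on the connected set E. It takes values
    below r = |z0|, because points of Omega come close to xb, and the value 2
    r at xb + 2 z0, which lies in E: for x in Omega near xb it is x + 2 z with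
    z near z0, where J is still positive. *)
Lemma sphere_meets xb z0 : closure Omega xb -> 0 < J z0 -> z0 != 0 ->
  exists2 y, E y & euclidean_norm (xb - y) = euclidean_norm z0.
Proof.
move=> cxb Jz0 z00; set r := euclidean_norm z0.
have r0 : 0 < r.
  rewrite lt_neqAle euclidean_norm_ge0 andbT eq_sym; apply: contra_neq z00.
  exact: euclidean_norm_eq0.
pose f y := euclidean_norm (xb - y).
have cf : continuous f.
  move=> y; apply: (@continuous_comp _ _ _ (fun y : V => xb - y) (@euclidean_norm R n)).
    rewrite (_ : (fun y => _) = (fun y : V => 0 + 1 *: (xb - y))); first exact: affine_continuous.
    by apply/funext => z; rewrite add0r scale1r.
  exact: euclidean_norm_continuous.
have [y1 [Oy1 fy1]] : exists y, Omega y /\ f y < r.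
  have : nbhs xb [set y | f y < r].
    apply: (continuous_lt_near cf).
    by rewrite /f subrr -(scale0r z0) euclidean_normZ normr0 mul0r.
  by move=> /cxb[y [Oy /= fy]]; exists y.
have Ey2 : E (xb + 2 *: z0).
  have : nbhs xb [set x | 0 < J (z0 + 2^-1 *: (xb - x))].
    apply: (@continuous_gt_near R V (fun x => J (z0 + 2^-1 *: (xb - x))) xb 0).
      move=> x; apply: (@continuous_comp _ _ _ (fun x : V => z0 + 2^-1 *: (xb - x)) J); last exact: J_cont.
      exact: affine_continuous.
    by rewrite subrr scaler0 addr0.
  move=> /cxb[x [Ox /= Jx]].
  apply: Omega_supp_sub; exists x => //; exists (z0 + 2^-1 *: (xb - x)).
    by apply: subset_closure; rewrite /= gt_eqF.
  by rewrite scalerDr scalerA divff// scale1r addrCA subrKC addrC.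
have fy2 : f (xb + 2 *: z0) = 2 * r.
  by rewrite /f opprD addrA subrr add0r euclidean_normN euclidean_normZ ger0_norm.
have /connected_intervalP iv : connected (f @` E).
  apply: connected_continuous_connected => //; exact: continuous_subspaceT.
have : (f @` E) r.
  apply: (iv (f y1) (f (xb + 2 *: z0))).
  - by exists y1 => //; exact: Omega_sub.
  - by exists (xb + 2 *: z0).
  - by rewrite (ltW fy1) fy2; lra.
by move=> [y Ey <-]; exists y.
Qed.

Variable mu : {finite_measure set V -> \bar R}.
Hypothesis muE : forall A, measurable A -> A `<=` E -> mu A = lebesgue_rV n A.

(** Some y in E has |xb - y| = |z0|, so J (xb - y) = J z0 > 0 because J is
    radial; by continuity J (x - z) > J z0 / 2 for x near xb and z in a box
    around y inside E. *)
Lemma degree_locally_positive xb z0 : closure Omega xb -> 0 < J z0 -> z0 != 0 ->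
  exists2 a, 0 < a & \forall x \near xb, a <= degree mu conv_kernel x.
Proof.
move=> cxb Jz0 z00; have [y Ey fy] := sphere_meets cxb Jz0 z00.
have [j Jj] := J_radial.
have Jxy : J (xb - y) = J z0 by rewrite !Jj fy.
have [d1 d10 h1] : exists2 e, 0 < e & forall z : V, (forall i, `|y ord0 i - z ord0 i| < e) -> E z.
  by apply/nbhs_rV; exact: open_nbhs_nbhs.
have [d2 d20 h2] : exists2 e, 0 < e & forall z : V, (forall i, `|(xb - y) ord0 i - z ord0 i| < e) -> J z0 / 2 < J z.
  apply/nbhs_rV; have h : J z0 / 2 < J (xb - y) by rewrite Jxy ltr_pdivrMr// ltr_pMr// ltr1n.
  exact: (continuous_gt_near J_cont h).
(* x and z move by less than e each, so x - z moves by less than d2. *)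
pose e := Num.min d1 d2 / 2.
have e0 : 0 < e by rewrite divr_gt0// lt_min d10.
have ed1 : 2 * e <= d1 by rewrite /e mulrC divfK// ge_min lexx.
have ed2 : 2 * e <= d2 by rewrite /e mulrC divfK// ge_min lexx orbT.
clearbody e.
pose a : V := \row_i (y ord0 i - e / 2); pose b : V := \row_i (y ord0 i + e / 2).
pose B := [set z : V | forall i, z ord0 i \in `]a ord0 i, b ord0 i]].
have mB : measurable B by exact: measurable_coord_itv.
have By z : B z -> forall i, `|y ord0 i - z ord0 i| < e.
  move=> hz i; have := hz i; rewrite !mxE in_itv/= => /andP[z1 z2].
  by rewrite ltr_norml; apply/andP; split; lra.
have BE : B `<=` E by move=> z /By hz; apply: h1 => i; rewrite (lt_le_trans (hz i))//; lra.
have muB : mu B = (e ^+ n)%:E.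
  rewrite muE// lebesgue_rV_box; last by move=> i; rewrite !mxE; lra.
  rewrite (eq_bigr (fun=> e)); first by rewrite prodr_const card_ord.
  by move=> i _; rewrite !mxE; lra.
have [M M0 kM] := conv_kernel_bounded.
exists (J z0 / 2 * e ^+ n); first by rewrite mulr_gt0 ?divr_gt0// exprn_gt0.
apply/nbhs_rV; exists e => // x hx.
have -> : J z0 / 2 * e ^+ n = \int[mu]_z (J z0 / 2 * \1_B z).
  rewrite RintZ; last by apply: (itg_bnd mu (c := 1)) => [|z]; [exact: measurable_indic|rewrite indicE; case: (_ \in _); rewrite ?normr1 ?normr0].
  by rewrite /Rintegral integral_indic// setIT; congr (_ * _); exact/esym/(congr1 fine muB).
apply: le_Rint.
- by apply: itgZ; apply: (itg_bnd mu (c := 1)) => [|z]; [exact: measurable_indic|rewrite indicE; case: (_ \in _); rewrite ?normr1 ?normr0].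
- by apply: (k_itg mu conv_kernel_meas _ kM) => u v; exact: J_ge0.
- move=> z; rewrite indicE; case: (boolP (z \in B)) => [/set_mem Bz|_]; last by rewrite mulr0 J_ge0.
  rewrite mulr1; apply/ltW; apply: h2 => i; rewrite !mxE.
  have := By z Bz i; have := hx i; rewrite !ltr_norml => /andP[a1 a2] /andP[a3 a4].
  by apply/andP; split; lra.
Qed.

(** The closure of Omega is compact, so the local bounds give a global one. If
    J vanishes away from 0 it vanishes everywhere by continuity. *)
Lemma degree_lower_bound : (0 < n)%N -> exists2 a0, 0 < a0 &
  (forall x, Omega x -> a0 <= degree mu conv_kernel x) \/ (forall x y, conv_kernel x y = 0).
Proof.
move=> n0; have [[z0 [z00 Jz0]]|nJ0] := pselect (exists z0 : V, z0 != 0 /\ 0 < J z0); last first.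
  have J1 x : x != 0 -> J x = 0.
    move=> x0; apply/eqP; rewrite eq_le J_ge0 andbT leNgt; apply/negP => Jx.
    by apply: nJ0; exists x.
  exists 1 => //; right => x y; rewrite /conv_kernel; move: (x - y) => {x y} z.
  have [->|] := eqVneq z 0; last exact: J1.
  apply/eqP; rewrite eq_le J_ge0 andbT leNgt; apply/negP => Jz.
  have /nbhs_rV[e e0 h] := continuous_gt_near J_cont Jz.
  pose v : V := const_mx (e / 2).
  have v0 : v != 0.
    apply/eqP => /rowP/(_ (Ordinal n0)); rewrite !mxE; lra.
  have /= : [set y | 0 < J y] v.
    by apply: h => i; rewrite !mxE sub0r normrN gtr0_norm; lra.
  by rewrite (J1 _ v0) ltxx.
have cO : compact (closure Omega).
  have [B [Br hB]] := Omega_bdd.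
  apply: bounded_closed_compact; last exact: closed_closure.
  exists B; split => // c Bc.
  have cl : closed [set x : V | `|x| <= c].
    apply: (@closed_comp _ _ (fun x : V => `|x|) [set y | y <= c]) => [x _|]; last exact: closed_le.
    exact: norm_continuous.
  move: cl => /closure_id cl x Ox; rewrite cl; exact: (closureS (hB _ Bc)) Ox.
have h : \forall a \near (0 : R)^'+, closure Omega `<=` (fun x => a <= degree mu conv_kernel x).
  apply: ((compact_near_coveringP (closure Omega)).1 cO R) => x cx.
  have [a a00 ha] := degree_locally_positive cx Jz0 z00.
  exists ([set x' | a <= degree mu conv_kernel x'], [set i | i <= a]).
    by split => //=; exact: nbhs_right_le.
  by move=> [x' i] [/= h1 h2]; exact: le_trans h2 h1.
have [a [ha a00]] := filter_ex (filterI h (nbhs_right_gt 0)).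
by exists a => //; left => x Ox; apply: ha; exact: subset_closure.
Qed.

End kernel_of_J.

(** * The power nonlinearity *)

Section p_power_theory.
Context (R : realType) (p : R).
Hypothesis p_gt1 : 1 < p.
Let p10 : 0 < p - 1. Proof. by rewrite subr_gt0. Qed.

Lemma p_power0 : p_power p 0 = 0.
Proof. by rewrite /p_power mulr0. Qed.

Lemma p_power_ge0 s : 0 <= s -> p_power p s = s `^ (p - 1).
Proof.
rewrite le_eqVlt => /predU1P[<-|s0].
  by rewrite p_power0 powR0// gt_eqF.
rewrite /p_power gtr0_norm// -[in X in _ * X](powRr1 (ltW s0)) -powRD.
  by congr (_ `^ _); ring.
by rewrite (gt_eqF s0) implybT.
Qed.

Lemma p_powerN s : p_power p (- s) = - p_power p s.
Proof. by rewrite /p_power normrN mulrN. Qed.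

Lemma p_power_nd : {homo p_power p : x y / x <= y}.
Proof.
have pos x y : 0 <= x -> x <= y -> p_power p x <= p_power p y.
  move=> x0 xy; rewrite !p_power_ge0 ?(le_trans x0 xy)//.
  by apply: ge0_ler_powR => //; rewrite ?nnegrE ?(le_trans x0 xy)// ltW.
have p0 x : 0 <= x -> 0 <= p_power p x by move=> x0; rewrite -p_power0; exact: pos.
move=> x y xy; have [x0|/ltW x0] := leP 0 x; first exact: pos.
have [y0|/ltW y0] := leP 0 y.
  apply: (@le_trans _ _ 0); last exact: p0.
  by rewrite -oppr_ge0 -p_powerN p0// oppr_ge0.
by rewrite -[leLHS]opprK -[leRHS]opprK lerN2 -!p_powerN pos ?oppr_ge0// lerN2.
Qed.

Lemma p_power_norm s : `|p_power p s| = `|s| `^ (p - 1).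
Proof.
rewrite -p_power_ge0// /p_power normr_id normrM; congr (_ * _).
by rewrite ger0_norm// powR_ge0.
Qed.

Lemma p_power_energy s : s * p_power p s = `|s| `^ p.
Proof.
have h x : 0 <= x -> x * p_power p x = x `^ p.
  by move=> x0; rewrite p_power_ge0// mulr_powRB1// (lt_trans _ p_gt1).
have [s0|/ltW s0] := leP 0 s; first by rewrite ger0_norm// h.
by rewrite ler0_norm// -h ?oppr_ge0// p_powerN mulrNN.
Qed.

Lemma p_power_continuous : continuous (p_power p).
Proof.
move=> x; have [->|x0] := eqVneq x 0.
  rewrite /continuous_at p_power0; apply/cvgr0Pnorm_le => e e0.
  have d0 : 0 < e `^ (p - 1)^-1 by exact: powR_gt0.
  have pn : p - 1 != 0 by rewrite gt_eqF.
  have eE : e = (e `^ (p - 1)^-1) `^ (p - 1) by rewrite -powRrM mulVf// powRr1// ltW.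
  have : \forall y \near (0 : R), `|y| <= e `^ (p - 1)^-1.
    have c0 : (id : R -> R) @ (0 : R) --> (0 : R) by exact: cvg_id.
    by have /cvgr0Pnorm_le := c0; exact.
  apply: filterS => y hy; rewrite p_power_norm [leRHS]eE.
  by apply: ge0_ler_powR; rewrite ?nnegrE ?powR_ge0 ?(ltW p10).
have cn : (fun y : R => `|y|) @ x --> `|x| by exact: norm_continuous.
have cp : {for `|x|, continuous (fun a : R => a `^ (p - 2))}.
  apply: differentiable_continuous; apply/derivable1_diffP.
  by apply: derivable_powR; rewrite in_itv/= andbT normr_gt0.
apply: cvgM; last exact: cvg_id.
exact: (@continuous_comp _ _ _ (fun y : R => `|y|) (fun a : R => a `^ (p - 2)) x).
Qed.

End p_power_theory.

Section L2_functions.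
Context d (X : measurableType d) (R : realType) (m : {measure set X -> \bar R}).

Lemma Lfun2_sqi (f : X -> R) : f \in Lfun m 2%:E <-> sqi m f.
Proof.
split.
  move=> lf; split; last exact: Lfun2_integrable_sqr.
  by move: lf; rewrite inE => /andP[]; rewrite inE.
move=> [mf if2]; rewrite inE; apply/andP; split; rewrite inE//=.
rewrite /finite_norm unlock /=; apply: poweR_lty.
have /integrableP[_] := if2; congr (_ < _)%E; apply: eq_integral => x _ /=.
by rewrite ger0_norm ?sqr_ge0// powR_mulrn// real_normK// num_real.
Qed.

Lemma Lnorm2E (f : X -> R) : sqi m f ->
  ('N[m]_2%:E[EFin \o f] = ((\int[m]_x f x ^+ 2) `^ 2^-1)%:E)%E.
Proof.
move=> [mf if2]; rewrite unlock /= -poweR_EFin fin_Rint//; congr (_ `^ _)%E.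
apply: eq_integral => x _ /=.
by rewrite powR_mulrn// real_normK// num_real.
Qed.

End L2_functions.

(** * Product measures and zero extension *)

Section restricted_product.
Context d1 d2 (X : measurableType d1) (Y : measurableType d2) (R : realType).
Variables (m1 : {sigma_finite_measure set X -> \bar R}) (m2 : {sigma_finite_measure set Y -> \bar R}).
Variables (D1 : set X) (mD1 : measurable D1) (fin1 : (m1 D1 < +oo)%E).
Variables (D2 : set Y) (mD2 : measurable D2) (fin2 : (m2 D2 < +oo)%E).
Let r1 : {finite_measure set X -> \bar R} := mfrestr mD1 fin1.
Let r2 : {finite_measure set Y -> \bar R} := mfrestr mD2 fin2.

Let mD : measurable (D1 `*` D2). Proof. exact: measurableX. Qed.
Let finD : ((m1 \x m2)%E (D1 `*` D2) < +oo)%E.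
Proof. by rewrite product_measure1E// lte_mul_pinfty// ge0_fin_numE. Qed.
Let r : {finite_measure set (X * Y)%type -> \bar R} := mfrestr mD finD.

Let prod_restr A : measurable A -> (r1 \x r2)%E A = r A.
Proof.
move=> mA; apply: product_measure_unique => // A1 A2 mA1 mA2.
rewrite /r /r1 /r2 /= /mfrestr /mrestr -setXI product_measure1E//; exact: measurableI.
Qed.

(** The product of the restrictions is the restriction of the product to D1 x
    D2, by uniqueness of product measures. *)
Lemma ae_restr_prod (P : X * Y -> Prop) :
  {ae (m1 \x m2)%E, forall z, (D1 `*` D2) z -> P z} <-> {ae (r1 \x r2)%E, forall z, P z}.
Proof.
rewrite (ae_restr mD finD); split => -[N [mN N0 sN]]; exists N; split => //.
  by rewrite prod_restr.
by rewrite -prod_restr.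
Qed.

Lemma itg_restr_prod (f : X * Y -> R) : measurable_fun setT f ->
  itg (r1 \x r2)%E f <-> (m1 \x m2)%E.-integrable (D1 `*` D2) (EFin \o f).
Proof.
move=> mf; rewrite -(itg_restr mD finD)//.
have e : (\int[(r1 \x r2)%E]_z `|(EFin \o f) z| = \int[r]_z `|(EFin \o f) z|)%E.
  by apply: eq_measure_integral => A mA _; exact: prod_restr.
by split => /integrableP[h1 h2]; apply/integrableP; split => //; rewrite ?e// -?e.
Qed.

End restricted_product.

Section ae_product.
Context d1 d2 (X : measurableType d1) (Y : measurableType d2) (R : realType).
Variables (m1 : {sigma_finite_measure set X -> \bar R}) (m2 : {sigma_finite_measure set Y -> \bar R}).

Lemma ae_prod_iter (P : X * Y -> Prop) : {ae (m1 \x m2)%E, forall z, P z} ->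
  {ae m2, forall y, {ae m1, forall x, P (x, y)}}.
Proof.
move=> [N [mN N0 sN]].
pose u (y : Y) (x : X) : R := \1_N (x, y).
have mu : meas2 u.
  rewrite /meas2 (_ : (fun z => _) = \1_N); first exact: measurable_indic.
  by apply/funext => -[x y].
have u0 : {ae (m1 \x m2)%E, forall z, u z.2 z.1 = 0}.
  exists N; split => // -[x y] /= h; apply: contrapT => nN; apply: h.
  by rewrite /u indicE memNset.
have [_] := ae_prod_12 mu u0; apply: filterS => y; apply: filterS => x.
rewrite /u indicE; case: (boolP ((x, y) \in N)) => [_ /eqP|/negP nN _].
  by rewrite oner_eq0.
by apply: contrapT => nP; apply: nN; apply/mem_set/sN.
Qed.

Lemma ae_prod_snd (Q : Y -> Prop) : {ae m2, forall y, Q y} ->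
  {ae (m1 \x m2)%E, forall z, Q z.2}.
Proof.
move=> [N [mN N0 sN]]; exists (setT `*` N); split.
- exact: measurableX.
- by rewrite product_measure1E// N0 mule0.
- by move=> [x y] /= h; split => //; exact: sN.
Qed.

End ae_product.

Section zero_extension.
Context d (X : measurableType d) (R : realType) (m : {measure set X -> \bar R}).
Variables (D : set X) (mD : measurable D).
Implicit Types f g : X -> R.

Lemma zextE f x : zext D f x = if x \in D then f x else 0.
Proof. by rewrite /zext patchE. Qed.

Lemma zext_id f : (forall x, (\1_D x : R) * f x = f x) -> zext D f = f.
Proof.
move=> h; apply/funext => x; rewrite zextE -(h x) indicE.
by case: (x \in D); rewrite ?mul1r ?mul0r.
Qed.

Lemma zext_chi f x : (\1_D x : R) * zext D f x = zext D f x.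
Proof. by rewrite zextE indicE; case: (x \in D); rewrite ?mul1r ?mul0r. Qed.

Lemma zextB f g x : zext D (f \- g) x = zext D f x - zext D g x.
Proof. by rewrite !zextE; case: ifP; rewrite ?subr0. Qed.

Lemma integrable_vanishing f : (forall x, ~ D x -> f x = 0) ->
  m.-integrable D (EFin \o f) <-> m.-integrable setT (EFin \o f).
Proof.
move=> f0; rewrite integrable_mkcond// (_ : (EFin \o f) \_ D = EFin \o f)//.
apply/funext => x; rewrite patchE; case: (boolP (x \in D)) => // /negP xD.
by rewrite /= f0// => Dx; apply: xD; exact: mem_set.
Qed.

Lemma Rint_vanishing f : (forall x, ~ D x -> f x = 0) ->
  \int[m]_(x in D) f x = \int[m]_x f x.
Proof.
move=> f0; rewrite Rintegral_mkcond; apply: eq_Rint => x.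
rewrite patchE; case: (boolP (x \in D)) => // /negP xD.
by rewrite /= f0// => Dx; apply: xD; exact: mem_set.
Qed.

Hypothesis mfin : (m D < +oo)%E.
Let mr : {finite_measure set X -> \bar R} := mfrestr mD mfin.

Lemma sqi_restr f : (forall x, ~ D x -> f x = 0) -> sqi mr f <-> sqi m f.
Proof.
move=> f0; split => -[mf if2]; split => //.
  apply/integrable_vanishing; last by apply/(itg_restr mD mfin) => //; exact: measurable_funX.
  by move=> x Dx; rewrite f0// expr0n.
apply/(itg_restr mD mfin); first exact: measurable_funX.
by apply/integrable_vanishing => // x Dx; rewrite f0// expr0n.
Qed.

Lemma Rint_restr_vanishing f : measurable_fun setT f -> (forall x, ~ D x -> f x = 0) ->
  \int[mr]_x f x = \int[m]_x f x.
Proof. by move=> mf f0; rewrite Rint_restr// Rint_vanishing. Qed.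

End zero_extension.

Section open_interval.
Context (R : realType) (T : R).
Hypothesis T0 : 0 < T.
Notation leb := (@lebesgue_measure R).

Lemma ae_tau_open : {ae tau T, forall t, 0 < t < T}.
Proof.
exists ([set 0] `|` [set T] `|` ~` `[0, T]); split.
- by apply: measurableU; [apply: measurableU; exact: measurable_set1|apply: measurableC; exact: measurable_itv].
- rewrite measureU0//; last 3 first.
  + by apply: measurableU; exact: measurable_set1.
  + by apply: measurableC; exact: measurable_itv.
  + by rewrite /tau /= /mfrestr /mrestr setICl measure0.
  rewrite measureU0; [exact: tau_set1|exact: measurable_set1|exact: measurable_set1|exact: tau_set1].
- move=> t /= nt; have [tT|tT] := pselect (t \in `[0, T]); last by right.
  left; move: tT nt; rewrite in_itv/= => /andP[]; rewrite !le_eqVlt => /predU1P[<-|t0]; first by left.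
  by move=> /predU1P[->|tT]; [right|rewrite t0 tT].
Qed.

Lemma Rint_tau_open (h h' : R -> R) : measurable_fun setT h ->
  (forall t, 0 < t < T -> h t = h' t) ->
  \int[tau T]_s h s = \int[leb]_(s in `]0, T[) h' s.
Proof.
move=> mh hh'; rewrite Rint_tau// /Rintegral integral_itv_bndoo; last first.
  by apply: measurable_funTS; exact/measurable_EFinP.
by congr fine; apply: eq_integral => t; rewrite inE/= in_itv/= => /hh' ->.
Qed.

End open_interval.

(** * Weak solutions and solutions on the domain *)

Section translation.
Context (R : realType) (N : nat).
Notation V := 'rV[R]_N.
Notation TR := (measurableTypeR R).
Notation leb := (@lebesgue_measure R).
Notation lebN := (lebesgue_rV N).
Variables (Omega E : set V).
Hypothesis mOm : measurable Omega.
Hypothesis mE : measurable E.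
Hypothesis Efin : (lebN E < +oo)%E.
Hypothesis OmE : Omega `<=` E.
Variable J : V -> R.
Notation k := (conv_kernel J).
Variable M : R.
Hypothesis mk : measurable_fun setT (fun z : V * V => k z.1 z.2).
Hypothesis k_ge0 : forall x y, 0 <= k x y.
Hypothesis k_le : forall x y, k x y <= M.
Hypothesis k_sym : forall x y, k x y = k y x.
Hypothesis M0 : 0 <= M.
Variables T p : R.
Hypothesis T0 : 0 < T.
Hypothesis p_gt1 : 1 < p.

Let mu : {finite_measure set V -> \bar R} := mfrestr mE Efin.
Notation phi := (p_power p).
Notation chi := (\1_Omega : V -> R).

(** The representative of u on the whole space-time that vanishes outside
    Omega and outside [0, T]. *)
Definition cut (u : R -> V -> R) (t : R) (x : V) : R :=
  if t \in `[0, T] then zext Omega (u t) x else 0.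

Lemma cutE u t : t \in `[0, T] -> cut u t = zext Omega (u t).
Proof. by move=> tT; apply/funext => x; rewrite /cut tT. Qed.

Lemma cut_chi u t x : chi x * cut u t x = cut u t x.
Proof. by rewrite /cut; case: ifP => _; rewrite ?mulr0// zext_chi. Qed.

Lemma start_mem : 0 \in `[0, T]. Proof. by rewrite in_itv/= lexx ltW. Qed.
Lemma end_mem : T \in `[0, T]. Proof. by rewrite in_itv/= lexx ltW. Qed.

Lemma mcyl (A : set V) : measurable A -> measurable (cylinder A T).
Proof. by move=> mA; apply: measurableX => //; exact: measurable_itv. Qed.

(** Joint measurability of u is known on the open cylinder only; the slices at
    times 0 and T are measurable separately. *)
Lemma meas_cut u : measurable_fun (cylinder Omega T) (uncurry_xt u) ->
  measurable_fun setT (zext Omega (u 0)) -> measurable_fun setT (zext Omega (u T)) ->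
  meas2 (cut u : TR -> V -> R).
Proof.
move=> mu_ m0 mT.
rewrite /meas2 (_ : (fun z => _) = (fun z : V * TR => (uncurry_xt u \_ (cylinder Omega T)) z +
    (z.2 == 0)%:R * zext Omega (u 0) z.1 + (z.2 == T)%:R * zext Omega (u T) z.1)).
  have meq (c : R) : measurable_fun setT (fun z : V * TR => (z.2 == c)%:R : R).
    rewrite (_ : (fun z => _) = (fun z : V * TR => \1_[set c] z.2)); last first.
      apply/funext => z; rewrite indicE (_ : (z.2 \in [set c]) = (z.2 == c))//.
      by apply/idP/eqP => [/set_mem|->]//; exact: mem_set.
    by apply: measurableT_comp => //; apply: measurable_indic; exact: measurable_set1.
  apply: measurable_funD; first apply: measurable_funD.
  - exact: (measurable_restrictT _ (mcyl mOm)).1.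
  - by apply: measurable_funM => //; exact: (measurableT_comp m0 measurable_fst).
  - by apply: measurable_funM => //; exact: (measurableT_comp mT measurable_fst).
apply/funext => -[x t] /=; rewrite patchE /cut in_itv/= !zextE.
have -> : ((x, t) \in cylinder Omega T) = (x \in Omega) && (0 < t < T).
  apply/idP/idP; first by move=> /set_mem[/= h]; rewrite in_itv/= => ->; rewrite mem_set.
  by move=> /andP[/set_mem h1 h2]; apply/mem_set; split => //=; rewrite in_itv.
have [->|t0] := eqVneq t 0.
  rewrite lexx (ltW T0) ltxx andbF add0r mul1r (lt_eqF T0) mul0r addr0.
  by case: ifP.
have [->|tT] := eqVneq t T.
  by rewrite lexx (ltW T0) ltxx !andbF mul0r !add0r mul1r.
rewrite !mul0r !addr0 !le_eqVlt eq_sym (negbTE t0) (negbTE tT) /=.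
by case: (_ < _ < _); rewrite ?andbT ?andbF//; case: ifP.
Qed.

Lemma NL_integrandE v x y : NL_integrand J v x y = k x y * v y - v x * k x y.
Proof. by rewrite /NL_integrand /conv_kernel mulrBr [v x * _]mulrC. Qed.

Lemma meas_kv v x : measurable_fun setT v -> measurable_fun setT (fun y => k x y * v y).
Proof. by move=> mv; apply: measurable_funM => //; exact: (meas_k mk). Qed.

Lemma meas_NL_integrand v x : measurable_fun setT v -> measurable_fun setT (NL_integrand J v x).
Proof.
move=> mv; rewrite (_ : NL_integrand J v x = fun y => k x y * v y - v x * k x y).
  apply: measurable_funB; first exact: meas_kv.
  by apply: measurable_funM => //; exact: (meas_k mk).
by apply/funext => y; exact: NL_integrandE.
Qed.

Let ik x : itg mu (k x). Proof. exact: (k_itg mu mk k_ge0 k_le). Qed.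

Lemma NL_definedE v x : measurable_fun setT v ->
  NL_defined_at J E v x <-> itg mu (fun y => k x y * v y).
Proof.
move=> mv; rewrite /NL_defined_at -(itg_restr mE Efin); last exact: meas_NL_integrand.
split => h.
  by apply: (itg_ext _ (itgD h (itgZ (v x) (ik x)))) => y; rewrite NL_integrandE subrK.
by apply: (itg_ext _ (itgB h (itgZ (v x) (ik x)))) => y; rewrite NL_integrandE.
Qed.

Lemma NL_laplacianE v x : measurable_fun setT v -> itg mu (fun y => k x y * v y) ->
  NL_laplacian J E v x = Dop mu k v x.
Proof.
move=> mv iv; rewrite /NL_laplacian -(Rint_restr mE Efin); last exact: meas_NL_integrand.
rewrite (eq_Rint mu (g := fun y => k x y * v y - v x * k x y)); last first.
  by move=> y; rewrite NL_integrandE.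
by rewrite RintB// ?RintZ//; [rewrite /Dop [v x * _]mulrC|exact: itgZ].
Qed.

Lemma p_fluxE u t : t \in `[0, T] -> sqi mu (cut u t) ->
  p_flux J E Omega p (u t) = flux mu k phi (cut u t).
Proof.
move=> tT su; apply/funext => x; rewrite /p_flux /flux -cutE// NL_laplacianE//.
  exact: su.1.
by apply: (kf_itg mk k_ge0 k_le); exact: sqi_itg.
Qed.

Lemma zext_out (f : V -> R) x : ~ E x -> zext Omega f x = 0.
Proof. by move=> nEx; rewrite zextE memNset// => /OmE. Qed.

Lemma cut_out u t x : ~ E x -> cut u t x = 0.
Proof. by move=> nEx; rewrite /cut zext_out//; case: ifP. Qed.

Lemma LpOn2E (f : V -> R) : LpOn lebN Omega 2 f <-> sqi mu (zext Omega f).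
Proof.
rewrite /LpOn /= (sqi_restr mE Efin); first exact: Lfun2_sqi.
by move=> x; exact: zext_out.
Qed.

Definition L2dist u s t := \int[mu]_x (cut u s x - cut u t x) ^+ 2.

Lemma LpNorm2E u s t : s \in `[0, T] -> t \in `[0, T] -> sqi mu (cut u s) -> sqi mu (cut u t) ->
  LpNorm_on lebN Omega 2 (u s \- u t) = (Num.sqrt (L2dist u s t))%:E.
Proof.
move=> sT tT us ut; have sd := sqiB us ut.
have e : zext Omega (u s \- u t) = fun x => cut u s x - cut u t x.
  by apply/funext => x; rewrite zextB !cutE.
have out x : ~ E x -> cut u s x - cut u t x = 0 by move=> nE; rewrite !cut_out// subrr.
rewrite /LpNorm_on e Lnorm2E; last by apply/(sqi_restr mE Efin).
rewrite /L2dist Rint_restr_vanishing; first by rewrite powR12_sqrt// Rint_ge0// => x; exact: sqr_ge0.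
  by apply: measurable_funX; exact: sd.1.
by move=> x nE; rewrite out// expr0n.
Qed.

Lemma continuous_L2E u : (forall t, t \in `[0, T] -> sqi mu (cut u t)) ->
  (forall t, t \in `[0, T] ->
     LpNorm_on lebN Omega 2 (u s \- u t) @[s --> within `[0, T] (nbhs t)] --> 0%E) <->
  L2_continuous mu T (cut u).
Proof.
move=> su; split => h t tT.
  move=> e e0; have se : 0 < Num.sqrt e by rewrite sqrtr_gt0.
  have := h t tT; move/fine_cvg => /cvgr0Pnorm_le/(_ _ se).
  rewrite near_withinE => /nbhs_ballP[d d0 hd]; exists d => // s sT st.
  have B : ball t d s by rewrite /ball/= distrC.
  have := hd s B sT; rewrite /= (LpNorm2E sT tT (su s sT) (su t tT)) /= ger0_norm ?sqrtr_ge0//.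
  by rewrite ler_sqrt ?(ltW e0).
have fE s : s \in `[0, T] -> LpNorm_on lebN Omega 2 (u s \- u t) = (Num.sqrt (L2dist u s t))%:E.
  by move=> sT; apply: LpNorm2E => //; exact: su.
apply: cvg_EFin.
  by rewrite near_withinE; apply: nearW => s sT; rewrite fE.
apply/cvgr0Pnorm_le => e e0; rewrite near_withinE.
have e2 : 0 < e ^+ 2 by rewrite exprn_gt0.
have [d d0 hd] := h t tT _ e2.
apply/nbhs_ballP; exists d => // s; rewrite /ball/= distrC => st sT.
have := hd s sT st; rewrite -/(L2dist u s t) /= fE// => h1.
rewrite ger0_norm ?sqrtr_ge0// -(ger0_norm (ltW e0)) -sqrtr_sqr.
exact: ler_wsqrtr.
Qed.

Lemma ae_spacetime (P : V * TR -> Prop) :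
  {ae spacetime_measure, forall z, (E `*` `[0, T]) z -> P z} <-> {ae (mu \x tau T)%E, forall z, P z}.
Proof. exact: (ae_restr_prod mE Efin (mitv0T T) (itv0T_fin T)). Qed.

Lemma itg_spacetime (f : V * TR -> R) : measurable_fun setT f ->
  (forall z, ~ (E `*` `[0, T]) z -> f z = 0) ->
  itg (mu \x tau T)%E f <-> itg spacetime_measure f.
Proof.
move=> mf f0; rewrite (itg_restr_prod mE Efin (mitv0T T) (itv0T_fin T))//.
apply: integrable_vanishing => //; exact: measurableX.
Qed.

Lemma cyl_sub (A : set V) : A `<=` E -> cylinder A T `<=` E `*` `[0, T].
Proof.
move=> AE [x t] [/= Ax]; rewrite in_itv/= => /andP[t0 tT]; split => /=; first exact: AE.
by rewrite in_itv/= !ltW.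
Qed.

(** The endpoints of [0, T] are negligible. *)
Lemma ae_cylinder_iter (A : set V) (P : V * TR -> Prop) : A `<=` E ->
  {ae spacetime_measure, forall z, cylinder A T z -> P z} ->
  {ae tau T, forall t, {ae mu, forall x, A x -> P (x, t)}}.
Proof.
move=> AE h.
have FS : Filter (nbhs (almost_everywhere (@spacetime_measure R N))) by exact: ae_filter_ringOfSetsType.
have h1 : {ae spacetime_measure, forall z, (E `*` `[0, T]) z -> cylinder A T z -> P z}.
  by apply: filterS h => z hz _.
have FF : Filter (nbhs (almost_everywhere (tau T))) by exact: ae_filter_ringOfSetsType.
have := (ae_spacetime _).1 h1 => /ae_prod_iter h2.
apply: filterS2 h2 (ae_tau_open T) => t ht tT; apply: filterS ht => x hx Ax.
by apply: hx; split => //=; rewrite in_itv.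
Qed.

Lemma ae_cylinder_prod (A : set V) (P : V * TR -> Prop) : A `<=` E ->
  {ae (mu \x tau T)%E, forall z, A z.1 -> P z} ->
  {ae spacetime_measure, forall z, cylinder A T z -> P z}.
Proof.
move=> AE /ae_spacetime.
have FS : Filter (nbhs (almost_everywhere (@spacetime_measure R N))) by exact: ae_filter_ringOfSetsType.
apply: filterS => z hz cz; apply: hz; last by case: cz.
exact: (cyl_sub AE).
Qed.

Variable a0 : R.
Hypothesis a00 : 0 < a0.
Hypothesis deg : (forall x, Omega x -> a0 <= degree mu k x) \/ (forall x y, k x y = 0).
Variable u0 : V -> R.

Notation weak_sol := (weak_solution mu k Omega phi T (zext Omega u0)).

(** The time derivative of a solution is known, and measurable, on the open
    cylinder only. *)
Definition cylinder_cut (g : R -> V -> R) (t : R) (x : V) : R :=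
  zext (cylinder Omega T) (uncurry_xt g) (x, t).

Lemma cylinder_cut_in g t x : 0 < t < T -> Omega x -> cylinder_cut g t x = g t x.
Proof.
by move=> tT Ox; rewrite /cylinder_cut zextE mem_set//; split => //=; rewrite in_itv.
Qed.

Lemma cylinder_cut_out g t x : ~ Omega x -> cylinder_cut g t x = 0.
Proof. by move=> nOx; rewrite /cylinder_cut zextE memNset// => -[]. Qed.

Lemma cut_outO u t x : ~ Omega x -> cut u t x = 0.
Proof. by move=> nOx; rewrite /cut zextE memNset//; case: ifP. Qed.

Lemma cut_inO u t x : 0 < t < T -> Omega x -> cut u t x = u t x.
Proof.
by move=> /andP[t0 tT] Ox; rewrite /cut in_itv/= !ltW// zextE mem_set.
Qed.

Let cphi : continuous phi. Proof. exact: p_power_continuous. Qed.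
Let ndphi : {homo phi : x y / x <= y}. Proof. exact: p_power_nd. Qed.
Let phi0 : phi 0 = 0. Proof. exact: p_power0. Qed.

Lemma test_function_meas f : test_function T f ->
  measurable_fun setT f /\ measurable_fun setT (derive1 f).
Proof.
move=> [sf _ _]; split; apply: continuous_measurable_fun.
  exact: (@smooth_continuous R f 0 sf).
exact: (@smooth_continuous R f 1 sf).
Qed.

Theorem is_solution_weak u : is_solution J Omega E p T u0 u ->
  exists g, weak_sol (cut u) g.
Proof.
move=> [[mu_ Lu cu] nld [g [Lg wg eg]] iu].
have FF : Filter (nbhs (almost_everywhere (tau T))) by exact: ae_filter_ringOfSetsType.
have su t : t \in `[0, T] -> sqi mu (cut u t).
  by move=> tT; rewrite cutE//; apply/LpOn2E; exact: Lu.
have mc : meas2 (cut u : TR -> V -> R).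
  apply: meas_cut => //.
    by have [] := (LpOn2E _).1 (Lu _ start_mem).
  by have [] := (LpOn2E _).1 (Lu _ end_mem).
have [mg g2] := (Lfun2_sqi _ _).1 Lg.
have mg2 : meas2 (cylinder_cut g : TR -> V -> R).
  by move: mg; congr (measurable_fun _ _); apply: funext => -[x t].
have fluxd : {ae tau T, forall t, {ae mu, forall x, itg mu (fun y => k x y * flux mu k phi (cut u t) y)}}.
  have h1 := @ae_cylinder_iter E _ (@subset_refl _ E) nld.
  have hE : {ae mu, forall x, E x} by apply/(ae_restr mE Efin); exact: aeW.
  apply: filterS2 h1 (ae_tau_open T) => t ht t0T.
  have tT : t \in `[0, T] by move: t0T => /andP[? ?]; rewrite in_itv/= !ltW.
  apply: filterS2 ht hE => x hx Ex; have /= := hx Ex.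
  rewrite (p_fluxE tT (su t tT)) => /NL_definedE; apply.
  by apply: meas_phi_flux => //; exact: (su t tT).1.
exists (cylinder_cut g); split.
- exact: mc.
- exact: cut_chi.
- exact: su.
- exact/continuous_L2E.
- exact: mg2.
- apply/(itg_spacetime (f := fun z => cylinder_cut g z.2 z.1 ^+ 2)).
  + exact: (measurable_funX 2 mg2).
  + move=> [x t] nz; rewrite /= /cylinder_cut zextE memNset ?expr0n// => cz.
    by apply: nz; exact: (cyl_sub OmE).
  + apply: itg_ext g2 => -[x t]; by [].
- move=> f tf; have [mf mdf] := test_function_meas tf.
  have h : {ae mu, forall x, Omega x ->
      \int[leb]_(t in `]0, T[) (derive1 f t * u t x) = - \int[leb]_(t in `]0, T[) (f t * g t x)}.
    by apply/(ae_restr mE Efin); apply: filterS (wg f tf) => x hx _.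
  apply: filterS h => x hx; have [Ox|nOx] := pselect (Omega x).
    rewrite (@Rint_tau_open R T (fun s => derive1 f s * cut u s x) (fun s => derive1 f s * u s x)).
    + rewrite (@Rint_tau_open R T (fun s => f s * cylinder_cut g s x) (fun s => f s * g s x)).
      * exact: hx.
      * by apply: measurable_funM => //; exact: (meas2_2 x mg2).
      * by move=> t tT; rewrite cylinder_cut_in.
    + by apply: measurable_funM => //; exact: (meas2_2 x mc).
    + by move=> t tT; rewrite cut_inO.
  rewrite (eq_Rint (tau T) (g := fun=> 0)); last by move=> s; rewrite cut_outO// mulr0.
  rewrite (eq_Rint (tau T) (f := fun s => f s * cylinder_cut g s x) (g := fun=> 0)); last first.
    by move=> s; rewrite cylinder_cut_out// mulr0.
  by rewrite Rint_zero oppr0.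
- exact: fluxd.
- have h1 := @ae_cylinder_iter Omega _ OmE eg.
  apply: filterS3 h1 fluxd (ae_tau_open T) => t ht kt t0T.
  have tT : t \in `[0, T] by move: t0T => /andP[? ?]; rewrite in_itv/= !ltW.
  apply: filterS2 ht kt => x hx kx; have [Ox|nOx] := pselect (Omega x); last first.
    by rewrite cylinder_cut_out// /field indicE memNset// mul0r oppr0.
  rewrite cylinder_cut_in// /field indicE mem_set// mul1r; have /= -> := hx Ox.
  rewrite (p_fluxE tT (su t tT)) NL_laplacianE//.
  by apply: meas_phi_flux => //; exact: (su t tT).1.
- have h : {ae mu, forall x, Omega x -> u 0 x = u0 x}.
    by apply/(ae_restr mE Efin); apply: filterS iu => x hx _.
  apply: filterS h => x hx; rewrite cutE ?start_mem// !zextE.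
  by case: (boolP (x \in Omega)) => // /set_mem; exact: hx.
Qed.

Theorem weak_is_solution u g : weak_sol u g -> is_solution J Omega E p T u0 u.
Proof.
move=> ws.
have FF : Filter (nbhs (almost_everywhere (tau T))) by exact: ae_filter_ringOfSetsType.
have FS : Filter (nbhs (almost_everywhere (@spacetime_measure R N))) by exact: ae_filter_ringOfSetsType.
have FP : Filter (nbhs (almost_everywhere (mu \x tau T)%E)) by exact: ae_filter_ringOfSetsType.
have zu t : zext Omega (u t) = u t by apply: zext_id => x; exact: (ws_chi ws).
have cu t : t \in `[0, T] -> cut u t = u t by move=> tT; rewrite cutE// zu.
have su t : t \in `[0, T] -> sqi mu (cut u t) by move=> tT; rewrite cu//; exact: (ws_sqi ws).
have mg := ws_dmeas ws.
have sw : {ae tau T, forall t, t \in `[0, T] /\ sqi mu (flux mu k phi (u t))}.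
  have hin : {ae tau T, forall t, t \in `[0, T]} by apply/ae_tau; exact: aeW.
  apply: filterS3 (filterI (ws_flux ws) hin) (ws_eq ws) (itg2_ae1 (ws_dsqr ws)) => t [kt tT] et gt.
  split => //; apply: (weak_power mk k_ge0 k_le k_sym mOm M0 cphi ndphi phi0 a00 deg ws tT kt et).
  by split => //; exact: (meas2_1 t mg).
have pf t : t \in `[0, T] -> p_flux J E Omega p (u t) = flux mu k phi (u t).
  by move=> tT; rewrite (p_fluxE tT (su t tT)) cu.
have mflux t : t \in `[0, T] -> measurable_fun setT (flux mu k phi (u t)).
  by move=> tT; apply: meas_phi_flux => //; exact: (ws_sqi ws tT).1.
have kflux t x : sqi mu (flux mu k phi (u t)) -> itg mu (fun y => k x y * flux mu k phi (u t) y).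
  by move=> sf; apply: (kf_itg mk k_ge0 k_le); exact: sqi_itg.
split.
- split.
  + apply: measurable_funTS; exact: (ws_meas ws).
  + by move=> t tT; apply/LpOn2E; rewrite -cutE//; exact: su.
  + apply/continuous_L2E => // t tT e e0; have [d d0 hd] := ws_cont ws tT e0.
    by exists d => // s sT st; rewrite !cu//; exact: hd.
- apply: (ae_cylinder_prod (A := E)) => //.
  apply: filterS (ae_prod_snd mu sw) => -[x t] /= [tT sf] _.
  by rewrite pf//; apply/NL_definedE; [exact: mflux|exact: kflux].
- exists g; split.
  + apply/Lfun2_sqi; split.
      apply: (measurable_restrictT _ (mcyl mOm)).1; apply: measurable_funTS; exact: mg.
    have mz : measurable_fun setT (zext (cylinder Omega T) (uncurry_xt g)).
      apply: (measurable_restrictT _ (mcyl mOm)).1; apply: measurable_funTS; exact: mg.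
    apply/(itg_spacetime (f := fun z => zext (cylinder Omega T) (uncurry_xt g) z ^+ 2)).
    * exact: measurable_funX.
    * move=> z nz; rewrite zextE memNset ?expr0n// => cz.
      by apply: nz; exact: (cyl_sub OmE).
    * apply: (itg_le _ (ws_dsqr ws)); first exact: measurable_funX.
      move=> z; rewrite ger0_norm ?sqr_ge0// zextE; case: ifP => // _.
      by rewrite expr0n sqr_ge0.
  + move=> f tf; have [mf mdf] := test_function_meas tf.
    have := (ae_restr mE Efin _).2 (ws_weak ws tf); apply: filterS => x hx Ox.
    have := hx (OmE Ox).
    rewrite (@Rint_tau_open R T (fun s => derive1 f s * u s x) (fun s => derive1 f s * u s x))//.
      rewrite (@Rint_tau_open R T (fun s => f s * g s x) (fun s => f s * g s x))//.
      by apply: measurable_funM => //; exact: (meas2_2 x mg).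
    by apply: measurable_funM => //; exact: (meas2_2 x (ws_meas ws)).
  + have mw : meas2 ((fun t => flux mu k phi (u t)) : TR -> V -> R).
      apply: (measurableT_comp (f := phi)); first exact: continuous_measurable_fun.
      by apply: (meas_Dop mu mk); exact: (ws_meas ws).
    have mF : meas2 ((fun t => field mu k Omega phi (u t)) : TR -> V -> R).
      apply: measurableT_comp => //; apply: measurable_funM; first exact: meas_chi.
      exact: (meas_Dop mu mk (u := fun t => flux mu k phi (u t)) mw).
    pose r t x := g t x - field mu k Omega phi (u t) x.
    have mr : meas2 (r : TR -> V -> R) by exact: measurable_funB.
    have r0 : {ae (mu \x tau T)%E, forall z, r z.2 z.1 = 0}.
      apply: ae_prod_swap => //; apply: filterS (ws_eq ws) => t; apply: filterS => x e.
      by rewrite /r e subrr.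
    apply: (ae_cylinder_prod (A := Omega)) => //.
    apply: filterS2 r0 (ae_prod_snd mu sw) => -[x t] /= h [tT sf] Ox.
    move/eqP : h; rewrite /r subr_eq0 => /eqP ->.
    rewrite /field indicE mem_set// mul1r pf// NL_laplacianE//; [exact: mflux|exact: kflux].
- have := (ae_restr mE Efin _).2 (ws_init ws); apply: filterS => x hx Ox.
  by rewrite (hx (OmE Ox)) zextE mem_set.
Qed.

End translation.

(** * The theorem *)

Section initial_energy.
Context d (X : measurableType d) (R : realType) (mu : {finite_measure set X -> \bar R}).
Variables (k : X -> X -> R) (M : R).
Hypothesis mk : measurable_fun setT (fun z : X * X => k z.1 z.2).
Hypothesis k_ge0 : forall x y, 0 <= k x y.
Hypothesis k_le : forall x y, k x y <= M.
Hypothesis M0 : 0 <= M.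
Variable p : R.
Hypothesis p_gt1 : 1 < p.

(** The energy density is |Dop f|^p, and |Dop f| <= C (1 + |f|), so that
    integrability of |f|^p suffices. *)
Lemma p_energy_itg f : sqi mu f -> itg mu (fun x => `|f x| `^ p) ->
  itg mu (fun x => Dop mu k f x * p_power p (Dop mu k f x)).
Proof.
move=> sf ifp; have fi := sqi_itg sf; have p0 : 0 <= p by rewrite ltW// (lt_trans _ p_gt1).
set C := M * \int[mu]_y `|f y| + M * mass mu.
have I0 : 0 <= \int[mu]_y `|f y| by apply: Rint_ge0.
have C0 : 0 <= C by rewrite addr_ge0 ?mulr_ge0 ?mass_ge0.
have mD : measurable_fun setT (Dop mu k f) by apply: meas_Dop1 => //; exact: sf.1.
apply: (itg_le _ (itgZ (C `^ p * 2 `^ p) (itgD (itg_cst mu 1) ifp))).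
  apply: measurable_funM => //; apply: measurableT_comp => //.
  by apply: continuous_measurable_fun; exact: p_power_continuous.
move=> x; rewrite p_power_energy// ger0_norm ?powR_ge0//.
have h : `|Dop mu k f x| <= C * (2 * Num.max 1 `|f x|).
  apply: (le_trans (Dop_abs mk k_ge0 k_le x fi)).
  have m1 : 1 <= Num.max 1 `|f x| by rewrite le_max lexx.
  have m2 : `|f x| <= Num.max 1 `|f x| by rewrite le_max lexx orbT.
  have h1 : M * \int[mu]_y `|f y| <= M * \int[mu]_y `|f y| * (2 * Num.max 1 `|f x|).
    by rewrite ler_peMr ?mulr_ge0//; lra.
  rewrite mulrDl; apply: lerD => //.
  apply: ler_wpM2l; first by rewrite mulr_ge0 ?mass_ge0.
  lra.
apply: (@le_trans _ _ ((C * (2 * Num.max 1 `|f x|)) `^ p)).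
  by apply: ge0_ler_powR => //; rewrite nnegrE// (le_trans _ h).
have m0 : 0 <= Num.max 1 `|f x| by rewrite le_max ler01.
rewrite powRM ?mulr_ge0// powRM// -mulrA; apply: ler_wpM2l; first exact: powR_ge0.
apply: ler_wpM2l; first exact: powR_ge0.
case: (leP 1 `|f x|) => _; first by rewrite lerDr.
by rewrite powR1 lerDl powR_ge0.
Qed.

End initial_energy.

Unset Implicit Arguments.

Theorem theorem2p2 (R : realType) (N : nat) (N_ge2 : (2 <= N)%N)
  (Omega OmegaE : set 'rV[R]_N)
  (Omega_dom : is_domain Omega) (Omega_bdd : bounded_set Omega)
  (OmegaE_dom : is_domain OmegaE) (OmegaE_bdd : bounded_set OmegaE)
  (J : 'rV[R]_N -> R)
  (J_ge0 : forall x, 0 <= J x) (J_cont : continuous J)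
  (J_radial : radial J) (J_supp : compact (supp J))
  (Omega_sub : Omega `<=` OmegaE)
  (Omega_supp_sub :
     [set x + 2 *: z | x in Omega & z in supp J] `<=` OmegaE)
  (T p : R) (T_gt0 : 0 < T) (p_gt1 : 1 < p)
  (u0 : 'rV[R]_N -> R)
  (u0_L2 : LpOn (lebesgue_rV N) Omega 2 u0)
  (u0_Lp : LpOn (lebesgue_rV N) Omega p u0) :
  exists u : R -> 'rV[R]_N -> R,
    is_solution J Omega OmegaE p T u0 u /\
    forall v : R -> 'rV[R]_N -> R, is_solution J Omega OmegaE p T u0 v ->
      forall t, t \in `[0, T] ->
        {ae lebesgue_rV N, forall x, Omega x -> v t x = u t x}.
Proof.
have mOm : measurable Omega by case: Omega_dom => _ ? _; exact: open_measurable_rV.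
have mE : measurable OmegaE by case: OmegaE_dom => _ ? _; exact: open_measurable_rV.
have Efin := bounded_lebesgue_fin mE OmegaE_bdd.
pose mu : {finite_measure set 'rV[R]_N -> \bar R} := mfrestr mE Efin.
have [M M0 kM] := conv_kernel_bounded J_cont J_supp.
have mk := conv_kernel_meas J_cont.
have k_ge0 x y : 0 <= conv_kernel J x y by exact: J_ge0.
have k_sym := conv_kernel_sym J_radial.
have muE A : measurable A -> A `<=` OmegaE -> mu A = lebesgue_rV N A.
  by move=> mA AE; rewrite /mu /= /mfrestr /mrestr setIidl.
have [_ oE cE] := OmegaE_dom.
have [a0 a00 deg] := degree_lower_bound J_ge0 J_cont J_radial J_supp Omega_bdd
  Omega_sub oE cE Omega_supp_sub muE (ltnW N_ge2).
have su0 : sqi mu (zext Omega u0) by apply/(LpOn2E mE Efin Omega_sub).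
have chi0 x : (\1_Omega x : R) * zext Omega u0 x = zext Omega u0 x by exact: zext_chi.
have pw0 : itg mu (fun x => `|zext Omega u0 x| `^ p).
  have := Lfun_integrable (ltW p_gt1) u0_Lp => ip.
  have mp : measurable_fun setT (fun x => `|zext Omega u0 x| `^ p).
    by have /measurable_EFinP := measurable_int _ ip.
  apply/(itg_restr mE Efin) => //.
  exact: integrableS ip.
have en := p_energy_itg mk k_ge0 kM M0 p_gt1 su0 pw0.
have [u [g ws]] := weak_existence mk k_ge0 kM k_sym mOm T_gt0 M0 su0 chi0
  (p_power_continuous p_gt1) (p_power_nd p_gt1) (p_power0 p) a00 deg en.
have su := weak_is_solution mOm Omega_sub mk k_ge0 kM k_sym M0 p_gt1 a00 deg ws.
exists u; split => // v sv t tT.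
have [h wv] := is_solution_weak mOm mE Efin Omega_sub mk k_ge0 kM T_gt0 p_gt1 sv.
have uq := weak_uniqueness mk k_ge0 kM k_sym mOm M0 (p_power_continuous p_gt1)
  (p_power_nd p_gt1) (p_power0 p) a00 deg T_gt0 wv ws tT.
have := (ae_restr mE Efin _).2 uq; apply: filterS => x hx Ox.
by rewrite -(hx (Omega_sub x Ox)) cutE// zextE mem_set.
Qed.
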